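(* Let $\mu\in(\mathcal R_{\underline k}\setminus\mathcal D_{\underline k})\cap(\mathbb R^2\setminus\mathbb Z^2)$. There exists $\epsilon_0=\epsilon_0(\mu)>0$ such that for any $\epsilon\in(0,\epsilon_0)$ the operator $\mathscr L_{\mu,\epsilon}:\mathcal V_{\mu,\epsilon}\to\mathcal V_{\mu,\epsilon}$ is represented (with respect to a suitable basis of the two-dimensional space $\mathcal V_{\mu,\epsilon}$) by the $2\times2$ matrix $$\begin{pmatrix}\lambda^++\mathrm i\,r_1(\epsilon^2)& \mathrm i\,\mathtt b_0(\mu)\epsilon+\mathrm i\,r_2(\epsilon^2)\\ \mathrm i\,\mathtt b_1(\mu)\epsilon+\mathrm i\,r_3(\epsilon^2)&\lambda^++\mathrm i\,r_4(\epsilon^2)\end{pmatrix},$$ where $$\mathtt b_1(\mu)=(\underline k^\perp\cdot\mu)\frac{(|\underline k+\mu|-|\underline k|)(|\underline k+\mu|+|\underline k|-|\mu|)}{4N|\underline k||\mu||\underline k+\mu|},\qquad \mathtt b_0(\mu)=-(\underline k^\perp\cdot\mu)\frac{(|\underline k|+|\mu|)(|\underline k+\mu|+|\underline k|-|\mu|)}{4N|\underline k||\mu||\underline k+\mu|}.$$ Its eigenvalues are given by $$\lambda^\pm(\mu,\epsilon)=\lambda^++\mathrm i\,r(\epsilon^2)\pm\epsilon\sqrt{\mathtt e(\mu)+r(\epsilon)},$$ where $$\mathtt e(\mu)=-\mathtt b_1(\mu)\mathtt b_0(\mu)=(\underline k^\perp\cdot\mu)^2\,\frac{(|\underline k+\mu|-|\underline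 k|)(|\underline k|+|\mu|)(|\underline k+\mu|+|\underline k|-|\mu|)^2}{16N^2|\mu|^2|\underline k+\mu|^2|\underline k|^2}.$$ In particular: (1) (small Floquet parameter) writing $\mu(\tau)=(\varphi_+(n\tau),n\tau)^T$ if $\tau>0$, $\mu(0)=0$, and $\mu(\tau)=(\varphi_-(n\tau),n\tau)^T$ if $\tau<0$, one has $$\mathtt e(\mu(\tau))=\frac{m^2n^2}{4N^2|\underline k|^2}\,\tau+\mathcal O(\tau^2)\quad\text{as }\tau\to0;$$ (2) (large Floquet parameter) writing $\mu(\tau)=(\varphi_+(\tau),\tau)^T$, one has $$\mathtt e(\mu(\tau))=\frac{m^2}{256N^2|\underline k|^6}\left(n-\sqrt{3m^2+4n^2}\right)^2\left(3m^2+2n^2+n\sqrt{3m^2+4n^2}\right)^2+\mathcal O(\tau^{-1})\quad\text{as }\tau\to+\infty.$$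
   Context: Fix $N>0$ and $\underline k=(m,n)^T\in\mathbb Z^2$ with $m,n>0$. For $a=(a_1,a_2)$ put $a^\perp=(a_2,-a_1)$; $\nabla^\perp=(\partial_y,-\partial_x)^T$; $\mathbb T^2=(\mathbb R/2\pi\mathbb Z)^2$. Let $\Omega(\xi)=N\xi_1/|\xi|$ for $\xi\in\mathbb R^2\setminus\{0\}$, $\Omega(0)=0$, $\underline c=\frac{Nm}{|\underline k|^3}\underline k$, and for $j\in\mathbb Z^2$, $\sigma=\pm$, $w^\sigma_j(\mu)=\underline c\cdot(j+\mu)+\sigma\Omega(j+\mu)$. Resonant set: $\mathcal R_{\underline k}=\{0\}\cup\{\mu\in\mathbb R^2\setminus\{0\}:\Omega(\underline k)-\Omega(\underline k+\mu)=\Omega(\mu)\}$; on it $w^-_{\underline k}(\mu)=w^+_0(\mu)$. $\mathcal D_{\underline k}\subset\mathcal R_{\underline k}$ is a fixed discrete set containing $0$ such that for every $\mu\in\mathcal R_{\underline k}\setminus\mathcal D_{\underline k}$ there is $\alpha=\alpha(\mu)>0$ with $\inf_{\ell\in\mathbb Z,\ell\ne0}|w^+_{\ell\underline k}(\mu)-w^+_0(\mu)|\ge\alpha N$ and $\inf_{\ell\in\mathbb Z,\ell\neq1}|w^-_{\ell\underline k}(\mu)-w^-_{\underline k}(\mu)|\ge\alpha N$ (such a set exists). Functions $\varphi_\pm$: for $y>0$, $\varphi_+(y)$ is the unique $x\in\mathbb R$ with $(x,y)\in\mathcal R_{\underline k}$; for $y<0$, $y\ne-n$, $\varphi_-(y)$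 is the unique $x\in\mathbb R$ with $(x,y)\in\mathcal R_{\underline k}$. Operators: with $b_\epsilon=\epsilon\sin(\underline k\cdot\mathbf x)$, $\omega_\epsilon=\epsilon\frac{|\underline k|}N\sin(\underline k\cdot\mathbf x)$, $\psi_\epsilon=\frac{\epsilon}{N|\underline k|}\sin(\underline k\cdot\mathbf x)$ and $\mu\in\mathbb R^2\setminus\mathbb Z^2$, let $$\mathcal L_{\mu,\epsilon}=\underline c\cdot(\nabla+\mathrm i\mu)\mathbb I_2+\begin{pmatrix}-\nabla^\perp\psi_\epsilon\cdot(\nabla+\mathrm i\mu)&\left(-N^2(\partial_x+\mathrm i\mu_1)-\nabla b_\epsilon\cdot(\nabla^\perp+\mathrm i\mu^\perp)\right)|\mathbf D+\mu|^{-2}\\-\partial_x-\mathrm i\mu_1&-\nabla^\perp\psi_\epsilon\cdot(\nabla+\mathrm i\mu)-\nabla\omega_\epsilon\cdot(\nabla^\perp+\mathrm i\mu^\perp)|\mathbf D+\mu|^{-2}\end{pmatrix},$$ where $|\mathbf D+\mu|^{-2}$ is the Fourier multiplier $e^{\mathrm ij\cdot\mathbf x}\mapsto|j+\mu|^{-2}e^{\mathrm ij\cdot\mathbf x}$. Let $X^0_{\underline k}$ be the closed subspace of $H^1(\mathbb T^2)\times L^2(\mathbb T^2)$ of functions whose Fourier coefficients are supported on $\underline k\mathbb Z$. $\mathscr L_{\mu,\epsilon}$ is the restriction of $\mathcal L_{\mu,\epsilon}$ to $X^0_{\underline k}$, with domain $\{U\in X^0_{\underline k}:\mathcal L_{\mu,\epsilon}U\in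 X^0_{\underline k}\}$. For $\mu\in(\mathcal R_{\underline k}\setminus\mathcal D_{\underline k})\cap(\mathbb R^2\setminus\mathbb Z^2)$, $\lambda^+:=\mathrm iw^-_{\underline k}(\mu)=\mathrm iw^+_0(\mu)$ is an isolated double eigenvalue of $\mathscr L_{\mu,0}$. Let $\Gamma$ be a counterclockwise circle around $\lambda^+$, enclosing a region of diameter less than $\alpha N$ and separating $\lambda^+$ from the rest of the spectrum of $\mathscr L_{\mu,0}$. For small $\epsilon$, $\mathcal V_{\mu,\epsilon}$ is the (two-dimensional) range of the spectral projector $P_{\mu,\epsilon}=-\frac1{2\pi\mathrm i}\oint_\Gamma(\mathscr L_{\mu,\epsilon}-\lambda)^{-1}d\lambda$, i.e. the spectral subspace of the part of the spectrum of $\mathscr L_{\mu,\epsilon}$ inside $\Gamma$. Notation: $r(\epsilon^p)$, $r_j(\epsilon^p)$ denote (possibly different) real-valued analytic functions of $\epsilon$, depending on $\mu$, bounded by $C|\epsilon|^p$ for small $\epsilon$. *)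

(* Defs.v *)
From Stdlib Require Import Reals ZArith List ClassicalEpsilon.
From Coquelicot Require Import Coquelicot.
Open Scope R_scope.

(** ** Plane geometry and the dispersion relation *)

Definition toR2 (j : Z * Z) : R * R := (IZR (fst j), IZR (snd j)).
Definition add2 (a b : R * R) : R * R := (fst a + fst b, snd a + snd b).
Definition sub2 (a b : R * R) : R * R := (fst a - fst b, snd a - snd b).
Definition dot2 (a b : R * R) : R := fst a * fst b + snd a * snd b.
Definition perp2 (a : R * R) : R * R := (snd a, - fst a).
Definition norm2 (a : R * R) : R := sqrt (dot2 a a).

Definition Zsub2 (j l : Z * Z) : Z * Z :=
  ((fst j - fst l)%Z, (snd j - snd l)%Z).
Definition Zscal2 (l : Z) (k : Z * Z) : Z * Z :=
  ((l * fst k)%Z, (l * snd k)%Z).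

(** The numerator vanishes at the origin, so [Omega N (0, 0) = 0]. *)
Definition Omega (N : R) (xi : R * R) : R := N * fst xi / norm2 xi.

Definition cvec (N : R) (k : Z * Z) : R * R :=
  let s := N * IZR (fst k) / norm2 (toR2 k) ^ 3 in
  (s * IZR (fst k), s * IZR (snd k)).

(** [w^sigma_j (mu)], the sign [sigma] being [1] or [-1]. *)
Definition w (N : R) (k : Z * Z) (sigma : R) (j : Z * Z) (mu : R * R) : R :=
  dot2 (cvec N k) (add2 (toR2 j) mu) + sigma * Omega N (add2 (toR2 j) mu).

Definition resonant (N : R) (k : Z * Z) (mu : R * R) : Prop :=
  mu = (0, 0) \/
  (mu <> (0, 0) /\
   Omega N (toR2 k) - Omega N (add2 (toR2 k) mu) = Omega N mu).

Definition discrete (D : R * R -> Prop) : Prop :=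
  forall mu, D mu -> exists delta, 0 < delta /\
    forall nu, D nu -> norm2 (sub2 nu mu) < delta -> nu = mu.

(** [D] is an admissible exceptional set and [alpha] a gap function for it. *)
Definition exceptional_set (N : R) (k : Z * Z)
    (D : R * R -> Prop) (alpha : R * R -> R) : Prop :=
  (forall mu, D mu -> resonant N k mu) /\
  D (0, 0) /\
  discrete D /\
  forall mu, resonant N k mu -> ~ D mu ->
    0 < alpha mu /\
    (forall l : Z, l <> 0%Z ->
       alpha mu * N <=
         Rabs (w N k 1 (Zscal2 l k) mu - w N k 1 (0%Z, 0%Z) mu)) /\
    (forall l : Z, l <> 1%Z ->
       alpha mu * N <=
         Rabs (w N k (-1) (Zscal2 l k) mu - w N k (-1) k mu)).

(** The abscissa of the point of the resonant set at height [y]: [varphi_+] is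
    its restriction to [y > 0], [varphi_-] its restriction to [y < 0],
    [y <> - snd k]. *)
Definition varphi (N : R) (k : Z * Z) (y : R) : R :=
  epsilon (inhabits 0) (fun x => resonant N k (x, y)).

Definition mu_small (N : R) (k : Z * Z) (tau : R) : R * R :=
  if Req_EM_T tau 0 then (0, 0)
  else (varphi N k (IZR (snd k) * tau), IZR (snd k) * tau).

Definition mu_large (N : R) (k : Z * Z) (tau : R) : R * R :=
  (varphi N k tau, tau).

(** ** Periodic distributions on the torus and their Fourier coefficients *)

(** A periodic distribution [sum_j u_j e^{i j.x}] is identified with its family
    of Fourier coefficients [u]. *)
Definition fourier : Type := Z * Z -> C.

Definition fadd (u v : fourier) : fourier := fun j => (u j + v j)%C.
Definition fscal (z : C) (u : fourier) : fourier := fun j => (z * u j)%C.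
Definition fsub (u v : fourier) : fourier := fun j => (u j - v j)%C.

(** Trigonometric polynomials: [(a, l)] stands for the term [a e^{i l.x}]. *)
Definition trig : Type := list (C * (Z * Z)).

(** [a sin (k.x) = a / (2 i) (e^{i k.x} - e^{- i k.x})]. *)
Definition trig_sin (a : R) (k : Z * Z) : trig :=
  (RtoC a / (2 * Ci), k)%C :: (- (RtoC a / (2 * Ci)), Zscal2 (-1) k)%C :: nil.

Definition trig_dx (t : trig) : trig :=
  map (fun p => (Ci * RtoC (IZR (fst (snd p))) * fst p, snd p)%C) t.
Definition trig_dy (t : trig) : trig :=
  map (fun p => (Ci * RtoC (IZR (snd (snd p))) * fst p, snd p)%C) t.

(** Pointwise product of a trigonometric polynomial and a distribution. *)
Definition fmul (t : trig) (u : fourier) : fourier := fun j =>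
  fold_right (fun p s => fst p * u (Zsub2 j (snd p)) + s)%C (RtoC 0) t.

(** [Dmux] and [Dmuy] are the components of [nabla + i mu]. *)
Definition Dmux (mu : R * R) (u : fourier) : fourier := fun j =>
  (Ci * RtoC (fst (add2 (toR2 j) mu)) * u j)%C.
Definition Dmuy (mu : R * R) (u : fourier) : fourier := fun j =>
  (Ci * RtoC (snd (add2 (toR2 j) mu)) * u j)%C.

(** The multiplier [|D + mu|^{-2}]. *)
Definition inv_lap (mu : R * R) (u : fourier) : fourier := fun j =>
  (RtoC (/ norm2 (add2 (toR2 j) mu) ^ 2) * u j)%C.

(** [nabla^perp t . (nabla + i mu)] and [nabla t . (nabla^perp + i mu^perp)]. *)
Definition perp_grad_dot (t : trig) (mu : R * R) (u : fourier) : fourier :=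
  fsub (fmul (trig_dy t) (Dmux mu u)) (fmul (trig_dx t) (Dmuy mu u)).
Definition grad_dot_perp (t : trig) (mu : R * R) (u : fourier) : fourier :=
  fsub (fmul (trig_dx t) (Dmuy mu u)) (fmul (trig_dy t) (Dmux mu u)).

(** ** The linearized operator *)

Definition state : Type := (fourier * fourier)%type.

Definition szero : state := (fun _ => RtoC 0, fun _ => RtoC 0).
Definition sadd (U V : state) : state :=
  (fadd (fst U) (fst V), fadd (snd U) (snd V)).
Definition sscal (z : C) (U : state) : state :=
  (fscal z (fst U), fscal z (snd U)).
Definition ssub (U V : state) : state :=
  (fsub (fst U) (fst V), fsub (snd U) (snd V)).

Definition b_wave (k : Z * Z) (eps : R) : trig := trig_sin eps k.
Definition omega_wave (N : R) (k : Z * Z) (eps : R) : trig :=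
  trig_sin (eps * norm2 (toR2 k) / N) k.
Definition psi_wave (N : R) (k : Z * Z) (eps : R) : trig :=
  trig_sin (eps / (N * norm2 (toR2 k))) k.

Definition transport (N : R) (k : Z * Z) (mu : R * R) (u : fourier) : fourier :=
  fadd (fscal (RtoC (fst (cvec N k))) (Dmux mu u))
       (fscal (RtoC (snd (cvec N k))) (Dmuy mu u)).

Definition Lop (N : R) (k : Z * Z) (mu : R * R) (eps : R) (U : state) : state :=
  let b := b_wave k eps in
  let om := omega_wave N k eps in
  let psi := psi_wave N k eps in
  let u := fst U in
  let v := snd U in
  let v' := inv_lap mu v in
  (fadd (transport N k mu u)
     (fadd (fscal (-1) (perp_grad_dot psi mu u))
           (fsub (fscal (RtoC (- N ^ 2)) (Dmux mu v')) (grad_dot_perp b mu v'))),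
   fadd (transport N k mu v)
     (fadd (fscal (-1) (Dmux mu u))
           (fsub (fscal (-1) (perp_grad_dot psi mu v))
                 (grad_dot_perp om mu v')))).

(** ** The space [X^0_k] and the spectrum of the restricted operator *)

(** Unordered sum of a nonnegative family. *)
Definition sumZ2 (a : Z * Z -> R) : Rbar :=
  Lub_Rbar (fun s => exists l : list (Z * Z),
    NoDup l /\ s = fold_right (fun j t => a j + t) 0 l).

(** Squared norm of [H^1 x L^2]. *)
Definition sqnormX (U : state) : Rbar :=
  sumZ2 (fun j => (1 + norm2 (toR2 j) ^ 2) * Cmod (fst U j) ^ 2
                  + Cmod (snd U j) ^ 2).
Definition normX (U : state) : R := sqrt (real (sqnormX U)).

Definition inX0 (k : Z * Z) (U : state) : Prop :=
  is_finite (sqnormX U) /\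
  forall j, (~ exists l : Z, j = Zscal2 l k) ->
    fst U j = RtoC 0 /\ snd U j = RtoC 0.

Definition domL (N : R) (k : Z * Z) (mu : R * R) (eps : R) (U : state) : Prop :=
  inX0 k U /\ inX0 k (Lop N k mu eps U).

(** [(L - z) U]. *)
Definition Lshift (N : R) (k : Z * Z) (mu : R * R) (eps : R) (z : C)
    (U : state) : state :=
  ssub (Lop N k mu eps U) (sscal z U).

Definition resolvent_set (N : R) (k : Z * Z) (mu : R * R) (eps : R) (z : C) :
    Prop :=
  (forall F, inX0 k F ->
     exists! U, domL N k mu eps U /\ Lshift N k mu eps z U = F) /\
  exists K : R, forall U, domL N k mu eps U ->
    normX U <= K * normX (Lshift N k mu eps z U).

Definition spectrum (N : R) (k : Z * Z) (mu : R * R) (eps : R) (z : C) : Prop :=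
  ~ resolvent_set N k mu eps z.

Definition lambda_plus (N : R) (k : Z * Z) (mu : R * R) : C :=
  (Ci * RtoC (w N k (-1) k mu))%C.

(** ** Spectral projector *)

Definition expi (theta : R) : C := (cos theta, sin theta).
Definition circle (z0 : C) (rho theta : R) : C :=
  (z0 + RtoC rho * expi theta)%C.

(** [-1/(2 pi i)] times the integral, along the circle of centre [z0] and radius
    [rho] run counterclockwise, of [z |-> f z], where [f (circle z0 rho theta)]
    is given as [g theta]. *)
Definition is_contour (rho : R) (g : R -> C) (v : C) : Prop :=
  exists I : C,
    is_RInt (V := C_R_NormedModule)
      (fun theta => Ci * RtoC rho * expi theta * g theta)%C 0 (2 * PI) I /\
    v = (- / (2 * RtoC PI * Ci) * I)%C.

(** [U = P F], where [W theta] is the resolvent at [circle z0 rho theta] applied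
    to [F].  The vector-valued integral is taken coefficientwise: the Fourier
    coefficients are continuous functionals separating the points of [X^0_k]. *)
Definition projector (N : R) (k : Z * Z) (mu : R * R) (eps : R)
    (z0 : C) (rho : R) (F U : state) : Prop :=
  inX0 k F /\ inX0 k U /\
  exists W : R -> state,
    (forall theta, 0 <= theta <= 2 * PI ->
       domL N k mu eps (W theta) /\
       Lshift N k mu eps (circle z0 rho theta) (W theta) = F) /\
    forall j : Z * Z,
      is_contour rho (fun theta => fst (W theta) j) (fst U j) /\
      is_contour rho (fun theta => snd (W theta) j) (snd U j).

Definition spectral_space (N : R) (k : Z * Z) (mu : R * R) (eps : R)
    (z0 : C) (rho : R) (U : state) : Prop :=
  exists F, projector N k mu eps z0 rho F U.

(** The circle of centre [z0] and radius [rho] encloses [lambda^+], bounds a disc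
    of diameter less than [alpha N], and separates [lambda^+] from the rest of
    the spectrum at [eps = 0]. *)
Definition separating_circle (N : R) (k : Z * Z) (alpha : R) (mu : R * R)
    (z0 : C) (rho : R) : Prop :=
  0 < rho /\
  Cmod (lambda_plus N k mu - z0) < rho /\
  2 * rho < alpha * N /\
  forall z, spectrum N k mu 0 z -> z <> lambda_plus N k mu ->
    rho < Cmod (z - z0).

Definition is_basis (V : state -> Prop) (v0 v1 : state) : Prop :=
  (forall a b : C, sadd (sscal a v0) (sscal b v1) = szero ->
     a = RtoC 0 /\ b = RtoC 0) /\
  (forall U, V U <-> exists a b : C, U = sadd (sscal a v0) (sscal b v1)).

(** ** Remainders and coefficients *)

(** [r] is a remainder [r (eps^p)], analytic on [(-e0, e0)]. *)
Definition remainder (e0 : R) (p : nat) (r : R -> R) : Prop :=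
  (exists a : nat -> R,
     forall eps, Rabs eps < e0 -> is_pseries a eps (r eps)) /\
  (exists C0 : R, forall eps, Rabs eps < e0 ->
     Rabs (r eps) <= C0 * Rabs eps ^ p).

(** Complex square root of a real number; [sqrt] is [0] on negative reals. *)
Definition csqrt (x : R) : C := (sqrt x, sqrt (- x)).

Definition b1 (N : R) (k : Z * Z) (mu : R * R) : R :=
  let K := norm2 (toR2 k) in
  let M := norm2 mu in
  let KM := norm2 (add2 (toR2 k) mu) in
  dot2 (perp2 (toR2 k)) mu * ((KM - K) * (KM + K - M)) / (4 * N * K * M * KM).

Definition b0 (N : R) (k : Z * Z) (mu : R * R) : R :=
  let K := norm2 (toR2 k) in
  let M := norm2 mu in
  let KM := norm2 (add2 (toR2 k) mu) in
  - (dot2 (perp2 (toR2 k)) mu * ((K + M) * (KM + K - M)) / (4 * N * K * M * KM)).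

(** The numerator vanishes at [mu = 0], so [e_coef N k (0, 0) = 0]. *)
Definition e_coef (N : R) (k : Z * Z) (mu : R * R) : R :=
  let K := norm2 (toR2 k) in
  let M := norm2 mu in
  let KM := norm2 (add2 (toR2 k) mu) in
  dot2 (perp2 (toR2 k)) mu ^ 2 *
    ((KM - K) * (K + M) * (KM + K - M) ^ 2) /
    (16 * N ^ 2 * M ^ 2 * KM ^ 2 * K ^ 2).

(* Main.v *)
Require Import Defs.
From Stdlib Require Import Reals ZArith List.
From Coquelicot Require Import Coquelicot.
From Stdlib Require Import Lra Lia FunctionalExtensionality ClassicalEpsilon.
Open Scope R_scope.

(** The proof works on the Fourier coefficients at the sites [l k].  With
    [xi_l = l k + mu], the unperturbed operator is block diagonal, with
    eigenvalues [i w^s_{lk}(mu)] and eigenvectors [(- s N / |xi_l|, 1)].  In these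
    coordinates the norm of [H^1 x L^2] is equivalent to that of [l^2]
    ([weight_bounds]), and the operator becomes [i (diag w + eps A)], where [A]
    has real bounded entries and couples a site to its two neighbours only,
    because [k^perp . xi_l] does not depend on [l] ([Lop_of_coords]).  The common
    factor [i] in front of a real operator is the reason why all remainders are
    real.

    At a resonant [mu] exactly two frequencies coincide, [w^+] at the site [0] and
    [w^-] at the site [k], and all the others are at distance at least [alpha N].
    A real plane invariant under [diag w + eps A] and close to the span of the
    two resonant directions is a graph over that span; the equation of the graph
    is quadratic and is solved by a power series in [eps] whose coefficients are
    dominated by a scalar recursion ([invariant_plane]).  The matrix of the
    operator on this plane is thus analytic, its first order part is given by the
    entries of [A] between the two resonant modes ([first_order]), and rescaling
    the two basis vectors turns these entries into [b0] and [b1].  The diagonal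
    has no first order term since a sine wave does not couple a site to itself.

    It remains to identify the invariant plane with the range of the contour
    integral.  Modulo the plane the resolvent has no singularity inside the
    circle: as [|lambda^+ - z0| < rho] and [2 rho < alpha N], every nonresonant
    eigenvalue is at distance more than [alpha N - rho > rho] from [z0], so the
    transverse part of the resolvent is a uniform limit of polynomials in
    [z - z0] and its contour integral vanishes ([contour_transverse]).  On the
    plane the resolvent is that of a two by two matrix with both eigenvalues
    inside the circle, and the contour integral is the identity
    ([plane_in_range], [contour_rational]).  Points of the circle belong to the
    resolvent set by a Neumann series ([resolvent_set_of_gap]).

    The eigenvalues are the roots of the characteristic polynomial; dividing the
    discriminant by [eps^2] leaves [- b0 b1 + O(eps)].

    For the asymptotics, the resonance condition equates [m / |k|] with the sum of
    the cosines of the directions of [mu] and [k + mu].  For small [y] this forces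
    [x = O(y^2)] ([resonant_small]); for large [y] the two directions differ by
    [O(1/y)], so both cosines tend to [m / (2 |k|)].  In both cases [e_coef] is
    an algebraic function of quantities known up to a relative error [O(t)]. *)

Lemma choose_fun {A B : Type} (P : A -> B -> Prop) :
  (forall x, exists y, P x y) -> exists f, forall x, P x (f x).
Proof.
  intros H.
  exists (fun x => proj1_sig (constructive_indefinite_description _ (H x))).
  intros x. apply (proj2_sig (constructive_indefinite_description _ (H x))).
Qed.

(** * Square summable families *)

Definition sumsq {I : Type} (x : I -> R) (l : list I) : R :=
  fold_right (fun i s => x i ^ 2 + s) 0 l.

(** [c] is a bound for the norm of [x] in [l^2(I)].  Carrying bounds instead of
    the norm itself keeps every estimate at the level of finite sums. *)
Definition ell2 {I : Type} (x : I -> R) (c : R) : Prop :=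
  0 <= c /\ forall l, NoDup l -> sumsq x l <= c ^ 2.

Definition ell2c {I : Type} (a : I -> C) (c : R) : Prop :=
  ell2 (fun i => Cmod (a i)) c.

Lemma sumsq_ge0 {I : Type} (x : I -> R) l : 0 <= sumsq x l.
Proof. induction l; simpl; [lra|]. pose proof (pow2_ge_0 (x a)). simpl in *. lra. Qed.

Lemma sumsq_le {I : Type} (x y : I -> R) l :
  (forall i, Rabs (x i) <= Rabs (y i)) -> sumsq x l <= sumsq y l.
Proof.
  intros H. induction l as [|a l IH]; simpl; [lra|].
  specialize (H a).
  pose proof (Rsqr_le_abs_1 _ _ H) as Q. unfold Rsqr in Q. lra.
Qed.

(** By induction on the list, each step being the triangle inequality of the
    plane, here that of the complex modulus. *)
Lemma sumsq_minkowski {I : Type} (x y : I -> R) l :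
  sqrt (sumsq (fun i => x i + y i) l) <= sqrt (sumsq x l) + sqrt (sumsq y l).
Proof.
  induction l as [|a l IH].
  - simpl. rewrite sqrt_0, Rplus_0_r. apply Rle_refl.
  - change (sumsq (fun i => x i + y i) (a :: l))
      with ((x a + y a) ^ 2 + sumsq (fun i => x i + y i) l).
    change (sumsq x (a :: l)) with (x a ^ 2 + sumsq x l).
    change (sumsq y (a :: l)) with (y a ^ 2 + sumsq y l).
    set (X := sqrt (sumsq x l)) in *. set (Y := sqrt (sumsq y l)) in *.
    assert (HX : sumsq x l = X ^ 2) by (symmetry; apply pow2_sqrt, sumsq_ge0).
    assert (HY : sumsq y l = Y ^ 2) by (symmetry; apply pow2_sqrt, sumsq_ge0).
    pose proof (Cmod_triangle (x a, X) (y a, Y)) as T. unfold Cmod in T. simpl fst in T; simpl snd in T.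
    rewrite HX, HY. eapply Rle_trans; [|apply T].
    apply sqrt_le_1_alt.
    set (S := sumsq (fun i => x i + y i) l) in *.
    rewrite <- (pow2_sqrt S) by apply sumsq_ge0. apply Rplus_le_compat_l.
    apply pow_incr. split; [apply sqrt_pos|exact IH].
Qed.

Lemma ell2_le {I : Type} (x y : I -> R) c d :
  (forall i, Rabs (x i) <= Rabs (y i)) -> c <= d -> ell2 y c -> ell2 x d.
Proof.
  intros H cd [c0 Hc]. split; [lra|]. intros l Hl.
  apply Rle_trans with (sumsq y l); [apply sumsq_le; auto|].
  apply Rle_trans with (c ^ 2); [auto|]. apply pow_incr; lra.
Qed.

Lemma ell2_plus {I : Type} (x y : I -> R) c d :
  ell2 x c -> ell2 y d -> ell2 (fun i => x i + y i) (c + d).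
Proof.
  intros [c0 Hc] [d0 Hd]. split; [lra|]. intros l Hl.
  rewrite <- (pow2_sqrt (sumsq _ l)) by apply sumsq_ge0.
  apply pow_incr. split; [apply sqrt_pos|].
  eapply Rle_trans; [apply sumsq_minkowski|].
  apply Rplus_le_compat.
  - rewrite <- (sqrt_pow2 c) by lra. apply sqrt_le_1_alt; auto.
  - rewrite <- (sqrt_pow2 d) by lra. apply sqrt_le_1_alt; auto.
Qed.

Lemma ell2_0 {I : Type} c : 0 <= c -> ell2 (fun _ : I => 0) c.
Proof.
  intros H. split; auto. intros l _.
  assert (sumsq (fun _ : I => 0) l = 0) as ->.
  { induction l; simpl in *; [lra|rewrite IHl; lra]. }
  apply pow2_ge_0.
Qed.

Lemma ell2_mult {I : Type} (f x : I -> R) q c :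
  0 <= q -> (forall i, Rabs (f i) <= q) -> ell2 x c ->
  ell2 (fun i => f i * x i) (q * c).
Proof.
  intros Hq Hf [c0 Hc]. split; [nra|]. intros l Hl.
  apply Rle_trans with (q ^ 2 * sumsq x l).
  - clear Hl. induction l as [|a l IH]; simpl; [lra|].
    specialize (Hf a).
    pose proof (Rsqr_le_abs_1 (f a) q) as Q. unfold Rsqr in Q.
    rewrite (Rabs_pos_eq q) in Q by lra. specialize (Q Hf). simpl in IH.
    pose proof (Rle_0_sqr (x a)) as X. unfold Rsqr in X. nra.
  - rewrite Rpow_mult_distr. apply Rmult_le_compat_l; [apply pow2_ge_0|auto].
Qed.

(** A partial map of index sets that is injective where it is defined moves
    families without increasing their norm: shifts of sites, restrictions, and
    extensions by zero are all of this form. *)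
Lemma ell2_reindex {I J : Type} (g : J -> option I) (x : I -> R) c :
  (forall j j' i, g j = Some i -> g j' = Some i -> j = j') ->
  ell2 x c ->
  ell2 (fun j => match g j with Some i => x i | None => 0 end) c.
Proof.
  intros inj [c0 Hc]. split; auto. intros l Hl.
  assert (exists l', NoDup l' /\ (forall i, In i l' -> exists j, In j l /\ g j = Some i)
     /\ sumsq (fun j => match g j with Some i => x i | None => 0 end) l = sumsq x l').
  { induction Hl as [|j l Hj Hl IH].
    - exists nil. split; [constructor|split; [intros i []|reflexivity]].
    - destruct IH as (l' & N' & I' & E').
      destruct (g j) as [i|] eqn:G.
      + exists (i :: l'). split; [constructor; auto|split].
        * intros Hi. destruct (I' i Hi) as (j' & Hj' & G').
          apply Hj. rewrite (inj j j' i G G'). exact Hj'.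
        * intros i' [<-|Hi']; [exists j; split; simpl; auto|].
          destruct (I' i' Hi') as (j' & ? & ?). exists j'. split; simpl; auto.
        * simpl. rewrite G. f_equal. exact E'.
      + exists l'. split; [auto|split].
        * intros i' Hi'. destruct (I' i' Hi') as (j' & ? & ?). exists j'. split; simpl; auto.
        * simpl. rewrite G. simpl in E'. rewrite E'. ring. }
  destruct H as (l' & N' & _ & ->). auto.
Qed.

Lemma ell2_coef {I : Type} (x : I -> R) c i : ell2 x c -> Rabs (x i) <= c.
Proof.
  intros [c0 Hc]. specialize (Hc (i :: nil)).
  assert (N : NoDup (i :: nil)) by (constructor; [intros []|constructor]).
  specialize (Hc N). simpl in Hc.
  apply Rsqr_incr_0_var; [|lra]. unfold Rsqr.
  rewrite <- Rabs_mult, Rabs_pos_eq by nra. nra.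
Qed.

Lemma ell2_lim {I : Type} (u : nat -> I -> R) (x : I -> R) c :
  (forall n, ell2 (u n) c) ->
  (forall i, is_lim_seq (fun n => u n i) (x i)) -> ell2 x c.
Proof.
  intros Hu Hx. split; [apply (Hu 0%nat)|]. intros l Hl.
  assert (L : is_lim_seq (fun n => sumsq (u n) l) (sumsq x l)).
  { clear Hl. induction l as [|i l IH].
    - apply is_lim_seq_const.
    - change (sumsq x (i :: l)) with (x i ^ 2 + sumsq x l).
      apply is_lim_seq_ext with (fun n => u n i * u n i + sumsq (u n) l).
      { intros n. simpl. unfold sumsq. ring. }
      replace (x i ^ 2) with (x i * x i) by ring.
      apply is_lim_seq_plus'; auto. apply is_lim_seq_mult'; auto. }
  assert (Rbar_le (sumsq x l) (c ^ 2)) as H; [|exact H].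
  refine (is_lim_seq_le _ _ _ _ _ L (is_lim_seq_const (c ^ 2))).
  intros n. apply (Hu n); auto.
Qed.

(** ** Complex families *)

Lemma ell2c_le {I : Type} (a b : I -> C) c d :
  (forall i, Cmod (a i) <= Cmod (b i)) -> c <= d -> ell2c b c -> ell2c a d.
Proof.
  intros H cd Hb. apply (ell2_le _ (fun i => Cmod (b i)) c d); auto.
  intros i. rewrite !Rabs_pos_eq by apply Cmod_ge_0. auto.
Qed.

Lemma ell2c_plus {I : Type} (a b : I -> C) c d :
  ell2c a c -> ell2c b d -> ell2c (fun i => a i + b i)%C (c + d).
Proof.
  intros Ha Hb. apply (ell2_le _ (fun i => Cmod (a i) + Cmod (b i)) (c + d)); [|lra|].
  - intros i. rewrite !Rabs_pos_eq.
    + apply Cmod_triangle.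
    + pose proof (Cmod_ge_0 (a i)); pose proof (Cmod_ge_0 (b i)); lra.
    + apply Cmod_ge_0.
  - apply ell2_plus; auto.
Qed.

Lemma ell2c_mult {I : Type} (f a : I -> C) q c :
  0 <= q -> (forall i, Cmod (f i) <= q) -> ell2c a c ->
  ell2c (fun i => f i * a i)%C (q * c).
Proof.
  intros Hq Hf Ha.
  apply (ell2_le _ (fun i => Cmod (f i) * Cmod (a i)) (q * c)); [|lra|].
  - intros i. rewrite Cmod_mult. lra.
  - apply (ell2_mult (fun i => Cmod (f i))); auto.
    intros i. rewrite Rabs_pos_eq by apply Cmod_ge_0. auto.
Qed.

Lemma ell2c_0 {I : Type} c : 0 <= c -> ell2c (fun _ : I => RtoC 0) c.
Proof.
  intros H. unfold ell2c. rewrite Cmod_0. apply ell2_0; auto.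
Qed.

Lemma ell2c_minus {I : Type} (a b : I -> C) c d :
  ell2c a c -> ell2c b d -> ell2c (fun i => a i - b i)%C (c + d).
Proof.
  intros Ha Hb. apply (ell2c_plus a (fun i => - b i)%C); auto.
  apply (ell2c_le _ b d); auto; [|lra]. intros i. rewrite Cmod_opp. lra.
Qed.

Lemma ell2c_scal {I : Type} (z : C) (a : I -> C) c :
  ell2c a c -> ell2c (fun i => z * a i)%C (Cmod z * c).
Proof.
  intros Ha. apply (ell2c_mult (fun _ => z)); auto using Cmod_ge_0. intros _; lra.
Qed.

Lemma ell2c_coef {I : Type} (a : I -> C) c i : ell2c a c -> Cmod (a i) <= c.
Proof.
  intros Ha. rewrite <- (Rabs_pos_eq (Cmod (a i))) by apply Cmod_ge_0.
  apply (ell2_coef (fun i => Cmod (a i))); auto.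
Qed.

Lemma ell2c_lim {I : Type} (u : nat -> I -> C) (a : I -> C) c :
  (forall n, ell2c (u n) c) ->
  (forall i, is_lim_seq (fun n => Re (u n i)) (Re (a i))) ->
  (forall i, is_lim_seq (fun n => Im (u n i)) (Im (a i))) -> ell2c a c.
Proof.
  intros Hu HR HI. apply (ell2_lim (fun n i => Cmod (u n i))); auto.
  intros i. unfold Cmod.
  apply (is_lim_seq_continuous sqrt).
  { apply continuity_pt_sqrt. pose proof (pow2_ge_0 (fst (a i))).
    pose proof (pow2_ge_0 (snd (a i))). lra. }
  apply is_lim_seq_ext with
    (fun n => Re (u n i) * Re (u n i) + Im (u n i) * Im (u n i)).
  { intros n. unfold Re, Im. ring. }
  replace (fst (a i) ^ 2 + snd (a i) ^ 2) with
    (Re (a i) * Re (a i) + Im (a i) * Im (a i)) by (unfold Re, Im; ring).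
  apply is_lim_seq_plus'; apply is_lim_seq_mult'; auto.
Qed.

(** ** Contractions *)

Definition additive {I : Type} (T : (I -> C) -> I -> C) : Prop :=
  forall a b i, T (fun j => a j - b j)%C i = (T a i - T b i)%C.

Definition ell2_bounded {I : Type} (T : (I -> C) -> I -> C) (q : R) : Prop :=
  0 <= q /\ forall a c, ell2c a c -> ell2c (T a) (q * c).

Lemma additive_0 {I : Type} (T : (I -> C) -> I -> C) i :
  additive T -> T (fun _ => RtoC 0) i = RtoC 0.
Proof.
  intros H. specialize (H (fun _ => RtoC 0) (fun _ => RtoC 0) i).
  cbv beta in H.
  replace (fun j : I => (0 - 0)%C) with (fun _ : I => RtoC 0)
    in H by (extensionality j; ring).
  rewrite H. ring.
Qed.

Lemma pow_lim_0 q c : 0 <= q < 1 -> is_lim_seq (fun n => q ^ n * c) 0.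
Proof.
  intros Hq. replace 0 with (0 * c) by ring.
  apply is_lim_seq_mult'; [|apply is_lim_seq_const].
  apply is_lim_seq_geom. rewrite Rabs_pos_eq; lra.
Qed.

Lemma le_of_pow_le q c x : 0 <= q < 1 -> (forall n, x <= q ^ n * c) -> x <= 0.
Proof.
  intros Hq H.
  assert (Rbar_le x 0) as K; [|exact K].
  refine (is_lim_seq_le _ _ _ _ _ (is_lim_seq_const x) (pow_lim_0 q c Hq)); auto.
Qed.

Section Contraction.
Variables (I : Type) (T : (I -> C) -> I -> C) (q : R).
Hypotheses (Tadd : additive T) (Tbd : ell2_bounded T q) (q1 : q < 1).

Lemma contraction_fixed_0 (a : I -> C) c :
  ell2c a c -> (forall i, a i = T a i) -> forall i, a i = RtoC 0.
Proof.
  intros Ha E i. apply Cmod_eq_0. apply Rle_antisym; [|apply Cmod_ge_0].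
  apply (le_of_pow_le q c); [destruct Tbd; lra|].
  intros n. apply ell2c_coef.
  induction n as [|n IH].
  - simpl. rewrite Rmult_1_l; auto.
  - simpl. rewrite Rmult_assoc.
    replace a with (T a) by (extensionality j; auto).
    apply Tbd; auto.
Qed.

Fixpoint neumann_sum (f : I -> C) (n : nat) : I -> C :=
  match n with
  | O => fun _ => RtoC 0
  | S n => fun i => (f i + T (neumann_sum f n) i)%C
  end.

Lemma neumann_sum_step f c n :
  ell2c f c ->
  ell2c (fun i => neumann_sum f (S n) i - neumann_sum f n i)%C (q ^ n * c).
Proof.
  intros Hf. induction n as [|n IH].
  - rewrite pow_O, Rmult_1_l. eapply ell2c_le; [| apply Rle_refl | exact Hf].
    intros i. simpl. rewrite additive_0 by auto.
    apply Req_le. f_equal. ring.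
  - simpl pow. rewrite Rmult_assoc.
    eapply ell2c_le; [|apply Rle_refl|apply Tbd, IH].
    intros i. apply Req_le. f_equal. rewrite Tadd.
    simpl neumann_sum. ring.
Qed.

Lemma neumann_sum_tail f c n p :
  ell2c f c ->
  ell2c (fun i => neumann_sum f (n + p) i - neumann_sum f n i)%C
        (q ^ n * c / (1 - q)).
Proof.
  intros Hf. destruct Tbd as [q0 _].
  assert (c0 : 0 <= c) by apply Hf.
  assert (K : ell2c (fun i => neumann_sum f (n + p) i - neumann_sum f n i)%C
        (q ^ n * c * (1 - q ^ p) / (1 - q))).
  { induction p as [|p IH].
    - rewrite Nat.add_0_r. simpl pow.
      replace (q ^ n * c * (1 - 1) / (1 - q)) with 0 by (field; lra).
      eapply ell2c_le; [|apply Rle_refl|apply (ell2c_0 0); lra].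
      intros i. apply Req_le. f_equal. ring.
    - rewrite Nat.add_succ_r.
      pose proof (ell2c_plus _ _ _ _ (neumann_sum_step f c (n + p) Hf) IH) as H.
      eapply ell2c_le; [| |exact H].
      + intros i. apply Req_le. f_equal. ring.
      + rewrite pow_add. simpl. apply Req_le. field. lra. }
  eapply ell2c_le; [|  |exact K]; [intros; lra|].
  unfold Rdiv. apply Rmult_le_compat_r; [left; apply Rinv_0_lt_compat; lra|].
  rewrite <- (Rmult_1_r (q ^ n * c)) at 2.
  apply Rmult_le_compat_l.
  - apply Rmult_le_pos; auto. apply pow_le; auto.
  - pose proof (pow_le q p q0). lra.
Qed.

Lemma neumann_sum_as_sum (f : I -> C) n i (p : C -> R) :
  (forall u v, p (u - v)%C = p u - p v) -> p (RtoC 0) = 0 ->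
  p (neumann_sum f (S n) i) =
  sum_n (fun k => p (neumann_sum f (S k) i - neumann_sum f k i)%C) n.
Proof.
  intros Hp P0. induction n as [|n IH].
  - rewrite sum_O, Hp. change (neumann_sum f 0 i) with (RtoC 0). rewrite P0. ring.
  - rewrite sum_Sn, <- IH, Hp. unfold plus; simpl. ring.
Qed.

(** The partial sums of the Neumann series converge coefficientwise, geometrically;
    as [l^2] bounds are bounds on finite sums they pass to this limit, and the
    limit equation follows from the bound on the tails. *)
Lemma neumann_solve (f : I -> C) c :
  ell2c f c ->
  exists a, ell2c a (c / (1 - q)) /\ forall i, a i = (f i + T a i)%C.
Proof.
  intros Hf. destruct Tbd as [q0 Tb].
  assert (c0 : 0 <= c) by apply Hf.
  assert (Hp : forall p : C -> R, (forall u v, p (u - v)%C = p u - p v) ->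
     p (RtoC 0) = 0 -> (forall u, Rabs (p u) <= Cmod u) -> forall i,
     exists L : R, is_lim_seq (fun n => p (neumann_sum f n i)) L).
  { intros p Hp P0 Pb i.
    assert (E : ex_series (fun k => p (neumann_sum f (S k) i - neumann_sum f k i)%C)).
    { apply (ex_series_le (V := R_CompleteNormedModule) _ (fun k => q ^ k * c)).
      - intros n. eapply Rle_trans; [apply Pb|].
        apply (ell2c_coef (fun i => neumann_sum f (S n) i - neumann_sum f n i)%C).
        apply neumann_sum_step; auto.
      - apply ex_series_ext with (fun k => c * q ^ k); [intros; simpl; ring|].
        apply (ex_series_scal_l c (fun k => q ^ k)).
        apply ex_series_geom. rewrite Rabs_pos_eq; lra. }
    destruct E as [L HL]. exists L.
    apply is_lim_seq_incr_1.
    eapply is_lim_seq_ext; [|exact HL].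
    intros n. symmetry. apply neumann_sum_as_sum; auto. }
  assert (HR := Hp Re (fun u v => eq_refl) eq_refl re_le_Cmod).
  assert (HI : forall i, exists L : R, is_lim_seq (fun n => Im (neumann_sum f n i)) L).
  { apply Hp; auto.
    intros u. unfold Im. eapply Rle_trans; [|apply Rmax_Cmod]. apply Rmax_r. }
  destruct (choose_fun _ HR) as [aR HaR]. destruct (choose_fun _ HI) as [aI HaI].
  set (a := fun i => (aR i, aI i) : C).
  assert (Tail : forall n, ell2c (fun i => a i - neumann_sum f n i)%C (q ^ n * c / (1 - q))).
  { intros n.
    apply (ell2c_lim (fun p i => neumann_sum f (n + p) i - neumann_sum f n i)%C).
    - intros p. apply neumann_sum_tail; auto.
    - intros i.
      apply (is_lim_seq_minus' (fun p => Re (neumann_sum f (n + p) i)) (fun _ => Re (neumann_sum f n i))).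
      + apply is_lim_seq_ext with (fun p => Re (neumann_sum f (p + n) i)).
        { intros p. rewrite Nat.add_comm. reflexivity. }
        apply (is_lim_seq_incr_n (fun p => Re (neumann_sum f p i))). apply HaR.
      + apply is_lim_seq_const.
    - intros i.
      apply (is_lim_seq_minus' (fun p => Im (neumann_sum f (n + p) i)) (fun _ => Im (neumann_sum f n i))).
      + apply is_lim_seq_ext with (fun p => Im (neumann_sum f (p + n) i)).
        { intros p. rewrite Nat.add_comm. reflexivity. }
        apply (is_lim_seq_incr_n (fun p => Im (neumann_sum f p i))). apply HaI.
      + apply is_lim_seq_const. }
  exists a. split.
  - eapply ell2c_le; [| |apply (Tail 0%nat)].
    + intros i. simpl. apply Req_le. f_equal. ring.
    + simpl. apply Req_le. field. lra.
  - intros i.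
    cut (a i - (f i + T a i) = 0)%C.
    { intros E. replace (a i) with (a i - (f i + T a i) + (f i + T a i))%C by ring.
      rewrite E. ring. }
    apply Cmod_eq_0. apply Rle_antisym; [|apply Cmod_ge_0].
    apply (le_of_pow_le q (2 * q * c / (1 - q))); [lra|]. intros n.
    replace (a i - (f i + T a i))%C with
      ((a i - neumann_sum f (S n) i) - T (fun j => a j - neumann_sum f n j)%C i)%C.
    2:{ rewrite Tadd. simpl. ring. }
    pose proof (ell2c_minus _ _ _ _ (Tail (S n)) (Tb _ _ (Tail n))) as H.
    eapply Rle_trans; [apply (ell2c_coef _ _ i H)|].
    simpl. apply Req_le. field. lra.
Qed.

(** Uniqueness turns the bound of the constructed solution into an a priori
    bound for every square summable solution. *)
Lemma neumann_bound (f a : I -> C) c d :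
  ell2c f c -> ell2c a d -> (forall i, a i = (f i + T a i)%C) ->
  ell2c a (c / (1 - q)).
Proof.
  intros Hf Ha E. destruct (neumann_solve f c Hf) as (b & Hb & Eb).
  replace a with b; auto. extensionality i.
  assert (D := contraction_fixed_0 (fun j => a j - b j)%C _ (ell2c_minus _ _ _ _ Ha Hb)).
  assert (D' : forall j, (a j - b j = 0)%C).
  { apply D. intros j. rewrite Tadd. rewrite (E j) at 1. rewrite (Eb j) at 1. ring. }
  specialize (D' i).
  replace (b i) with (a i - (a i - b i))%C by ring. rewrite D'. ring.
Qed.

End Contraction.

Lemma RtoC_neq0 x : x <> 0 -> RtoC x <> RtoC 0.
Proof. intros H E. apply H, RtoC_inj, E. Qed.

(** * Integrals over a circle *)

Definition is_CInt (f : R -> C) (l : C) : Prop :=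
  is_RInt (V := C_R_NormedModule) f 0 (2 * PI) l.

Lemma is_CInt_pair f l :
  is_RInt (fun t => Re (f t)) 0 (2 * PI) (Re l) ->
  is_RInt (fun t => Im (f t)) 0 (2 * PI) (Im l) -> is_CInt f l.
Proof.
  intros HR HI. destruct l as [lr li].
  apply (is_RInt_fct_extend_pair (U := R_NormedModule) (V := R_NormedModule)); auto.
Qed.

Lemma is_CInt_Re f l : is_CInt f l -> is_RInt (fun t => Re (f t)) 0 (2 * PI) (Re l).
Proof. apply (is_RInt_fct_extend_fst (U := R_NormedModule) (V := R_NormedModule)). Qed.

Lemma is_CInt_Im f l : is_CInt f l -> is_RInt (fun t => Im (f t)) 0 (2 * PI) (Im l).
Proof. apply (is_RInt_fct_extend_snd (U := R_NormedModule) (V := R_NormedModule)). Qed.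

Lemma is_CInt_ext f g l :
  (forall t, 0 <= t <= 2 * PI -> f t = g t) -> is_CInt f l -> is_CInt g l.
Proof.
  intros H. apply is_RInt_ext. intros x Hx. apply H.
  pose proof PI_RGT_0. rewrite Rmin_left, Rmax_right in Hx by lra. lra.
Qed.

Lemma is_CInt_plus f g l m :
  is_CInt f l -> is_CInt g m -> is_CInt (fun t => f t + g t)%C (l + m).
Proof. intros Hf Hg. apply (is_RInt_plus (V := C_R_NormedModule)); auto. Qed.

Lemma is_CInt_scal z f l : is_CInt f l -> is_CInt (fun t => z * f t)%C (z * l).
Proof.
  intros H. pose proof (is_CInt_Re _ _ H) as HR. pose proof (is_CInt_Im _ _ H) as HI.
  apply is_CInt_pair.
  - apply (is_RInt_minus (V := R_NormedModule)
      (fun t => Re z * Re (f t)) (fun t => Im z * Im (f t)));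
    apply (is_RInt_scal (V := R_NormedModule)); auto.
  - apply (is_RInt_plus (V := R_NormedModule)
      (fun t => Re z * Im (f t)) (fun t => Im z * Re (f t)));
    apply (is_RInt_scal (V := R_NormedModule)); auto.
Qed.

Lemma is_CInt_const z : is_CInt (fun _ => z) (RtoC (2 * PI) * z).
Proof.
  apply is_CInt_pair.
  - replace (Re (RtoC (2 * PI) * z)) with (scal (2 * PI - 0) (Re z)).
    + apply (is_RInt_const (V := R_NormedModule)).
    + unfold scal, Re, Im; simpl; unfold mult; simpl. ring.
  - replace (Im (RtoC (2 * PI) * z)) with (scal (2 * PI - 0) (Im z)).
    + apply (is_RInt_const (V := R_NormedModule)).
    + unfold scal, Re, Im; simpl; unfold mult; simpl. ring.
Qed.

Lemma is_CInt_unique f l l' : is_CInt f l -> is_CInt f l' -> l = l'.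
Proof.
  intros H H'.
  pose proof (is_RInt_unique _ _ _ _ (is_CInt_Re _ _ H)) as A.
  rewrite (is_RInt_unique _ _ _ _ (is_CInt_Re _ _ H')) in A.
  pose proof (is_RInt_unique _ _ _ _ (is_CInt_Im _ _ H)) as B.
  rewrite (is_RInt_unique _ _ _ _ (is_CInt_Im _ _ H')) in B.
  destruct l, l'. simpl in *. congruence.
Qed.

Lemma is_contour_CInt rho g v :
  is_contour rho g v <->
  is_CInt (fun t => RtoC rho * expi t * g t)%C (- RtoC (2 * PI) * v).
Proof.
  assert (P : RtoC PI <> 0) by (apply RtoC_neq0, PI_neq0).
  assert (I0 : Ci <> 0) by (intros E; apply (f_equal snd) in E; simpl in E; lra).
  assert (I2 : (Ci * Ci = -1)%C)
    by (apply injective_projections; simpl; ring).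
  assert (T2 : RtoC 2 <> 0) by (apply RtoC_neq0; lra).
  rewrite RtoC_mult. split.
  - intros (I & HI & ->).
    apply (is_CInt_ext (fun t => - Ci * (Ci * RtoC rho * expi t * g t))%C).
    { intros t _. replace (- Ci * (Ci * RtoC rho * expi t * g t))%C
        with (- (Ci * Ci) * (RtoC rho * expi t * g t))%C by ring.
      rewrite I2. ring. }
    replace (- (RtoC 2 * RtoC PI) * (- / (2 * RtoC PI * Ci) * I))%C with (- Ci * I)%C.
    + apply is_CInt_scal. exact HI.
    + replace (- (RtoC 2 * RtoC PI) * (- / (2 * RtoC PI * Ci) * I))%C with (I / Ci)%C
        by (field; auto).
      replace (- Ci * I)%C with ((- (Ci * Ci)) * I / Ci)%C by (field; auto).
      rewrite I2. field; auto.
  - intros H. exists (Ci * (- (RtoC 2 * RtoC PI) * v))%C. split.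
    + apply (is_CInt_ext (fun t => Ci * (RtoC rho * expi t * g t))%C).
      { intros t _. ring. }
      apply is_CInt_scal. exact H.
    + field; auto.
Qed.

Lemma is_contour_ext rho f g v :
  (forall t, 0 <= t <= 2 * PI -> f t = g t) -> is_contour rho f v -> is_contour rho g v.
Proof.
  rewrite !is_contour_CInt. intros H. apply is_CInt_ext.
  intros t Ht. rewrite H; auto.
Qed.

Lemma is_contour_plus rho f g u v :
  is_contour rho f u -> is_contour rho g v ->
  is_contour rho (fun t => f t + g t)%C (u + v).
Proof.
  rewrite !is_contour_CInt. intros Hf Hg.
  replace (- RtoC (2 * PI) * (u + v))%C
    with (- RtoC (2 * PI) * u + - RtoC (2 * PI) * v)%C by ring.
  eapply is_CInt_ext; [|apply (is_CInt_plus _ _ _ _ Hf Hg)].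
  intros t _. simpl. ring.
Qed.

Lemma is_contour_scal rho z f u :
  is_contour rho f u -> is_contour rho (fun t => z * f t)%C (z * u).
Proof.
  rewrite !is_contour_CInt. intros Hf.
  replace (- RtoC (2 * PI) * (z * u))%C with (z * (- RtoC (2 * PI) * u))%C by ring.
  eapply is_CInt_ext; [|apply (is_CInt_scal z _ _ Hf)].
  intros t _. simpl. ring.
Qed.

Lemma is_contour_unique rho f u v : is_contour rho f u -> is_contour rho f v -> u = v.
Proof.
  rewrite !is_contour_CInt. intros Hu Hv. pose proof (is_CInt_unique _ _ _ Hu Hv) as E.
  assert (P : RtoC (2 * PI) <> 0) by (apply RtoC_neq0; pose proof PI_RGT_0; lra).
  replace u with (- / RtoC (2 * PI) * (- RtoC (2 * PI) * u))%C by (field; auto).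
  rewrite E. field; auto.
Qed.

(** ** Functions with Fourier modes of one sign *)

Lemma expi_plus x y : expi (x + y) = (expi x * expi y)%C.
Proof.
  unfold expi. rewrite cos_plus, sin_plus.
  apply injective_projections; simpl; ring.
Qed.

Lemma expi_0 : expi 0 = RtoC 1.
Proof. unfold expi. rewrite cos_0, sin_0. reflexivity. Qed.

Lemma Cmod_expi x : Cmod (expi x) = 1.
Proof.
  unfold Cmod, expi. simpl fst; simpl snd.
  rewrite <- sqrt_1. f_equal. pose proof (sin2_cos2 x) as E. unfold Rsqr in E. lra.
Qed.

Lemma is_CInt_expi (s : R) m :
  s = 1 \/ s = -1 -> is_CInt (fun t => expi (INR (S m) * (s * t))) 0.
Proof.
  intros Hs. set (p := INR (S m) * s).
  assert (p0 : p <> 0).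
  { apply Rmult_integral_contrapositive. split; [apply not_0_INR; lia|].
    destruct Hs; lra. }
  assert (Per : sin (p * (2 * PI)) = 0 /\ cos (p * (2 * PI)) = 1).
  { assert (S1 : sin (0 + 2 * INR (S m) * PI) = 0) by (rewrite sin_period; apply sin_0).
    assert (C1 : cos (0 + 2 * INR (S m) * PI) = 1) by (rewrite cos_period; apply cos_0).
    rewrite Rplus_0_l in S1, C1.
    unfold p. destruct Hs as [-> | ->].
    - replace (INR (S m) * 1 * (2 * PI)) with (2 * INR (S m) * PI) by ring. auto.
    - replace (INR (S m) * -1 * (2 * PI)) with (- (2 * INR (S m) * PI)) by ring.
      rewrite sin_neg, cos_neg, S1, C1. split; lra. }
  destruct Per as [PS PC].
  apply (is_CInt_ext (fun t => expi (p * t))).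
  { intros t _. f_equal. unfold p. ring. }
  assert (cont : forall (f f' : R -> R) x, (forall y, is_derive f y (f' y)) -> continuous f x).
  { intros f f' x H. apply (ex_derive_continuous (V := R_NormedModule)).
    exists (f' x). apply H. }
  apply is_CInt_pair; simpl.
  - evar_last.
    + apply (is_RInt_derive (fun t => sin (p * t) / p) (fun t => cos (p * t))).
      * intros x _. auto_derive; auto. field; auto.
      * intros x _. apply (cont _ (fun y => - sin (p * y) * p)).
        intros y. auto_derive; auto. ring.
    + rewrite PS, Rmult_0_r, sin_0. unfold minus, plus, opp; simpl. field; auto.
  - evar_last.
    + apply (is_RInt_derive (fun t => - cos (p * t) / p) (fun t => sin (p * t))).
      * intros x _. auto_derive; auto. field; auto.
      * intros x _. apply (cont _ (fun y => cos (p * y) * p)).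
        intros y. auto_derive; auto. ring.
    + rewrite PC, Rmult_0_r, cos_0. unfold minus, plus, opp; simpl. field; auto.
Qed.

(** [h] is, on the circle, a boundary value of a function holomorphic inside the
    disc ([s = 1]) or outside it ([s = -1]): its Fourier modes [e^{i p t}] with
    [s p < 0] vanish.  Stability under products with [e^{i s t}] and under
    uniform limits makes this class a substitute for Cauchy's theorem. *)
Definition hardy (s : R) (h : R -> C) : Prop :=
  forall m, is_CInt (fun t => expi (INR (S m) * (s * t)) * h t)%C 0.

Lemma hardy_const s z : s = 1 \/ s = -1 -> hardy s (fun _ => z).
Proof.
  intros Hs m. apply (is_CInt_ext (fun t => z * expi (INR (S m) * (s * t)))%C).
  { intros; ring. }
  replace (RtoC 0) with (z * 0)%C by ring.
  apply is_CInt_scal, is_CInt_expi; auto.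
Qed.

Lemma hardy_plus s f g : hardy s f -> hardy s g -> hardy s (fun t => f t + g t)%C.
Proof.
  intros Hf Hg m. replace (RtoC 0) with (0 + 0)%C by ring.
  eapply is_CInt_ext; [|apply (is_CInt_plus _ _ _ _ (Hf m) (Hg m))].
  intros; simpl; ring.
Qed.

Lemma hardy_scal s z f : hardy s f -> hardy s (fun t => z * f t)%C.
Proof.
  intros Hf m. replace (RtoC 0) with (z * 0)%C by ring.
  eapply is_CInt_ext; [|apply (is_CInt_scal z _ _ (Hf m))].
  intros; simpl; ring.
Qed.

Lemma hardy_shift s f : hardy s f -> hardy s (fun t => expi (s * t) * f t)%C.
Proof.
  intros Hf m. eapply is_CInt_ext; [|apply (Hf (S m))].
  intros t _. rewrite (S_INR (S m)).
  replace ((INR (S m) + 1) * (s * t)) with (INR (S m) * (s * t) + s * t) by ring.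
  rewrite expi_plus. ring.
Qed.

Lemma hardy_mean s f : hardy s f -> is_CInt (fun t => expi (s * t) * f t)%C 0.
Proof.
  intros H. eapply is_CInt_ext; [|apply (H 0%nat)].
  intros t _. simpl. rewrite Rmult_1_l. reflexivity.
Qed.

Lemma hardy_ext s f g :
  (forall t, 0 <= t <= 2 * PI -> f t = g t) -> hardy s f -> hardy s g.
Proof.
  intros H Hf m. eapply is_CInt_ext; [|apply (Hf m)]. intros t Ht. simpl. rewrite H; auto.
Qed.

Lemma hardy_lim s (p : nat -> R -> C) (h : R -> C) q c :
  0 <= q < 1 -> (forall n, hardy s (p n)) ->
  (forall n t, 0 <= t <= 2 * PI -> Cmod (h t - p n t) <= q ^ n * c) -> hardy s h.
Proof.
  intros Hq Hp Hb m. pose proof PI_RGT_0 as Pi.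
  set (cl := fun t => Rmax 0 (Rmin t (2 * PI))).
  assert (Hcl : forall t, 0 <= cl t <= 2 * PI).
  { intros t. unfold cl. split; [apply Rmax_l|].
    apply Rmax_lub; [lra|apply Rmin_r]. }
  assert (Ecl : forall t, 0 <= t <= 2 * PI -> cl t = t).
  { intros t Ht. unfold cl. rewrite Rmin_left by lra. apply Rmax_right; lra. }
  (* clamping [t] turns the bound on the circle into uniform convergence on R *)
  destruct (filterlim_RInt (V := C_R_CompleteNormedModule)
    (fun n t => expi (INR (S m) * (s * cl t)) * p n (cl t))%C 0 (2 * PI)
    eventually _ (fun t => expi (INR (S m) * (s * cl t)) * h (cl t))%C (fun _ => RtoC 0))
    as (If & L & HI).
  - intros n. eapply is_CInt_ext; [|apply (Hp n m)].
    intros t Ht. simpl. rewrite Ecl; auto.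
  - apply filterlim_locally. intros e.
    destruct (proj1 (filterlim_locally _ _) (pow_lim_0 q c Hq) e) as [n0 Hn0].
    exists n0. intros n Hn t.
    specialize (Hn0 n Hn). unfold ball in Hn0; simpl in Hn0.
    unfold AbsRing_ball, abs, minus, plus, opp in Hn0; simpl in Hn0.
    assert (M : Cmod (expi (INR (S m) * (s * cl t)) * p n (cl t)
                 - expi (INR (S m) * (s * cl t)) * h (cl t)) < e).
    { replace (expi (INR (S m) * (s * cl t)) * p n (cl t)
                 - expi (INR (S m) * (s * cl t)) * h (cl t))%C with
        (- (expi (INR (S m) * (s * cl t)) * (h (cl t) - p n (cl t))))%C by ring.
      rewrite Cmod_opp, Cmod_mult, Cmod_expi, Rmult_1_l.
      eapply Rle_lt_trans; [apply Hb, Hcl|].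
      eapply Rle_lt_trans; [apply Rle_abs|]. rewrite <- (Rplus_0_r (q ^ n * c)).
      rewrite <- Ropp_0 at 1. exact Hn0. }
    apply (C_NormedModule_mixin_compat1 _ _ _ M).
  - assert (E : If = RtoC 0).
    { apply (filterlim_locally_unique (F := eventually) (fun _ : nat => RtoC 0)); auto.
      apply filterlim_const. }
    subst If.
    eapply is_CInt_ext; [|exact HI]. intros t Ht. simpl. rewrite Ecl; auto.
Qed.

(** The [n]-th iterate of the relation approximates [h] with the error
    [(q e^{i s t})^n h], and each iterate is built from [f] by products with
    [e^{i s t}]. *)
Lemma hardy_geom s f h (q : C) c :
  s = 1 \/ s = -1 -> Cmod q < 1 -> hardy s f ->
  (forall t, 0 <= t <= 2 * PI -> Cmod (h t) <= c) ->
  (forall t, 0 <= t <= 2 * PI -> h t = f t + q * expi (s * t) * h t)%C ->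
  hardy s h.
Proof.
  intros Hs Hq Hf Hc E.
  set (p := fix p n := match n with O => fun _ => RtoC 0
     | S n => fun t => (f t + q * (expi (s * t) * p n t))%C end).
  apply (hardy_lim s p h (Cmod q) c).
  - split; [apply Cmod_ge_0|auto].
  - induction n as [|n IH]; simpl; [apply hardy_const; auto|].
    apply hardy_plus; auto. apply (hardy_scal s q). apply hardy_shift; auto.
  - intros n t Ht. induction n as [|n IH].
    + simpl. rewrite Rmult_1_l. replace (h t - 0)%C with (h t) by ring. auto.
    + simpl. rewrite (E t Ht).
      replace (f t + q * expi (s * t) * h t - (f t + q * (expi (s * t) * p n t)))%C
        with (q * (expi (s * t) * (h t - p n t)))%C by ring.
      rewrite !Cmod_mult, Cmod_expi, Rmult_1_l, Rmult_assoc.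
      apply Rmult_le_compat_l; [apply Cmod_ge_0|auto].
Qed.

Lemma Cmod_minus_ge (a b : C) : Cmod a - Cmod b <= Cmod (a - b).
Proof.
  pose proof (Cmod_triangle (a - b) b) as H.
  replace (a - b + b)%C with a in H by ring. lra.
Qed.

Lemma Cneq_0_of_mod z : 0 < Cmod z -> z <> 0.
Proof. intros H E. rewrite E, Cmod_0 in H. lra. Qed.

(** With [l_i] inside the circle, [z - l_i = rho e^{it} (1 - q_i e^{-it})] and
    [1 / (1 - q_i e^{-it})] has only modes of nonpositive frequency, with mean
    value [1]: this is the residue at infinity. *)
Lemma contour_rational (z0 l1 l2 al be : C) rho :
  Cmod (l1 - z0) < rho -> Cmod (l2 - z0) < rho ->
  is_contour rho (fun t => (al * circle z0 rho t + be) /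
     ((l1 - circle z0 rho t) * (l2 - circle z0 rho t)))%C (- al).
Proof.
  intros H1 H2.
  assert (r0 : 0 < rho) by (pose proof (Cmod_ge_0 (l1 - z0)); lra).
  assert (r0' : RtoC rho <> 0) by (apply RtoC_neq0; lra).
  set (q1 := ((l1 - z0) / RtoC rho)%C). set (q2 := ((l2 - z0) / RtoC rho)%C).
  assert (Q : forall l, Cmod (l - z0) < rho -> Cmod ((l - z0) / RtoC rho) < 1).
  { intros l Hl. rewrite Cmod_div by auto. rewrite Cmod_R, (Rabs_pos_eq rho) by lra.
    apply Rmult_lt_reg_r with rho; auto. unfold Rdiv. rewrite Rmult_assoc, Rinv_l; lra. }
  assert (Q1 : Cmod q1 < 1) by (apply Q; auto).
  assert (Q2 : Cmod q2 < 1) by (apply Q; auto).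
  assert (D : forall q t, Cmod q < 1 -> 1 - Cmod q <= Cmod (1 - q * expi (-1 * t))).
  { intros q t _. pose proof (Cmod_minus_ge 1 (q * expi (-1 * t))) as H.
    rewrite Cmod_mult, Cmod_expi, Cmod_1 in H. lra. }
  assert (N : forall q t, Cmod q < 1 -> (1 - q * expi (-1 * t) <> 0)%C).
  { intros q t Hq. apply Cneq_0_of_mod. specialize (D q t Hq). lra. }
  assert (B : forall q t, Cmod q < 1 -> Cmod (/ (1 - q * expi (-1 * t))) <= / (1 - Cmod q)).
  { intros q t Hq. rewrite Cmod_inv by auto. apply Rinv_le_contravar; [lra|]. auto. }
  set (f2 := fun t => (/ (1 - q2 * expi (-1 * t)))%C).
  set (f := fun t => (/ (1 - q1 * expi (-1 * t)) * f2 t)%C).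
  assert (E2 : forall t, f2 t = (1 + q2 * expi (-1 * t) * f2 t)%C).
  { intros t. unfold f2. field. apply N; auto. }
  assert (E1 : forall t, f t = (f2 t + q1 * expi (-1 * t) * f t)%C).
  { intros t. unfold f. field. apply N; auto. }
  assert (F2 : hardy (-1) f2).
  { apply (hardy_geom (-1) (fun _ => RtoC 1) f2 q2 (/ (1 - Cmod q2))); auto.
    - apply hardy_const; auto.
    - intros t _. unfold f2. auto. }
  assert (F : hardy (-1) f).
  { apply (hardy_geom (-1) f2 f q1 (/ (1 - Cmod q1) * / (1 - Cmod q2))); auto.
    intros t _. unfold f. rewrite Cmod_mult.
    apply Rmult_le_compat; try apply Cmod_ge_0; auto. unfold f2; auto. }
  assert (I2 : is_CInt f2 (RtoC (2 * PI))).
  { eapply is_CInt_ext; [intros t _; symmetry; apply (E2 t)|].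
    replace (RtoC (2 * PI)) with (RtoC (2 * PI) * 1 + q2 * 0)%C by ring.
    apply is_CInt_plus; [apply is_CInt_const|].
    eapply is_CInt_ext; [|apply (is_CInt_scal q2 _ _ (hardy_mean _ _ F2))].
    intros; simpl; ring. }
  assert (I1 : is_CInt f (RtoC (2 * PI))).
  { eapply is_CInt_ext; [intros t _; symmetry; apply (E1 t)|].
    replace (RtoC (2 * PI)) with (RtoC (2 * PI) + q1 * 0)%C by ring.
    apply is_CInt_plus; [auto|].
    eapply is_CInt_ext; [|apply (is_CInt_scal q1 _ _ (hardy_mean _ _ F))].
    intros; simpl; ring. }
  apply is_contour_CInt.
  replace (- RtoC (2 * PI) * - al)%C with
    (al * RtoC (2 * PI) + (al * z0 + be) / RtoC rho * 0)%C by ring.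
  eapply is_CInt_ext; [|apply is_CInt_plus;
    [apply (is_CInt_scal al _ _ I1)
    |apply (is_CInt_scal ((al * z0 + be) / RtoC rho)%C _ _ (hardy_mean _ _ F))]].
  intros t _. cbv beta. unfold f, f2.
  assert (EE : (expi t * expi (-1 * t) = 1)%C).
  { rewrite <- expi_plus. replace (t + -1 * t) with 0 by ring. apply expi_0. }
  assert (EN : expi t <> 0) by (apply Cneq_0_of_mod; rewrite Cmod_expi; lra).
  assert (Em : expi (-1 * t) = (/ expi t)%C).
  { replace (expi (-1 * t)) with (/ expi t * (expi t * expi (-1 * t)))%C by (field; auto).
    rewrite EE. ring. }
  pose proof (N q1 t Q1) as N1. pose proof (N q2 t Q2) as N2.
  rewrite Em in *.
  assert (Z : forall l, (l - circle z0 rho t = - (RtoC rho * expi t * (1 - (l - z0) / RtoC rho * / expi t)))%C).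
  { intros l. unfold circle. field; auto. }
  rewrite (Z l1), (Z l2). fold q1 q2.
  unfold circle. field.
  assert (forall q, (1 - q * / expi t <> 0 -> expi t - q <> 0)%C) as U.
  { intros q Hq E. apply Hq. replace (1 - q * / expi t)%C with ((expi t - q) / expi t)%C by (field; auto).
    rewrite E. field; auto. }
  repeat split; auto.
Qed.

(** * Analytic remainders *)

Lemma pseries_radius (a : nat -> R) r M x :
  (forall n, Rabs (a n) * r ^ n <= M) -> Rabs x < r ->
  Rbar_lt (Rabs x) (CV_radius a).
Proof.
  intros H Hx.
  assert (L : Rbar_le r (CV_radius a)).
  { apply (CV_radius_bounded a). exists M. intros n.
    rewrite Rabs_mult, <- RPow_abs, (Rabs_pos_eq r); auto.
    pose proof (Rabs_pos x); lra. }
  destruct (CV_radius a) as [c| |]; simpl in *; auto; lra.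
Qed.

Lemma pseries_conv (a : nat -> R) r M x :
  (forall n, Rabs (a n) * r ^ n <= M) -> Rabs x < r -> is_pseries a x (PSeries a x).
Proof.
  intros H Hx. apply PSeries_correct, CV_radius_inside, (pseries_radius a r M x H Hx).
Qed.

Lemma pseries_bound (a : nat -> R) r M x :
  (forall n, Rabs (a n) * r ^ n <= M) -> Rabs x <= r / 2 -> 0 < r ->
  Rabs (PSeries a x) <= 2 * M.
Proof.
  intros H Hx r0.
  assert (T : forall n, Rabs (a n * x ^ n) <= M * (1 / 2) ^ n).
  { intros n. rewrite Rabs_mult, <- RPow_abs.
    apply Rle_trans with (Rabs (a n) * (r * (1 / 2)) ^ n).
    - apply Rmult_le_compat_l; [apply Rabs_pos|].
      apply pow_incr. split; [apply Rabs_pos|lra].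
    - rewrite Rpow_mult_distr, <- Rmult_assoc.
      apply Rmult_le_compat_r; [apply pow_le; lra|auto]. }
  assert (G : is_series (fun n => M * (1 / 2) ^ n) (M * / (1 - 1 / 2))).
  { apply (is_series_scal_l M (fun n => (1/2) ^ n)). apply is_series_geom.
    rewrite Rabs_pos_eq; lra. }
  unfold PSeries.
  eapply Rle_trans; [apply Series_Rabs|].
  - apply (ex_series_le (V := R_CompleteNormedModule) _ (fun n => M * (1 / 2) ^ n)).
    + intros n. unfold norm; simpl. unfold abs; simpl. rewrite Rabs_Rabsolu. auto.
    + eexists; exact G.
  - eapply Rle_trans; [apply Series_le|].
    + intros n. split; [apply Rabs_pos|apply T].
    + eexists; exact G.
    + rewrite (is_series_unique _ _ G). lra.
Qed.

Lemma pseries_remainder (a : nat -> R) r M :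
  0 < r -> (forall n, Rabs (a n) * r ^ n <= M) -> a 0%nat = 0 ->
  remainder (r / 2) 1 (PSeries a).
Proof.
  intros r0 H a0. split.
  - exists a. intros e He. apply (pseries_conv a r M); auto. lra.
  - exists (2 * (M / r)). intros e He.
    assert (E : PSeries a e = e * PSeries (PS_decr_1 a) e).
    { rewrite PSeries_decr_1, a0; [ring|].
      eexists. apply (pseries_conv a r M); auto. lra. }
    rewrite E, Rabs_mult, pow_1, Rmult_comm.
    apply Rmult_le_compat_r; [apply Rabs_pos|].
    apply (pseries_bound _ r); auto; [|lra].
    intros n. unfold PS_decr_1. apply (Rmult_le_reg_r r); auto.
    unfold Rdiv. rewrite (Rmult_assoc M), Rinv_l, Rmult_1_r by lra.
    eapply Rle_trans; [|apply (H (S n))]. simpl. lra.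
Qed.

Lemma remainder_restrict e0 e1 p r : e1 <= e0 -> remainder e0 p r -> remainder e1 p r.
Proof.
  intros H [[a Ha] [c Hc]]. split.
  - exists a. intros e He. apply Ha. lra.
  - exists c. intros e He. apply Hc. lra.
Qed.

Lemma remainder_plus e0 p r r' :
  remainder e0 p r -> remainder e0 p r' -> remainder e0 p (fun e => r e + r' e).
Proof.
  intros [[a Ha] [c Hc]] [[b Hb] [d Hd]]. split.
  - exists (PS_plus a b). intros e He.
    apply (is_pseries_plus (K := R_AbsRing) (V := R_NormedModule) a b e (r e) (r' e)); auto.
  - exists (c + d). intros e He. eapply Rle_trans; [apply Rabs_triang|].
    specialize (Hc e He). specialize (Hd e He). lra.
Qed.

Lemma remainder_scal e0 p z r :
  remainder e0 p r -> remainder e0 p (fun e => z * r e).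
Proof.
  intros [[a Ha] [c Hc]]. split.
  - exists (PS_scal z a). intros e He.
    apply (is_pseries_scal (K := R_AbsRing) (V := R_NormedModule) z a e (r e)); auto.
    apply Rmult_comm.
  - exists (Rabs z * c). intros e He. rewrite Rabs_mult, Rmult_assoc.
    apply Rmult_le_compat_l; [apply Rabs_pos|auto].
Qed.

(** The terms of the series tend to zero at a point strictly between [|x|] and
    [e0], which bounds the radius of convergence from below. *)
Lemma pseries_inside (a : nat -> R) f e0 x :
  (forall e, Rabs e < e0 -> is_pseries a e (f e)) -> Rabs x < e0 ->
  Rbar_lt (Rabs x) (CV_radius a).
Proof.
  intros H Hx. set (y := (Rabs x + e0) / 2).
  assert (Hy : Rabs y = y) by (apply Rabs_pos_eq; unfold y; pose proof (Rabs_pos x); lra).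
  assert (L : Rbar_le y (CV_radius a)).
  { rewrite <- Hy. apply Rbar_not_lt_le. intros K.
    apply (CV_disk_outside a y K).
    apply ex_series_lim_0. exists (f y).
    apply is_series_ext with (2 := H y ltac:(unfold y in *; lra)).
    intros n. rewrite pow_n_pow. apply Rmult_comm. }
  assert (Rabs x < y) by (unfold y; lra).
  destruct (CV_radius a) as [c| |]; simpl in *; auto; lra.
Qed.

Lemma remainder_mult e0 p q r r' :
  remainder e0 p r -> remainder e0 q r' -> remainder e0 (p + q) (fun e => r e * r' e).
Proof.
  intros [[a Ha] [c Hc]] [[b Hb] [d Hd]]. split.
  - exists (PS_mult a b). intros e He.
    apply is_pseries_mult; auto.
    + apply (pseries_inside a r e0); auto.
    + apply (pseries_inside b r' e0); auto.
  - exists (c * d). intros e He. rewrite Rabs_mult, pow_add.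
    replace (c * d * (Rabs e ^ p * Rabs e ^ q)) with (c * Rabs e ^ p * (d * Rabs e ^ q)) by ring.
    apply Rmult_le_compat; auto using Rabs_pos.
Qed.

Lemma remainder_weaken e0 p r : remainder e0 (S p) r -> remainder e0 p r.
Proof.
  intros [Ha [c Hc]]. split; auto.
  exists (Rabs c * e0). intros e He. eapply Rle_trans; [apply (Hc e He)|].
  simpl. rewrite <- Rmult_assoc.
  apply Rmult_le_compat_r; [apply pow_le, Rabs_pos|].
  pose proof (Rle_abs c). pose proof (Rabs_pos c). pose proof (Rabs_pos e). nra.
Qed.

Lemma remainder_id e0 : remainder e0 1 (fun e => e).
Proof.
  split.
  - exists (fun n => match n with 1%nat => 1 | _ => 0 end). intros e He.
    unfold is_pseries. apply is_series_decr_1.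
    apply is_series_decr_1.
    apply (is_series_ext (K := R_AbsRing) (V := R_NormedModule) (fun _ => 0)).
    { intros n. rewrite pow_n_pow. unfold scal; simpl. unfold mult; simpl. ring. }
    evar_last.
    + apply filterlim_ext with (fun _ : nat => 0).
      { intros n. rewrite sum_n_const. ring. }
      apply filterlim_const.
    + unfold plus, opp, scal; simpl. unfold mult, one; simpl. ring.
  - exists 1. intros e He. rewrite pow_1. lra.
Qed.

(** * The resonant plane *)

(** Recursion on all earlier values; [G n] below is the table of the values up to
    rank [n]. *)
Lemma course_of_values {X : Type} (x0 : X) (F : nat -> (nat -> X) -> X) :
  (forall n f g, (forall p, (p <= n)%nat -> f p = g p) -> F n f = F n g) ->
  exists f, f 0%nat = x0 /\ forall n, f (S n) = F n f.
Proof.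
  intros Fext.
  set (G := fix G n := match n with
     | O => fun _ => x0
     | S n => fun m => if Nat.leb m n then G n m else F n (G n) end).
  assert (Gf : forall n p, (p <= n)%nat -> G n p = G p p).
  { induction n as [|n IH]; intros p Hp.
    - replace p with 0%nat by lia. reflexivity.
    - destruct (Nat.eq_dec p (S n)) as [->|E]; [reflexivity|].
      change (G (S n) p) with (if Nat.leb p n then G n p else F n (G n)).
      rewrite (proj2 (Nat.leb_le p n)) by lia. apply IH. lia. }
  exists (fun n => G n n). split; [reflexivity|]. intros n.
  change (G (S n) (S n)) with (if Nat.leb (S n) n then G n (S n) else F n (G n)).
  rewrite (proj2 (Nat.leb_gt (S n) n)) by lia.
  apply Fext. intros p Hp. apply Gf; auto.
Qed.

(** The square of a partial sum contains all the terms of the truncated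
    convolution, and further nonnegative ones. *)
Lemma convolution_le (x : nat -> R) N :
  (forall n, 0 <= x n) ->
  sum_f_R0 (PS_mult x x) N <= sum_f_R0 x N ^ 2.
Proof.
  intros Hx. destruct N as [|N].
  - unfold PS_mult. simpl. lra.
  - replace (sum_f_R0 x (S N) ^ 2) with (sum_f_R0 x (S N) * sum_f_R0 x (S N)) by ring.
    rewrite cauchy_finite by lia. unfold PS_mult.
    match goal with |- ?a <= ?a + ?b => assert (0 <= b); [|lra] end.
    apply cond_pos_sum. intros k. apply cond_pos_sum. intros l.
    apply Rmult_le_pos; auto.
Qed.

(** Couplings of a mode to finitely many others.  Listing them as coefficients
    with injective displacements makes the [l^2] bound a triangle inequality over
    reindexed families. *)
Definition hops (I : Type) : Type := list ((I -> R) * (I -> I)).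

Definition hop_op {I : Type} (h : hops I) (x : I -> R) : I -> R := fun i =>
  fold_right (fun p s => fst p i * x (snd p i) + s) 0 h.

Definition hop_opC {I : Type} (h : hops I) (a : I -> C) : I -> C := fun i =>
  fold_right (fun p s => RtoC (fst p i) * a (snd p i) + s)%C (RtoC 0) h.

Definition hops_bounded {I : Type} (h : hops I) (b : R) : Prop :=
  0 <= b /\ forall p, In p h ->
    (forall i, Rabs (fst p i) <= b) /\ (forall i j, snd p i = snd p j -> i = j).

(** An upper bound for the operator norm, one contribution for each displacement. *)
Definition hops_norm {I : Type} (h : hops I) (b : R) : R := INR (length h) * b.

Lemma hops_norm_ge0 {I : Type} (h : hops I) b : hops_bounded h b -> 0 <= hops_norm h b.
Proof. intros [b0 _]. apply Rmult_le_pos; auto. apply pos_INR. Qed.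

Lemma hop_op_ell2 {I : Type} (h : hops I) b x c :
  hops_bounded h b -> ell2 x c -> ell2 (hop_op h x) (hops_norm h b * c).
Proof.
  intros [b0 Hh] Hx. unfold hops_norm. induction h as [|[f g] h IH].
  - simpl. rewrite !Rmult_0_l. unfold hop_op; simpl. apply ell2_0; lra.
  - change (length ((f, g) :: h)) with (S (length h)). rewrite S_INR.
    replace ((INR (length h) + 1) * b * c) with (b * c + INR (length h) * b * c) by ring.
    apply (ell2_plus (fun i => f i * x (g i)) (hop_op h x)).
    + destruct (Hh (f, g)) as [Hf Hg]; [left; auto|].
      apply (ell2_mult f (fun i => x (g i))); auto.
      apply (ell2_reindex (fun i => Some (g i)) x c); auto.
      intros j j' i E E'. apply Hg. simpl. congruence.
    + apply IH. intros p Hp. apply Hh. right; auto.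
Qed.

Lemma Cmod_hop_opC {I : Type} (h : hops I) (a : I -> C) i :
  Cmod (hop_opC h a i) <=
  hop_op (map (fun p => (fun j => Rabs (fst p j), snd p)) h) (fun j => Cmod (a j)) i.
Proof.
  induction h as [|[f g] h IH].
  - unfold hop_opC, hop_op; simpl. rewrite Cmod_0. lra.
  - change (Cmod (RtoC (f i) * a (g i) + hop_opC h a i) <=
      Rabs (f i) * Cmod (a (g i)) +
      hop_op (map (fun p => (fun j => Rabs (fst p j), snd p)) h) (fun j => Cmod (a j)) i).
    eapply Rle_trans; [apply Cmod_triangle|].
    rewrite Cmod_mult, Cmod_R. lra.
Qed.

Lemma hop_opC_bounded {I : Type} (h : hops I) b :
  hops_bounded h b -> ell2_bounded (hop_opC h) (hops_norm h b).
Proof.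
  intros Hh. split; [apply hops_norm_ge0; auto|]. intros a c Ha.
  set (h' := map (fun p : (I -> R) * (I -> I) => (fun j => Rabs (fst p j), snd p)) h).
  assert (Hh' : hops_bounded h' b).
  { destruct Hh as [b0 Hh]. split; auto. intros p Hp.
    apply in_map_iff in Hp. destruct Hp as (q & <- & Hq). simpl.
    destruct (Hh q Hq) as [Q1 Q2]. split; auto. intros i. rewrite Rabs_Rabsolu. auto. }
  replace (hops_norm h b) with (hops_norm h' b)
    by (unfold hops_norm, h'; rewrite length_map; reflexivity).
  apply (ell2_le _ (hop_op h' (fun j => Cmod (a j))) (hops_norm h' b * c)); [|lra|].
  - intros i. rewrite (Rabs_pos_eq (Cmod _)) by apply Cmod_ge_0.
    eapply Rle_trans; [apply Cmod_hop_opC|]. apply Rle_abs.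
  - apply hop_op_ell2; auto.
Qed.

Lemma hop_opC_lin {I : Type} (h : hops I) (a b : I -> C) (y z : C) i :
  hop_opC h (fun j => y * a j + z * b j)%C i = (y * hop_opC h a i + z * hop_opC h b i)%C.
Proof.
  unfold hop_opC. induction h as [|[f g] h IH]; simpl; [ring|]. rewrite IH. ring.
Qed.

Lemma hop_opC_RtoC {I : Type} (h : hops I) (x : I -> R) i :
  hop_opC h (fun j => RtoC (x j)) i = RtoC (hop_op h x i).
Proof.
  unfold hop_opC, hop_op. induction h as [|[f g] h IH]; simpl; auto.
  rewrite IH, RtoC_plus, RtoC_mult. reflexivity.
Qed.

Lemma hop_op_pseries {I : Type} (h : hops I) (V : nat -> I -> R) (v : I -> R) e i :
  (forall j, is_pseries (fun n => V n j) e (v j)) ->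
  is_pseries (fun n => hop_op h (V n) i) e (hop_op h v i).
Proof.
  intros H. unfold hop_op. induction h as [|[f g] h IH]; simpl.
  - unfold is_pseries. apply (is_series_ext (K := R_AbsRing) (V := R_NormedModule) (fun _ => 0)).
    { intros n. unfold scal; simpl. unfold mult; simpl. ring. }
    apply filterlim_ext with (fun _ : nat => 0).
    { intros n. rewrite sum_n_const. ring. }
    apply filterlim_const.
  - apply (is_pseries_plus (K := R_AbsRing) (V := R_NormedModule)
      (fun n => f i * V n (g i)) _ e (f i * v (g i))); auto.
    apply (is_pseries_scal (K := R_AbsRing) (V := R_NormedModule) (f i) (fun n => V n (g i))); auto.
    apply Rmult_comm.
Qed.

Definition delta (s t : bool) : R := if Bool.eqb s t then 1 else 0.

Section Plane.
Variables (I : Type) (wt : I -> R) (om : R) (Rs : I -> R) (G : R)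
  (h : hops I) (b : R) (pt : bool -> I).
Hypotheses (h_bd : hops_bounded h b) (G0 : 0 <= G) (Rs_le : forall i, Rabs (Rs i) <= G)
  (Rs_pt : forall t, Rs (pt t) = 0) (wt_pt : forall t, wt (pt t) = om)
  (pt_inj : pt true <> pt false)
  (Rs_inv : forall i, (exists t, i = pt t) \/ Rs i * (wt i - om) = 1).

Definition unit_at (s : bool) (i : I) : R :=
  if excluded_middle_informative (i = pt s) then 1 else 0.

Lemma unit_at_pt s t : unit_at s (pt t) = delta s t.
Proof.
  unfold unit_at, delta. destruct (excluded_middle_informative _) as [E|E];
  destruct s, t; simpl; auto; exfalso; auto; apply pt_inj; auto.
Qed.

Lemma unit_at_ell2 s : ell2 (unit_at s) 1.
Proof.
  apply (ell2_le _ (fun i => match (if excluded_middle_informative (i = pt s) then Some tt else None)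
     with Some u => (fun _ => 1) u | None => 0 end) 1); [|lra|].
  - intros i. unfold unit_at. destruct excluded_middle_informative; lra.
  - apply (ell2_reindex (I := unit) _ (fun _ => 1)).
    + intros j j' u. destruct (excluded_middle_informative (j = pt s));
      destruct (excluded_middle_informative (j' = pt s)); congruence.
    + split; [lra|]. intros l Hl. destruct l as [|[] [|[] l]]; simpl; try lra.
      exfalso. inversion Hl as [|? ? N]. apply N. left; auto.
Qed.

(** Taylor coefficient of order [n + 1] in the fixed point equation of
    [invariant_plane], from those of order at most [n]. *)
Definition plane_step (n : nat) (V : nat -> bool -> I -> R) (s : bool) (i : I) : R :=
  Rs i * (PS_mult (fun p => hop_op h (V p s) (pt true)) (fun p => V p true i) n
        + PS_mult (fun p => hop_op h (V p s) (pt false)) (fun p => V p false i) n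
        - hop_op h (V n s) i).

Let beta := hops_norm h b.

(** Norm estimate for [plane_step], with the two convolutions replaced by the
    convolution of the bounds. *)
Definition bound_step (n : nat) (c : nat -> R) : R :=
  G * (beta * (2 * PS_mult c c n + c n)).

(** The partial sums satisfy [s_{N+1} <= 1 + G beta r (2 s_N^2 + s_N)], and the
    interval [0, 2] is stable under this map as soon as [10 G beta r <= 1]. *)
Lemma bound_sum_le (c : nat -> R) r :
  c 0%nat = 1 -> (forall n, c (S n) = bound_step n c) -> (forall n, 0 <= c n) ->
  0 < r -> 10 * (G * beta * r) <= 1 ->
  forall N, sum_f_R0 (fun n => c n * r ^ n) N <= 2.
Proof.
  intros C0 CS Cp r0 Hr. induction N as [|N IH].
  - simpl. rewrite C0. lra.
  - rewrite decomp_sum by lia. simpl Init.Nat.pred. rewrite C0.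
    set (x := fun n => c n * r ^ n) in *.
    assert (E : sum_f_R0 (fun i => c (S i) * r ^ S i) N =
       r * G * beta * (2 * sum_f_R0 (PS_mult x x) N + sum_f_R0 x N)).
    { rewrite Rmult_plus_distr_l, <- Rmult_assoc, !scal_sum, <- sum_plus.
      apply sum_eq. intros n Hn. rewrite CS. unfold bound_step.
      replace (PS_mult x x n) with (r ^ n * PS_mult c c n).
      - unfold x. simpl. ring.
      - unfold PS_mult, x. rewrite scal_sum. apply sum_eq. intros p Hp.
        replace (r ^ n) with (r ^ p * r ^ (n - p)) by (rewrite <- pow_add; f_equal; lia).
        ring. }
    rewrite E.
    assert (Xp : forall n, 0 <= x n) by (intros n; apply Rmult_le_pos; auto; apply pow_le; lra).
    pose proof (convolution_le x N Xp) as Cv.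
    assert (S0 : 0 <= sum_f_R0 x N) by (apply cond_pos_sum; auto).
    assert (Gb : 0 <= r * G * beta).
    { apply Rmult_le_pos; [apply Rmult_le_pos; lra|]. apply hops_norm_ge0; auto. }
    assert (2 * sum_f_R0 (PS_mult x x) N + sum_f_R0 x N <= 10) by nra.
    simpl. nra.
Qed.

Lemma sum_ell2 (x : nat -> I -> R) (c : nat -> R) n :
  (forall p, (p <= n)%nat -> ell2 (x p) (c p)) ->
  ell2 (fun i => sum_f_R0 (fun p => x p i) n) (sum_f_R0 c n).
Proof.
  induction n as [|n IH]; intros H; simpl.
  - apply H; lia.
  - apply ell2_plus; [apply IH; intros; apply H|apply H]; lia.
Qed.

Lemma conv_ell2 (V : nat -> bool -> I -> R) (c : nat -> R) n s t :
  (forall p s, (p <= n)%nat -> ell2 (V p s) (c p)) ->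
  ell2 (fun i => PS_mult (fun p => hop_op h (V p s) (pt t)) (fun p => V p t i) n)
       (beta * PS_mult c c n).
Proof.
  intros H. unfold PS_mult. rewrite scal_sum.
  apply (sum_ell2 (fun p i => hop_op h (V p s) (pt t) * V (n - p)%nat t i)).
  intros p Hp. replace (c p * c (n - p)%nat * beta) with (beta * c p * c (n - p)%nat) by ring.
  pose proof (hop_op_ell2 h b (V p s) (c p) h_bd (H p s Hp)) as K.
  apply (ell2_mult (fun _ => hop_op h (V p s) (pt t))).
  - apply K.
  - intros _. apply (ell2_coef _ _ (pt t) K).
  - apply H. lia.
Qed.

Lemma plane_coefficients :
  exists (V : nat -> bool -> I -> R) (c : nat -> R),
    V 0%nat = unit_at /\ (forall n, V (S n) = plane_step n V) /\
    c 0%nat = 1 /\ (forall n, c (S n) = bound_step n c) /\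
    (forall n, 0 <= c n) /\ forall n s, ell2 (V n s) (c n).
Proof.
  destruct (course_of_values unit_at plane_step) as (V & V0 & VS).
  { intros n f g E. extensionality s. extensionality i.
    unfold plane_step, PS_mult. rewrite (E n) by lia. f_equal. f_equal.
    f_equal; apply sum_eq; intros p Hp; rewrite (E p), (E (n - p)%nat) by lia; reflexivity. }
  destruct (course_of_values 1 bound_step) as (c & c0 & cS).
  { intros n f g E. unfold bound_step, PS_mult. rewrite (E n) by lia.
    do 4 f_equal. apply sum_eq. intros p Hp. rewrite (E p), (E (n - p)%nat) by lia; reflexivity. }
  assert (K : forall n, forall p, (p <= n)%nat -> forall s, ell2 (V p s) (c p)).
  { induction n as [|n IH]; intros p Hp s.
    - replace p with 0%nat by lia. rewrite V0, c0. apply unit_at_ell2.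
    - destruct (Nat.eq_dec p (S n)) as [->|E]; [|apply IH; lia].
      rewrite VS, cS. unfold plane_step, bound_step.
      apply (ell2_mult Rs (fun i => PS_mult (fun p => hop_op h (V p s) (pt true)) (fun p => V p true i) n
        + PS_mult (fun p => hop_op h (V p s) (pt false)) (fun p => V p false i) n
        - hop_op h (V n s) i)); auto.
      replace (beta * (2 * PS_mult c c n + c n)) with
        (beta * PS_mult c c n + beta * PS_mult c c n + beta * c n) by ring.
      apply ell2_plus; [apply ell2_plus; apply conv_ell2; auto|].
      apply (ell2_le _ (hop_op h (V n s)) (beta * c n)); [|lra|].
      + intros i. rewrite Rabs_Ropp. lra.
      + apply hop_op_ell2; auto. }
  exists V, c. repeat split; auto.
  - intros n. apply (K n n (le_n n) true).
  - apply (K n n (le_n n) s).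
  - apply (K n n (le_n n) s).
Qed.

(** The invariant plane of [diag wt + e A] issued from the two resonant
    directions is spanned by vectors [v_s] normalised by [v_s(pt t) = delta]; then
    invariance reads
    [v_s = unit_s + e Rs (sum_t (A v_s)(pt t) v_t - A v_s)],
    a quadratic equation solved by a power series in [e].  Its coefficients are
    dominated by those of a scalar quadratic recursion, whose weighted partial
    sums never exceed 2. *)
Lemma invariant_plane :
  exists (r : R) (v : R -> bool -> I -> R) (rho : bool -> bool -> R -> R),
    0 < r /\ (forall s t, remainder r 1 (rho s t)) /\
    forall e, Rabs e < r ->
      (forall s, ell2 (v e s) 2) /\
      (forall s t, v e s (pt t) = delta s t) /\
      forall s i,
        wt i * v e s i + e * hop_op h (v e s) i =
        (om * delta s true + e * (hop_op h (unit_at s) (pt true) + rho s true e)) * v e true i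
      + (om * delta s false + e * (hop_op h (unit_at s) (pt false) + rho s false e)) * v e false i.
Proof.
  destruct plane_coefficients as (V & c & V0 & VS & c0 & cS & cp & HV).
  assert (b0 : 0 <= beta) by (apply hops_norm_ge0; auto).
  set (r := / (10 * (G * beta) + 1)).
  assert (D0 : 0 < 10 * (G * beta) + 1) by nra.
  assert (r0 : 0 < r) by (apply Rinv_0_lt_compat; auto).
  assert (Hr : 10 * (G * beta * r) <= 1).
  { apply (Rmult_le_reg_r (10 * (G * beta) + 1)); auto.
    replace (10 * (G * beta * r) * (10 * (G * beta) + 1)) with (10 * (G * beta))
      by (unfold r; field; lra). lra. }
  pose proof (bound_sum_le c r c0 cS cp r0 Hr) as Sum.
  assert (cr : forall n, c n * r ^ n <= 2).
  { intros n. eapply Rle_trans; [|apply (Sum n)].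
    assert (Q : forall n, 0 <= c n * r ^ n) by (intros; apply Rmult_le_pos; auto; apply pow_le; lra).
    destruct n as [|n]; simpl; [lra|].
    pose proof (cond_pos_sum (fun n => c n * r ^ n) n Q). simpl in *. lra. }
  assert (BV : forall s i n, Rabs (V n s i) * r ^ n <= 2).
  { intros s i n. eapply Rle_trans; [|apply (cr n)].
    apply Rmult_le_compat_r; [apply pow_le; lra|]. apply ell2_coef, HV. }
  assert (BH : forall s i n, Rabs (hop_op h (V n s) i) * r ^ n <= beta * 2).
  { intros s i n.
    apply Rle_trans with (beta * c n * r ^ n).
    - apply Rmult_le_compat_r; [apply pow_le; lra|].
      apply ell2_coef, hop_op_ell2; auto.
    - rewrite Rmult_assoc. apply Rmult_le_compat_l; auto. }
  set (v := fun e s i => PSeries (fun n => V n s i) e).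
  set (rc := fun s t n => match n with O => 0 | S _ => hop_op h (V n s) (pt t) end).
  exists (r / 2), v, (fun s t => PSeries (rc s t)).
  split; [lra|]. split.
  { intros s t. apply (pseries_remainder _ r (beta * 2)); auto.
    intros [|n]; [|apply BH]. unfold rc. rewrite Rabs_R0. lra. }
  intros e He.
  assert (Pv : forall s i, is_pseries (fun n => V n s i) e (v e s i)).
  { intros s i. apply (pseries_conv _ r 2); auto. lra. }
  assert (Ph : forall s i, is_pseries (fun n => hop_op h (V n s) i) e (hop_op h (v e s) i)).
  { intros s i. apply (hop_op_pseries h (fun n => V n s)). intros j. apply Pv. }
  assert (Prho : forall s t, hop_op h (v e s) (pt t) =
     hop_op h (unit_at s) (pt t) + PSeries (rc s t) e).
  { intros s t. rewrite <- (is_pseries_unique _ _ _ (Ph s (pt t))).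
    rewrite PSeries_decr_1 by (eexists; apply Ph).
    rewrite (PSeries_decr_1 (rc s t)).
    2:{ eexists. apply (pseries_conv _ r (beta * 2)); [|lra].
        intros [|n]; [|apply BH]. unfold rc. rewrite Rabs_R0. lra. }
    rewrite V0. simpl rc. unfold PS_decr_1. simpl rc. ring. }
  assert (Eq : forall s i, v e s i = unit_at s i + e * (Rs i *
     (hop_op h (v e s) (pt true) * v e true i + hop_op h (v e s) (pt false) * v e false i
      - hop_op h (v e s) i))).
  { intros s i. unfold v at 1. rewrite PSeries_decr_1 by (eexists; apply Pv).
    rewrite V0. f_equal. f_equal. apply is_pseries_unique.
    assert (Pm : forall t, is_pseries (PS_mult (fun p => hop_op h (V p s) (pt t)) (fun p => V p t i)) e
       (hop_op h (v e s) (pt t) * v e t i)).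
    { intros t. apply is_pseries_mult; auto.
      - apply (pseries_radius _ r (beta * 2)); auto; lra.
      - apply (pseries_radius _ r 2); auto; lra. }
    apply (is_pseries_ext (K := R_AbsRing) (V := R_NormedModule) (PS_scal (Rs i)
      (PS_plus (PS_plus (PS_mult (fun p => hop_op h (V p s) (pt true)) (fun p => V p true i))
                        (PS_mult (fun p => hop_op h (V p s) (pt false)) (fun p => V p false i)))
               (PS_opp (fun n => hop_op h (V n s) i))))).
    { intros n. unfold PS_decr_1. rewrite VS. reflexivity. }
    apply (is_pseries_scal (K := R_AbsRing) (V := R_NormedModule) (Rs i)); [apply Rmult_comm|].
    apply (is_pseries_plus (K := R_AbsRing) (V := R_NormedModule)).
    - apply (is_pseries_plus (K := R_AbsRing) (V := R_NormedModule)); auto.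
    - apply (is_pseries_opp (K := R_AbsRing) (V := R_NormedModule)); auto. }
  assert (Vpt : forall s t, v e s (pt t) = delta s t).
  { intros s t. rewrite Eq, Rs_pt, unit_at_pt. ring. }
  split; [|split; auto].
  - intros s.
    apply (ell2_lim (fun n i => sum_f_R0 (fun p => e ^ p * V p s i) n)).
    + intros n. apply (ell2_le _ (fun i => sum_f_R0 (fun p => e ^ p * V p s i) n)
        (sum_f_R0 (fun p => r ^ p * c p) n)); [intros; lra| |].
      * eapply Rle_trans; [|apply (Sum n)]. apply sum_Rle. intros. lra.
      * apply (sum_ell2 (fun p i => e ^ p * V p s i) (fun p => r ^ p * c p)).
        intros p _. apply (ell2_mult (fun _ => e ^ p)); auto.
        { apply pow_le; lra. }
        intros _. rewrite <- RPow_abs. apply pow_incr. split; [apply Rabs_pos|lra].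
    + intros i. eapply is_lim_seq_ext; [|exact (Pv s i)].
      intros n. rewrite <- sum_n_Reals. apply sum_n_ext. intros p.
      rewrite pow_n_pow. reflexivity.
  - intros s i. rewrite <- !Prho.
    destruct (Rs_inv i) as [[t ->]|Hi].
    + rewrite wt_pt, !Vpt. destruct s, t; unfold delta; simpl; ring.
    + assert (D : wt i - om <> 0) by (intros E; rewrite E, Rmult_0_r in Hi; lra).
      assert (Ui : forall s, unit_at s i = 0).
      { intros s'. unfold unit_at. destruct excluded_middle_informative as [E|E]; auto.
        rewrite E, wt_pt in D. exfalso. apply D. ring. }
      assert (F : (wt i - om) * v e s i = e * (hop_op h (v e s) (pt true) * v e true i
        + hop_op h (v e s) (pt false) * v e false i - hop_op h (v e s) i)).
      { rewrite (Eq s i) at 1. rewrite Ui. rewrite Rplus_0_l.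
        replace ((wt i - om) * (e * (Rs i * (hop_op h (v e s) (pt true) * v e true i
        + hop_op h (v e s) (pt false) * v e false i - hop_op h (v e s) i))))
        with (Rs i * (wt i - om) * (e * (hop_op h (v e s) (pt true) * v e true i
        + hop_op h (v e s) (pt false) * v e false i - hop_op h (v e s) i))) by ring.
        rewrite Hi. ring. }
      destruct s; unfold delta; simpl; lra.
Qed.

End Plane.

(** * Resolvent and spectral projector in diagonalising coordinates *)

(** Keeping [i] as a common factor leaves a real operator, whence real invariant
    vectors and real remainders. *)
Definition diag_hop {I : Type} (wt : I -> R) (h : hops I) (e : R) (a : I -> C) : I -> C :=
  fun i => (Ci * (RtoC (wt i) * a i + RtoC e * hop_opC h a i))%C.

Lemma Cmod_Ci : Cmod Ci = 1.
Proof. unfold Cmod, Ci. simpl fst; simpl snd. replace (0 ^ 2 + 1 ^ 2) with 1 by ring. apply sqrt_1. Qed.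

Lemma additive_hop {I : Type} (h : hops I) (f : I -> C) :
  additive (fun a i => f i * hop_opC h a i)%C.
Proof.
  intros x y i. replace (fun j : I => (x j - y j)%C) with (fun j : I => (1 * x j + (-1) * y j)%C)
    by (extensionality j; ring).
  rewrite hop_opC_lin. ring.
Qed.

Lemma ell2_bounded_mult {I : Type} (f : I -> C) T d q :
  0 <= d -> (forall i, Cmod (f i) <= d) -> ell2_bounded T q ->
  ell2_bounded (fun (a : I -> C) i => f i * T a i)%C (d * q).
Proof.
  intros Hd Hf [q0 HT]. split; [nra|]. intros a c Ha. rewrite Rmult_assoc.
  apply (ell2c_mult f (T a)); auto.
Qed.

Lemma ell2_bounded_le {I : Type} (T : (I -> C) -> I -> C) q q' :
  q <= q' -> ell2_bounded T q -> ell2_bounded T q'.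
Proof.
  intros H [q0 HT]. split; [lra|]. intros a c Ha.
  apply (ell2c_le _ (T a) (q * c)); auto; [intros; lra|].
  destruct Ha as [c0 _]. apply Rmult_le_compat_r; auto.
Qed.

Lemma ell2_bounded_minus {I : Type} (T T' : (I -> C) -> I -> C) q q' :
  ell2_bounded T q -> ell2_bounded T' q' ->
  ell2_bounded (fun a i => T a i - T' a i)%C (q + q').
Proof.
  intros [q0 HT] [q0' HT']. split; [lra|]. intros a c Ha.
  rewrite Rmult_plus_distr_r. apply ell2c_minus; auto.
Qed.

Section Resolvent.
Variables (I : Type) (wt : I -> R) (h : hops I) (b e : R) (z : C) (d : R).
Hypotheses (h_bd : hops_bounded h b) (d0 : 0 < d)
  (dist : forall i, d <= Cmod (Ci * RtoC (wt i) - z))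
  (small : Rabs e * hops_norm h b <= d / 2).

Let D i := (/ (Ci * RtoC (wt i) - z))%C.
Let T (a : I -> C) (i : I) := (- (Ci * RtoC e * D i) * hop_opC h a i)%C.

Lemma dist_neq0 i : (Ci * RtoC (wt i) - z <> 0)%C.
Proof. apply Cneq_0_of_mod. specialize (dist i). lra. Qed.

Lemma D_le i : Cmod (D i) <= / d.
Proof.
  unfold D. rewrite Cmod_inv by apply dist_neq0.
  apply Rinv_le_contravar; auto.
Qed.

Lemma T_bounded : ell2_bounded T (1 / 2).
Proof.
  assert (n0 := hops_norm_ge0 h b h_bd).
  apply (ell2_bounded_le _ (Rabs e * / d * hops_norm h b)).
  - apply (Rmult_le_reg_r d); auto.
    replace (Rabs e * / d * hops_norm h b * d) with (Rabs e * hops_norm h b) by (field; lra).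
    lra.
  - apply ell2_bounded_mult; [| |apply hop_opC_bounded; auto].
    + apply Rmult_le_pos; [apply Rabs_pos|left; apply Rinv_0_lt_compat; auto].
    + intros i. rewrite Cmod_opp, !Cmod_mult, Cmod_Ci, Cmod_R, Rmult_1_l.
      apply Rmult_le_compat_l; [apply Rabs_pos|apply D_le].
Qed.

Lemma resolvent_eq (a f : I -> C) i :
  (diag_hop wt h e a i - z * a i = f i)%C <-> a i = (D i * f i + T a i)%C.
Proof.
  pose proof (dist_neq0 i) as N. unfold T, D, diag_hop. split; intros H.
  - rewrite <- H. field. auto.
  - apply (f_equal (fun x => (Ci * RtoC (wt i) - z) * x)%C) in H.
    replace ((Ci * RtoC (wt i) - z) * (/ (Ci * RtoC (wt i) - z) * f i +
       - (Ci * RtoC e * / (Ci * RtoC (wt i) - z)) * hop_opC h a i))%C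
      with (f i - Ci * RtoC e * hop_opC h a i)%C in H by (field; auto).
    replace (Ci * (RtoC (wt i) * a i + RtoC e * hop_opC h a i) - z * a i)%C
      with ((Ci * RtoC (wt i) - z) * a i + Ci * RtoC e * hop_opC h a i)%C by ring.
    rewrite H. ring.
Qed.

Lemma Df_ell2c f c : ell2c f c -> ell2c (fun i => D i * f i)%C (/ d * c).
Proof.
  intros Hf. apply ell2c_mult; auto using D_le. left; apply Rinv_0_lt_compat; auto.
Qed.

Lemma resolvent_exists f c :
  ell2c f c ->
  exists a, ell2c a (2 / d * c) /\ forall i, (diag_hop wt h e a i - z * a i = f i)%C.
Proof.
  intros Hf.
  destruct (neumann_solve I T (1 / 2) (additive_hop h _) T_bounded ltac:(lra)
    _ _ (Df_ell2c f c Hf)) as (a & Ha & E).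
  exists a. split.
  - replace (2 / d * c) with (/ d * c / (1 - 1 / 2)) by (field; lra). auto.
  - intros i. apply resolvent_eq. auto.
Qed.

Lemma resolvent_bound a f c c' :
  ell2c f c -> ell2c a c' -> (forall i, (diag_hop wt h e a i - z * a i = f i)%C) ->
  ell2c a (2 / d * c).
Proof.
  intros Hf Ha E.
  replace (2 / d * c) with (/ d * c / (1 - 1 / 2)) by (field; lra).
  apply (neumann_bound I T (1 / 2) (additive_hop h _) T_bounded ltac:(lra)
    (fun i => D i * f i)%C a (/ d * c) c'); auto.
  - apply Df_ell2c; auto.
  - intros i. apply resolvent_eq. auto.
Qed.

End Resolvent.

Lemma hardy_hop {I : Type} (h : hops I) (p : R -> I -> C) i :
  (forall j, hardy 1 (fun t => p t j)) -> hardy 1 (fun t => hop_opC h (p t) i).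
Proof.
  intros H. unfold hop_opC. induction h as [|[f g] h IH]; simpl.
  - apply hardy_const; auto.
  - apply hardy_plus; [apply hardy_scal, H|]. apply IH.
Qed.

Definition plane_comb {I : Type} (v : bool -> I -> R) (x : bool -> C) (i : I) : C :=
  (x true * RtoC (v true i) + x false * RtoC (v false i))%C.

Section Projector.
Variables (I : Type) (wt : I -> R) (h : hops I) (b e : R) (pt : bool -> I)
  (v : bool -> I -> R) (M : bool -> bool -> R) (z0 : C) (rho d : R).
Hypotheses (h_bd : hops_bounded h b)
  (v_bd : forall s, ell2 (v s) 2)
  (v_pt : forall s t, v s (pt t) = delta s t)
  (v_inv : forall s i, wt i * v s i + e * hop_op h (v s) i
     = M s true * v true i + M s false * v false i)
  (rho0 : 0 < rho)
  (dist : forall i, (exists t, i = pt t) \/ d <= Cmod (Ci * RtoC (wt i) - z0))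
  (small : rho + 5 * (Rabs e * hops_norm h b) < d).

(** Projection along the plane onto the families vanishing at the resonant sites. *)
Let off (a : I -> C) (i : I) : C :=
  (a i - (a (pt true) * RtoC (v true i) + a (pt false) * RtoC (v false i)))%C.

Let D (i : I) : C :=
  if excluded_middle_informative (exists t, i = pt t) then RtoC 0
  else (/ (Ci * RtoC (wt i) - z0))%C.

Let B (a : I -> C) : I -> C := off (hop_opC h a).

Lemma proj_d0 : 0 < d.
Proof.
  pose proof (hops_norm_ge0 h b h_bd). pose proof (Rabs_pos e). nra.
Qed.

Lemma proj_D_le i : Cmod (D i) <= / d.
Proof.
  pose proof proj_d0 as d0. unfold D. destruct excluded_middle_informative as [E|E].
  - rewrite Cmod_0. left; apply Rinv_0_lt_compat; auto.
  - destruct (dist i) as [?|Hi]; [contradiction|].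
    rewrite Cmod_inv by (apply Cneq_0_of_mod; lra). apply Rinv_le_contravar; auto.
Qed.

Lemma RtoC_v_ell2c (x : C) s : ell2c (fun i => x * RtoC (v s i))%C (Cmod x * 2).
Proof.
  apply ell2c_scal. apply (ell2_le _ (v s) 2); auto; [|lra].
  intros i. rewrite Cmod_R, Rabs_Rabsolu. lra.
Qed.

Lemma comb_ell2c x : exists c, ell2c (plane_comb v x) c.
Proof. eexists. apply ell2c_plus; apply RtoC_v_ell2c. Qed.

Lemma off_ell2c a c : ell2c a c -> ell2c (off a) (5 * c).
Proof.
  intros Ha. unfold off.
  apply (ell2c_le _ (off a) (c + (Cmod (a (pt true)) * 2 + Cmod (a (pt false)) * 2))).
  - intros; apply Rle_refl.
  - pose proof (ell2c_coef a c (pt true) Ha). pose proof (ell2c_coef a c (pt false) Ha). lra.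
  - apply ell2c_minus; auto. apply ell2c_plus; apply RtoC_v_ell2c.
Qed.

Lemma off_pt a t : off a (pt t) = RtoC 0.
Proof. unfold off. rewrite !v_pt. destruct t; unfold delta; simpl; ring. Qed.

Lemma hop_opC_split a i :
  hop_opC h a i = (hop_opC h (off a) i + (a (pt true) * RtoC (hop_op h (v true) i)
    + a (pt false) * RtoC (hop_op h (v false) i)))%C.
Proof.
  rewrite <- !hop_opC_RtoC, <- hop_opC_lin.
  replace (hop_opC h (off a) i + hop_opC h (fun j => a (pt true) * RtoC (v true j) + a (pt false) * RtoC (v false j)) i)%C
    with (1 * hop_opC h (off a) i + 1 * hop_opC h (fun j => a (pt true) * RtoC (v true j) + a (pt false) * RtoC (v false j)) i)%C by ring.
  rewrite <- hop_opC_lin. f_equal. extensionality j. unfold off. ring.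
Qed.

Lemma v_inv_C s i : (RtoC (wt i) * RtoC (v s i) + RtoC e * RtoC (hop_op h (v s) i)
  = RtoC (M s true) * RtoC (v true i) + RtoC (M s false) * RtoC (v false i))%C.
Proof. rewrite <- !RtoC_mult, <- !RtoC_plus, v_inv. reflexivity. Qed.

Lemma diag_hop_split a i :
  diag_hop wt h e a i = (diag_hop wt h e (off a) i
    + Ci * (a (pt true) * (RtoC (M true true) * RtoC (v true i) + RtoC (M true false) * RtoC (v false i))
          + a (pt false) * (RtoC (M false true) * RtoC (v true i) + RtoC (M false false) * RtoC (v false i))))%C.
Proof.
  rewrite <- !v_inv_C. unfold diag_hop. rewrite hop_opC_split. unfold off at 2. ring.
Qed.

(** The part of the resolvent transverse to the plane solves a fixed point
    equation whose only dependence on [z = z0 + zeta] is linear. *)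
Let T (zeta : C) (y : I -> C) (i : I) : C := (D i * (zeta * y i - Ci * RtoC e * B y i))%C.

(** The plane being invariant, the component of [a] along it only contributes
    multiples of the [v_t], which [off] removes; dividing by the diagonal at [z0]
    gives the fixed point form. *)
Lemma transverse_eq z a f :
  (forall i, (diag_hop wt h e a i - z * a i = f i)%C) ->
  forall i, off a i = (D i * off f i + T (z - z0) (off a) i)%C.
Proof.
  intros E i. unfold T, D. destruct excluded_middle_informative as [[t ->]|Hi].
  - rewrite off_pt. ring.
  - destruct (dist i) as [?|Di]; [contradiction|].
    assert (N : (Ci * RtoC (wt i) - z0 <> 0)%C).
    { apply Cneq_0_of_mod. pose proof proj_d0. lra. }
    assert (F : (off f i = (Ci * RtoC (wt i) - z) * off a i + Ci * RtoC e * B (off a) i)%C).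
    { unfold off at 1. rewrite <- !E. rewrite !(diag_hop_split a). unfold diag_hop at 1 2 3.
      rewrite !v_pt. unfold B.
      replace (off (hop_opC h (off a)) i) with (hop_opC h (off a) i - (hop_opC h (off a) (pt true) * RtoC (v true i)
        + hop_opC h (off a) (pt false) * RtoC (v false i)))%C by reflexivity.
      rewrite !off_pt. unfold delta; simpl.
      replace (a i) with (off a i + (a (pt true) * RtoC (v true i) + a (pt false) * RtoC (v false i)))%C
        by (unfold off; ring).
      ring. }
    rewrite F. field. auto.
Qed.

Lemma B_bounded : ell2_bounded B (5 * hops_norm h b).
Proof.
  destruct (hop_opC_bounded h b h_bd) as [n0 Hn]. split; [lra|].
  intros a c Ha. rewrite Rmult_assoc. apply off_ell2c; auto.
Qed.

Lemma T_lin zeta x y i : T zeta (fun j => x j - y j)%C i = (T zeta x i - T zeta y i)%C.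
Proof.
  assert (L : forall k, hop_opC h (fun j => x j - y j)%C k = (hop_opC h x k - hop_opC h y k)%C).
  { intros k. replace (fun j : I => (x j - y j)%C) with (fun j : I => (1 * x j + (-1) * y j)%C)
      by (extensionality j; ring).
    rewrite hop_opC_lin. ring. }
  unfold T, B, off. rewrite !L. ring.
Qed.

Let q := (rho + 5 * (Rabs e * hops_norm h b)) / d.

Lemma proj_q : 0 <= q < 1.
Proof.
  pose proof proj_d0 as d0. pose proof (hops_norm_ge0 h b h_bd). pose proof (Rabs_pos e).
  assert (0 <= Rabs e * hops_norm h b) by nra.
  unfold q. split.
  - apply Rmult_le_pos; [lra|]. left; apply Rinv_0_lt_compat; auto.
  - apply (Rmult_lt_reg_r d); auto. unfold Rdiv. rewrite Rmult_assoc, Rinv_l; lra.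
Qed.

Lemma transverse_bounded zeta : Cmod zeta <= rho -> ell2_bounded (T zeta) q.
Proof.
  intros Hz. pose proof proj_d0 as d0. pose proof proj_q as Q.
  replace q with (/ d * (rho + Rabs e * (5 * hops_norm h b))) by (unfold q; field; lra).
  apply (ell2_bounded_mult D); [left; apply Rinv_0_lt_compat; auto|apply proj_D_le|].
  apply (ell2_bounded_minus (fun y i => zeta * y i)%C (fun y i => Ci * RtoC e * B y i)%C).
  - split; [lra|]. intros a c Ha. apply (ell2c_mult (fun _ => zeta)); auto. lra.
  - apply (ell2_bounded_mult (fun _ => Ci * RtoC e)%C); auto using B_bounded, Rabs_pos.
    intros _. rewrite Cmod_mult, Cmod_Ci, Cmod_R. lra.
Qed.

(** Iterating the fixed point equation approximates the transverse part of the
    resolvent, geometrically and uniformly on the circle, by polynomials in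
    [z - z0]; their contour integrals vanish, so the projector maps into the
    plane. *)
Lemma contour_transverse (f : I -> C) c (W : R -> I -> C) :
  ell2c f c ->
  (forall t, 0 <= t <= 2 * PI -> (exists c', ell2c (W t) c') /\
     forall i, (diag_hop wt h e (W t) i - circle z0 rho t * W t i = f i)%C) ->
  forall i, is_contour rho (fun t => off (W t) i) 0.
Proof.
  intros Hf HW i. pose proof proj_q as Q. pose proof proj_d0 as d0.
  set (zeta := fun t => (RtoC rho * expi t)%C).
  assert (Hz : forall t, Cmod (zeta t) <= rho).
  { intros t. unfold zeta. rewrite Cmod_mult, Cmod_R, Cmod_expi, Rabs_pos_eq; lra. }
  set (g := fun j => (D j * off f j)%C).
  assert (Hg : ell2c g (/ d * (5 * c))).
  { apply ell2c_mult; [left; apply Rinv_0_lt_compat; auto|apply proj_D_le|].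
    apply off_ell2c; auto. }
  set (p := fix p n (t : R) := match n with
     | O => fun _ : I => RtoC 0
     | S n => fun j => (g j + T (zeta t) (p n t) j)%C end).
  assert (Hp : forall n j, hardy 1 (fun t => p n t j)).
  { induction n as [|n IH]; intros j; simpl; [apply hardy_const; auto|].
    apply hardy_plus; [apply hardy_const; auto|].
    unfold T. apply hardy_scal.
    apply (hardy_ext 1 (fun t => RtoC rho * (expi (1 * t) * p n t j) +
      (- (Ci * RtoC e)) * (hop_opC h (p n t) j +
         ((- RtoC (v true j)) * hop_opC h (p n t) (pt true) +
          (- RtoC (v false j)) * hop_opC h (p n t) (pt false))))%C).
    { intros t _. unfold zeta, B, off. rewrite Rmult_1_l. ring. }
    apply hardy_plus; [apply hardy_scal, hardy_shift, IH|].
    apply hardy_scal, hardy_plus; [apply hardy_hop; auto|].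
    apply hardy_plus; apply hardy_scal, hardy_hop; auto. }
  assert (Ey : forall t, 0 <= t <= 2 * PI -> forall j,
     off (W t) j = (g j + T (zeta t) (off (W t)) j)%C).
  { intros t Ht j. destruct (HW t Ht) as [_ E].
    rewrite (transverse_eq (circle z0 rho t) (W t) f E j).
    unfold g. replace (circle z0 rho t - z0)%C with (zeta t) by (unfold circle, zeta; ring).
    reflexivity. }
  assert (By : forall t, 0 <= t <= 2 * PI -> ell2c (off (W t)) (/ d * (5 * c) / (1 - q))).
  { intros t Ht. destruct (HW t Ht) as [[c' Hc'] _].
    apply (neumann_bound I (T (zeta t)) q) with (f := g) (d := 5 * c').
    - intros x y j. apply T_lin.
    - apply transverse_bounded, Hz.
    - lra.
    - auto.
    - apply off_ell2c; auto.
    - intros j. apply Ey; auto. }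
  assert (Hh : hardy 1 (fun t => off (W t) i)).
  { apply (hardy_lim 1 (fun n t => p n t i) _ q (/ d * (5 * c) / (1 - q))); auto.
    intros n t Ht.
    apply (ell2c_coef (fun i => off (W t) i - p n t i)%C).
    induction n as [|n IH].
    - simpl. rewrite Rmult_1_l. eapply ell2c_le; [|apply Rle_refl|apply (By t Ht)].
      intros j. apply Req_le. f_equal. ring.
    - simpl pow. rewrite Rmult_assoc.
      eapply ell2c_le; [|apply Rle_refl|].
      2:{ apply (transverse_bounded (zeta t) (Hz t)). exact IH. }
      intros j. rewrite T_lin, (Ey t Ht j). simpl. apply Req_le. f_equal. ring. }
  apply is_contour_CInt.
  replace (- RtoC (2 * PI) * 0)%C with (RtoC rho * 0)%C by ring.
  eapply is_CInt_ext; [|apply (is_CInt_scal (RtoC rho) _ _ (hardy_mean _ _ Hh))].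
  intros t _. simpl. rewrite Rmult_1_l. ring.
Qed.

Lemma projector_in_plane (f a : I -> C) c (W : R -> I -> C) :
  ell2c f c ->
  (forall t, 0 <= t <= 2 * PI -> (exists c', ell2c (W t) c') /\
     forall i, (diag_hop wt h e (W t) i - circle z0 rho t * W t i = f i)%C) ->
  (forall i, is_contour rho (fun t => W t i) (a i)) ->
  forall i, a i = plane_comb v (fun t => a (pt t)) i.
Proof.
  intros Hf HW Ha i.
  assert (E : off a i = RtoC 0).
  { apply (is_contour_unique rho (fun t => off (W t) i)).
    - apply (is_contour_ext rho (fun t => W t i + ((- RtoC (v true i)) * W t (pt true)
        + (- RtoC (v false i)) * W t (pt false)))%C).
      { intros; unfold off; ring. }
      replace (off a i) with (a i + ((- RtoC (v true i)) * a (pt true)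
        + (- RtoC (v false i)) * a (pt false)))%C by (unfold off; ring).
      apply is_contour_plus; auto. apply is_contour_plus; apply is_contour_scal; auto.
    - apply (contour_transverse f c); auto. }
  replace (a i) with (off a i + plane_comb v (fun t => a (pt t)) i)%C by (unfold off, plane_comb; ring).
  rewrite E. ring.
Qed.

Lemma diag_hop_comb x i :
  diag_hop wt h e (plane_comb v x) i =
  plane_comb v (fun t => Ci * (x true * RtoC (M true t) + x false * RtoC (M false t)))%C i.
Proof.
  unfold diag_hop, plane_comb. rewrite hop_opC_lin, !hop_opC_RtoC.
  transitivity (Ci * (x true * (RtoC (wt i) * RtoC (v true i) + RtoC e * RtoC (hop_op h (v true) i))
    + x false * (RtoC (wt i) * RtoC (v false i) + RtoC e * RtoC (hop_op h (v false) i))))%C; [ring|].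
  rewrite !v_inv_C. ring.
Qed.

(** On the plane the resolvent is that of a two by two matrix: by Cramer's rule its
    entries are rational functions of [z] with denominator [(l1 - z) (l2 - z)],
    and only their coefficients of degree one in [z] survive integration. *)
Lemma plane_in_range (l1 l2 : C) (x : bool -> C) :
  Cmod (l1 - z0) < rho -> Cmod (l2 - z0) < rho ->
  (forall z, ((Ci * RtoC (M true true) - z) * (Ci * RtoC (M false false) - z)
      - (Ci * RtoC (M true false)) * (Ci * RtoC (M false true)) = (l1 - z) * (l2 - z))%C) ->
  exists W : R -> I -> C,
    (forall t, (exists c, ell2c (W t) c) /\
       forall i, (diag_hop wt h e (W t) i - circle z0 rho t * W t i = plane_comb v x i)%C) /\
    forall i, is_contour rho (fun t => W t i) (plane_comb v x i).
Proof.
  intros H1 H2 Hdet.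
  set (X := fun t (s : bool) => let z := circle z0 rho t in
    ((if s then x true * (Ci * RtoC (M false false) - z) - x false * (Ci * RtoC (M false true))
      else x false * (Ci * RtoC (M true true) - z) - x true * (Ci * RtoC (M true false)))
     / ((l1 - z) * (l2 - z)))%C).
  exists (fun t => plane_comb v (X t)). split.
  - intros t. split; [apply comb_ell2c|]. intros i. rewrite diag_hop_comb.
    set (z := circle z0 rho t).
    assert (N : forall l, Cmod (l - z0) < rho -> (l - z <> 0)%C).
    { intros l Hl. unfold z, circle.
      apply Cneq_0_of_mod.
      pose proof (Cmod_minus_ge (RtoC rho * expi t) (l - z0)) as K.
      rewrite Cmod_mult, Cmod_R, Cmod_expi, Rabs_pos_eq in K by lra.
      replace (l - (z0 + RtoC rho * expi t))%C with (- (RtoC rho * expi t - (l - z0)))%C by ring.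
      rewrite Cmod_opp. lra. }
    assert (P : ((l1 - z) * (l2 - z) <> 0)%C) by (apply Cmult_neq_0; auto).
    unfold plane_comb, X. fold z. rewrite <- Hdet in *. field. auto.
  - intros i. unfold plane_comb.
    assert (K : forall s, is_contour rho (fun t => X t s) (x s)).
    { intros s. destruct s; unfold X.
      - pose proof (contour_rational z0 l1 l2 (- x true)
          (x true * (Ci * RtoC (M false false)) - x false * (Ci * RtoC (M false true))) rho H1 H2) as K.
        replace (- - x true)%C with (x true) in K by ring.
        eapply is_contour_ext; [|exact K].
        intros t _. unfold Cdiv. simpl. f_equal. ring.
      - pose proof (contour_rational z0 l1 l2 (- x false)
          (x false * (Ci * RtoC (M true true)) - x true * (Ci * RtoC (M true false))) rho H1 H2) as K.
        replace (- - x false)%C with (x false) in K by ring.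
        eapply is_contour_ext; [|exact K].
        intros t _. unfold Cdiv. simpl. f_equal. ring. }
    apply (is_contour_ext rho (fun t => RtoC (v true i) * X t true + RtoC (v false i) * X t false)%C).
    { intros; ring. }
    replace (x true * RtoC (v true i) + x false * RtoC (v false i))%C
      with (RtoC (v true i) * x true + RtoC (v false i) * x false)%C by ring.
    apply is_contour_plus; apply is_contour_scal; auto.
Qed.

End Projector.

(** * The linearized operator on the lattice line *)

Definition site (k j : Z * Z) : option Z :=
  let l := (fst j / fst k)%Z in
  if (Z.eqb (l * fst k) (fst j) && Z.eqb (l * snd k) (snd j))%bool then Some l else None.

Lemma site_spec k j l : (0 < fst k)%Z -> site k j = Some l <-> j = Zscal2 l k.
Proof.
  intros Hk. unfold site, Zscal2. split.
  - destruct (Z.eqb_spec (fst j / fst k * fst k) (fst j)) as [E|]; simpl; [|discriminate].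
    destruct (Z.eqb_spec (fst j / fst k * snd k) (snd j)) as [E'|]; simpl; [|discriminate].
    intros H. injection H as <-. destruct j. simpl in *. congruence.
  - intros ->. simpl. rewrite Z.div_mul by lia. rewrite !Z.eqb_refl. reflexivity.
Qed.

Lemma site_scal k l : (0 < fst k)%Z -> site k (Zscal2 l k) = Some l.
Proof. intros H. apply site_spec; auto. Qed.

Lemma site_sub k j (s : Z) :
  (0 < fst k)%Z -> site k (Zsub2 j (Zscal2 s k)) = option_map (fun l => (l - s)%Z) (site k j).
Proof.
  intros Hk. destruct (site k j) as [l|] eqn:E; simpl.
  - apply site_spec in E; auto. apply site_spec; auto. subst j.
    unfold Zsub2, Zscal2; simpl. f_equal; ring.
  - destruct (site k (Zsub2 j (Zscal2 s k))) as [l|] eqn:E'; auto.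
    apply site_spec in E'; auto.
    assert (site k j = Some (l + s)%Z); [|congruence].
    apply site_spec; auto. destruct j as [j1 j2]. unfold Zsub2, Zscal2 in *; simpl in *.
    injection E' as E1 E2. f_equal; nia.
Qed.

Definition sg (s : bool) : R := if s then 1 else -1.

Section Line.
Variables (N : R) (k : Z * Z) (mu : R * R).
Hypotheses (N0 : 0 < N) (k0 : (0 < fst k)%Z)
  (mu_nonint : ~ exists j : Z * Z, mu = toR2 j).

Let K := norm2 (toR2 k).

Definition xi (l : Z) : R * R := add2 (toR2 (Zscal2 l k)) mu.
Definition modulus (l : Z) : R := norm2 (xi l).
Definition freq (i : Z * bool) : R := w N k (sg (snd i)) (Zscal2 (fst i) k) mu.
Definition kappa : R := dot2 (perp2 (toR2 k)) mu.

(** Coordinates on the eigenvectors [(- s N / |xi_l|, 1)] of the unperturbed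
    operator at the site [l k]. *)
Definition of_coords (a : Z * bool -> C) : state :=
  (fun j => match site k j with
     | Some l => RtoC (- N / modulus l) * (a (l, true) - a (l, false))
     | None => 0 end,
   fun j => match site k j with
     | Some l => a (l, true) + a (l, false)
     | None => 0 end)%C.

Definition to_coords (U : state) : Z * bool -> C := fun i =>
  ((snd U (Zscal2 (fst i) k)
    - RtoC (sg (snd i) * (modulus (fst i) / N)) * fst U (Zscal2 (fst i) k)) / 2)%C.

(** Entry, from the mode [i'] to the mode [i], of the derivative in [eps] of the
    operator divided by [i]. *)
Definition coupling (i i' : Z * bool) : R :=
  let p := modulus (fst i) in
  let p' := modulus (fst i') in
  kappa / (4 * N * K * p' ^ 2) *
  (K ^ 2 - p' ^ 2 - sg (snd i) * p * (sg (snd i') * p' + K)).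

Definition neighbours : list (Z * bool -> Z * bool) :=
  (fun i => (fst i - 1, snd i)%Z) :: (fun i => (fst i - 1, negb (snd i))%Z) ::
  (fun i => (fst i + 1, snd i)%Z) :: (fun i => (fst i + 1, negb (snd i))%Z) :: nil.

Definition wave_hops : hops (Z * bool) :=
  map (fun f => (fun i => coupling i (f i), f)) neighbours.

Lemma norm2_pos x : x <> (0, 0) -> 0 < norm2 x.
Proof.
  intros H. unfold norm2, dot2. apply sqrt_lt_R0. destruct x as [x y]; simpl.
  destruct (Req_dec x 0) as [->|Hx]; [destruct (Req_dec y 0) as [->|Hy]|].
  - exfalso; auto.
  - nra.
  - nra.
Qed.

Lemma norm2_sq x : norm2 x ^ 2 = fst x ^ 2 + snd x ^ 2.
Proof.
  unfold norm2, dot2. rewrite pow2_sqrt; [ring|].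
  pose proof (Rle_0_sqr (fst x)); pose proof (Rle_0_sqr (snd x)). unfold Rsqr in *. lra.
Qed.

Lemma norm2_triangle x y : norm2 (add2 x y) <= norm2 x + norm2 y.
Proof.
  pose proof (Cmod_triangle x y) as T. unfold Cmod in T. simpl in T.
  unfold norm2, dot2, add2; simpl.
  destruct x as [x1 x2], y as [y1 y2]; simpl in *.
  rewrite !Rmult_1_r in T. exact T.
Qed.

Lemma xi_neq0 l : xi l <> (0, 0).
Proof.
  intros E. apply mu_nonint. exists (Zscal2 (- l) k).
  unfold xi, add2, toR2, Zscal2 in *. destruct mu as [x y]. simpl in *.
  injection E as E1 E2. rewrite !mult_IZR, opp_IZR. rewrite mult_IZR in E1, E2.
  f_equal; lra.
Qed.

Lemma modulus_pos l : 0 < modulus l.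
Proof. apply norm2_pos, xi_neq0. Qed.

Lemma K_pos : 0 < K.
Proof.
  apply norm2_pos. unfold toR2. intros E. injection E as E _. apply eq_IZR in E. lia.
Qed.

Lemma to_of_coords a : to_coords (of_coords a) = a.
Proof.
  extensionality i. destruct i as [l s]. unfold to_coords, of_coords; simpl.
  rewrite site_scal by auto. pose proof (modulus_pos l) as P.
  destruct (a (l, true)) as [x y] eqn:E1, (a (l, false)) as [x' y'] eqn:E2.
  unfold Cdiv. destruct s; rewrite ?E1, ?E2; unfold sg;
  apply injective_projections; simpl; field; lra.
Qed.

Lemma of_to_coords U :
  (forall j, (~ exists l : Z, j = Zscal2 l k) -> fst U j = RtoC 0 /\ snd U j = RtoC 0) ->
  of_coords (to_coords U) = U.
Proof.
  intros H. destruct U as [u v]. unfold of_coords, to_coords; simpl in *. f_equal; extensionality j.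
  - destruct (site k j) as [l|] eqn:E.
    + apply site_spec in E; auto. subst j. pose proof (modulus_pos l) as P.
      destruct (u (Zscal2 l k)) as [x y], (v (Zscal2 l k)) as [x' y'].
      apply injective_projections; simpl; field; lra.
    + symmetry. apply H. intros [l El]. apply site_spec in El; auto. congruence.
  - destruct (site k j) as [l|] eqn:E.
    + apply site_spec in E; auto. subst j. pose proof (modulus_pos l) as P.
      destruct (u (Zscal2 l k)) as [x y], (v (Zscal2 l k)) as [x' y'].
      apply injective_projections; simpl; field; lra.
    + symmetry. apply H. intros [l El]. apply site_spec in El; auto. congruence.
Qed.

(** Along the line [mu + Z k] the vector product of [k] with the wave number is
    constant, so a sine wave couples neighbouring sites with equal strengths. *)
Lemma perp_grad_dot_sin a u j :
  perp_grad_dot (trig_sin a k) mu u j =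
  (Ci * RtoC (a / 2 * dot2 (perp2 (toR2 k)) (add2 (toR2 j) mu)) *
   (u (Zsub2 j k) + u (Zsub2 j (Zscal2 (-1) k))))%C.
Proof.
  unfold perp_grad_dot, fsub, fmul, trig_dx, trig_dy, trig_sin, Dmux, Dmuy, add2, toR2, dot2, perp2.
  cbn [map fold_right fst snd Zsub2 Zscal2].
  rewrite !mult_IZR, !minus_IZR, !mult_IZR.
  assert (S : (RtoC a / (2 * Ci))%C = (0, - (a / 2))).
  { apply injective_projections; simpl; field. }
  rewrite S. cbn [Zsub2 fst snd].
  set (U1 := u (fst j - fst k, snd j - snd k)%Z).
  set (U2 := u (fst j - -1 * fst k, snd j - -1 * snd k)%Z).
  destruct U1 as [x y], U2 as [x' y'].
  apply injective_projections; simpl; field.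
Qed.

Lemma grad_dot_perp_sin a u j :
  grad_dot_perp (trig_sin a k) mu u j =
  (- (Ci * RtoC (a / 2 * dot2 (perp2 (toR2 k)) (add2 (toR2 j) mu)) *
   (u (Zsub2 j k) + u (Zsub2 j (Zscal2 (-1) k)))))%C.
Proof.
  rewrite <- perp_grad_dot_sin. unfold grad_dot_perp, perp_grad_dot, fsub. ring.
Qed.

(** Both components at a site are expanded on the two eigenvectors there: the free
    part is diagonal by the choice of the eigenvectors, and the wave contributes
    the couplings to the two neighbouring sites. *)
Lemma Lop_of_coords eps a :
  Lop N k mu eps (of_coords a) = of_coords (diag_hop freq wave_hops eps a).
Proof.
  pose proof K_pos as Kp.
  assert (Zk : k = Zscal2 1 k) by (unfold Zscal2; rewrite !Z.mul_1_l; apply surjective_pairing).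
  unfold Lop. cbv zeta.
  assert (E : forall j,
    fst (Lop N k mu eps (of_coords a)) j = fst (of_coords (diag_hop freq wave_hops eps a)) j /\
    snd (Lop N k mu eps (of_coords a)) j = snd (of_coords (diag_hop freq wave_hops eps a)) j).
  2:{ apply injective_projections; extensionality j; apply E. }
  intros j. unfold Lop, fadd, fsub, fscal, transport, b_wave, omega_wave, psi_wave. cbv zeta.
  cbn [fst snd]. unfold fadd, fsub, fscal.
  rewrite !perp_grad_dot_sin, !grad_dot_perp_sin. unfold inv_lap, Dmux, Dmuy.
  unfold of_coords; cbn [fst snd].
  replace (site k (Zsub2 j k)) with (option_map (fun l => (l - 1)%Z) (site k j))
    by (rewrite <- site_sub, <- Zk by auto; reflexivity).
  rewrite !site_sub by auto.
  destruct (site k j) as [l|] eqn:Ej; cbn [option_map].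
  2:{ split; ring. }
  apply site_spec in Ej; auto.
  replace (l - -1)%Z with (l + 1)%Z by ring.
  assert (X0 : add2 (toR2 j) mu = xi l) by (subst j; reflexivity).
  assert (Xm : add2 (toR2 (Zsub2 j k)) mu = xi (l - 1)).
  { subst j. apply (f_equal (fun q => add2 (toR2 q) mu)).
    apply injective_projections; cbn [Zsub2 Zscal2 fst snd]; ring. }
  assert (Xp : add2 (toR2 (Zsub2 j (Zscal2 (-1) k))) mu = xi (l + 1)).
  { subst j. apply (f_equal (fun q => add2 (toR2 q) mu)).
    apply injective_projections; cbn [Zsub2 Zscal2 fst snd]; ring. }
  rewrite X0, Xm, Xp.
  assert (Kap : dot2 (perp2 (toR2 k)) (xi l) = kappa).
  { unfold kappa, xi, dot2, perp2, add2, toR2, Zscal2; cbn [fst snd]. rewrite !mult_IZR. ring. }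
  rewrite Kap.
  fold (modulus l) (modulus (l - 1)) (modulus (l + 1)).
  unfold diag_hop, hop_opC, wave_hops, neighbours, coupling.
  cbn [map fold_right fst snd negb sg].
  unfold freq, w, Omega. cbn [fst snd sg].
  fold (xi l). fold (modulus l). fold K.
  pose proof (modulus_pos l) as P0. pose proof (modulus_pos (l - 1)) as Pm.
  pose proof (modulus_pos (l + 1)) as Pp.
  unfold dot2. generalize (cvec N k). intros cv.
  destruct (a (l, true)) as [x1 y1], (a (l, false)) as [x2 y2],
    (a ((l - 1)%Z, true)) as [x3 y3], (a ((l - 1)%Z, false)) as [x4 y4],
    (a ((l + 1)%Z, true)) as [x5 y5], (a ((l + 1)%Z, false)) as [x6 y6].
  generalize dependent (modulus l). generalize dependent (modulus (l - 1)).
  generalize dependent (modulus (l + 1)). generalize dependent K.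
  intros K' Kp' p1 Hp1 p2 Hp2 p3 Hp3.
  split; apply injective_projections; simpl; field; repeat split; lra.
Qed.
End Line.

(** ** Bounds uniform in the site *)

Section Bounds.
Variables (N : R) (k : Z * Z) (mu : R * R).
Hypotheses (N0 : 0 < N) (k0 : (0 < fst k)%Z)
  (mu_nonint : ~ exists j : Z * Z, mu = toR2 j).

Let K := norm2 (toR2 k).

Lemma norm2_ge_fst x : Rabs (fst x) <= norm2 x.
Proof.
  rewrite <- sqrt_Rsqr_abs. apply sqrt_le_1_alt. unfold dot2, Rsqr.
  pose proof (Rle_0_sqr (snd x)) as H. unfold Rsqr in H. lra.
Qed.

Lemma norm2_opp x : norm2 (sub2 (0, 0) x) = norm2 x.
Proof. unfold norm2, sub2, dot2; simpl. f_equal. ring. Qed.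

(** Far sites are far from the origin, and none of the others sits at it. *)
Lemma modulus_lower : exists c, 0 < c /\ forall l, c <= modulus k mu l.
Proof.
  assert (F : forall L : nat, exists c, 0 < c /\
     forall l, (Z.abs l <= Z.of_nat L)%Z -> c <= modulus k mu l).
  { induction L as [|L (c & c0 & Hc)].
    - exists (modulus k mu 0). split; [apply modulus_pos; auto|].
      intros l Hl. replace l with 0%Z by lia. lra.
    - set (L' := Z.of_nat (S L)).
      exists (Rmin c (Rmin (modulus k mu L') (modulus k mu (- L')))). split.
      + repeat apply Rmin_pos; auto; apply modulus_pos; auto.
      + intros l Hl.
        destruct (Z_le_gt_dec (Z.abs l) (Z.of_nat L)) as [H|H].
        * eapply Rle_trans; [apply Rmin_l|auto].
        * eapply Rle_trans; [apply Rmin_r|].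
          destruct (Z_le_gt_dec 0 l).
          -- replace l with L' by (unfold L'; lia). apply Rmin_l.
          -- replace l with (- L')%Z by (unfold L'; lia). apply Rmin_r. }
  destruct (F (Z.to_nat (up (Rabs (fst mu) + 1)))) as (c & c0 & Hc).
  exists (Rmin c 1). split; [apply Rmin_pos; lra|].
  intros l. destruct (Z_le_gt_dec (Z.abs l) (Z.of_nat (Z.to_nat (up (Rabs (fst mu) + 1))))) as [H|H].
  - eapply Rle_trans; [apply Rmin_l|auto].
  - eapply Rle_trans; [apply Rmin_r|].
    eapply Rle_trans; [|apply norm2_ge_fst].
    unfold xi, add2, toR2, Zscal2; simpl. rewrite mult_IZR.
    assert (A : (up (Rabs (fst mu) + 1) <= Z.abs l)%Z) by lia.
    apply IZR_le in A. rewrite abs_IZR in A.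
    destruct (archimed (Rabs (fst mu) + 1)) as [Ar _].
    assert (k1 : 1 <= IZR (fst k)) by (apply IZR_le; lia).
    assert (P : Rabs (IZR l) <= Rabs (IZR l * IZR (fst k))).
    { rewrite Rabs_mult, (Rabs_pos_eq (IZR (fst k))) by lra.
      pose proof (Rabs_pos (IZR l)). nra. }
    pose proof (Rabs_triang (IZR l * IZR (fst k) + fst mu) (- fst mu)) as T.
    rewrite Rabs_Ropp in T.
    replace (IZR l * IZR (fst k) + fst mu + - fst mu) with (IZR l * IZR (fst k)) in T by ring.
    lra.
Qed.

Lemma modulus_step l l' :
  l = (l' + 1)%Z \/ l' = (l + 1)%Z -> modulus k mu l <= modulus k mu l' + K.
Proof.
  intros [-> | ->].
  - replace (modulus k mu (l' + 1)) with (norm2 (add2 (xi k mu l') (toR2 k))).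
    + apply norm2_triangle.
    + unfold modulus, xi, add2, toR2, Zscal2; simpl. f_equal. rewrite !mult_IZR, plus_IZR.
      f_equal; ring.
  - replace (modulus k mu l) with (norm2 (add2 (xi k mu (l + 1)) (sub2 (0, 0) (toR2 k)))).
    + eapply Rle_trans; [apply norm2_triangle|]. rewrite norm2_opp. apply Rle_refl.
    + unfold modulus, xi, add2, sub2, toR2, Zscal2; simpl. f_equal. rewrite !mult_IZR, plus_IZR.
      f_equal; ring.
Qed.

(** Up to a constant the entries only depend on the ratios [p / p'] and [K / p'],
    where [p'] is bounded below and [p <= p' + K]. *)
Lemma coupling_bounded : exists b, 0 <= b /\
  forall i i', (fst i = fst i' + 1 \/ fst i' = fst i + 1)%Z -> Rabs (coupling N k mu i i') <= b.
Proof.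
  destruct modulus_lower as (c & c0 & Hc).
  assert (Kp : 0 < K) by (apply K_pos; auto).
  set (b := Rabs (kappa k mu) / (4 * N * K) * ((K / c) ^ 2 + 1 + (1 + K / c) * (1 + K / c))).
  assert (Kc : 0 < K / c) by (apply Rdiv_lt_0_compat; auto).
  assert (A0 : 0 <= Rabs (kappa k mu) / (4 * N * K)).
  { apply Rmult_le_pos; [apply Rabs_pos|]. left. apply Rinv_0_lt_compat. nra. }
  exists b. split.
  { unfold b. apply Rmult_le_pos; auto. nra. }
  intros [l s] [l' s'] H. simpl in H. unfold coupling; cbn [fst snd].
  set (p := modulus k mu l). set (p' := modulus k mu l').
  assert (p0 : c <= p) by apply Hc. assert (p0' : c <= p') by apply Hc.
  assert (St : p <= p' + K) by (apply modulus_step; auto).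
  fold K.
  replace (kappa k mu / (4 * N * K * p' ^ 2) * (K ^ 2 - p' ^ 2 - sg s * p * (sg s' * p' + K)))
    with (kappa k mu / (4 * N * K) * ((K / p') ^ 2 - 1 - sg s * (p / p') * (sg s' + K / p')))
    by (field; lra).
  unfold b. rewrite Rabs_mult. unfold Rdiv at 1. rewrite Rabs_mult, (Rabs_pos_eq (/ (4 * N * K))).
  2:{ left. apply Rinv_0_lt_compat. nra. }
  apply Rmult_le_compat_l; auto.
  set (x := K / p'). set (y := p / p').
  assert (x0 : 0 < x) by (apply Rdiv_lt_0_compat; lra).
  assert (xl : x <= K / c).
  { apply Rmult_le_compat_l; [lra|]. apply Rinv_le_contravar; lra. }
  assert (y0 : 0 < y) by (apply Rdiv_lt_0_compat; lra).
  assert (yl : y <= 1 + x).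
  { unfold x, y. apply (Rmult_le_reg_r p'); [lra|].
    replace (p / p' * p') with p by (field; lra).
    replace ((1 + K / p') * p') with (p' + K) by (field; lra). auto. }
  assert (x2 : x ^ 2 <= (K / c) ^ 2) by (apply pow_incr; lra).
  assert (Y : y * (1 + x) <= (1 + K / c) * (1 + K / c)) by (apply Rmult_le_compat; lra).
  assert (x20 : 0 <= x ^ 2) by apply pow2_ge_0.
  assert (Q : - (y * (1 + x)) <= sg s * y * (sg s' + x) <= y * (1 + x)).
  { destruct s, s'; unfold sg; split; nra. }
  apply Rabs_le. lra.
Qed.

Lemma wave_hops_bounded : exists b, hops_bounded (wave_hops N k mu) b.
Proof.
  destruct coupling_bounded as (b & b0 & Hb). exists b. split; auto.
  intros p Hp. unfold wave_hops, neighbours in Hp. simpl in Hp.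
  destruct Hp as [<-|[<-|[<-|[<-|[]]]]]; cbn [fst snd]; (split;
   [intros i; apply Hb; cbn [fst snd]; lia
   |intros [l s] [l' s'] E; cbn [fst snd] in E; injection E as E1 E2]);
  f_equal; try lia; auto; destruct s, s'; auto; discriminate.
Qed.

(** The weight of [H^1] is comparable with [|xi_l|], which makes the norm of
    [H^1 x L^2] equivalent to the [l^2] norm of the coordinates. *)
Lemma weight_bounds : exists c, 0 < c /\ forall l,
  sqrt (1 + norm2 (toR2 (Zscal2 l k)) ^ 2) <= c * modulus k mu l /\
  modulus k mu l <= c * sqrt (1 + norm2 (toR2 (Zscal2 l k)) ^ 2).
Proof.
  destruct modulus_lower as (c & c0 & Hc).
  set (M := norm2 mu).
  assert (M0 : 0 <= M) by apply sqrt_pos.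
  assert (C1 : 0 < (1 + M) / c) by (apply Rdiv_lt_0_compat; lra).
  exists (1 + M + (1 + M) / c). split; [lra|].
  intros l. set (p := modulus k mu l). set (q := norm2 (toR2 (Zscal2 l k))).
  assert (p0 : c <= p) by apply Hc.
  assert (q0 : 0 <= q) by apply sqrt_pos.
  assert (T1 : p <= q + M) by apply norm2_triangle.
  assert (T2 : q <= p + M).
  { unfold q. replace (toR2 (Zscal2 l k)) with (add2 (xi k mu l) (sub2 (0, 0) mu)).
    - eapply Rle_trans; [apply norm2_triangle|]. rewrite norm2_opp. apply Rle_refl.
    - unfold xi, add2, sub2. apply injective_projections; cbn [fst snd]; ring. }
  assert (S1 : sqrt (1 + q ^ 2) <= 1 + q).
  { rewrite <- (sqrt_pow2 (1 + q)) by lra. apply sqrt_le_1_alt. nra. }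
  assert (S2 : q <= sqrt (1 + q ^ 2)).
  { rewrite <- (sqrt_pow2 q) at 1 by lra. apply sqrt_le_1_alt. lra. }
  assert (S3 : 1 <= sqrt (1 + q ^ 2)).
  { rewrite <- sqrt_1 at 1. apply sqrt_le_1_alt. nra. }
  assert (D : 1 + M <= (1 + M) / c * p).
  { apply (Rmult_le_reg_r c); auto. replace ((1 + M) / c * p * c) with ((1 + M) * p) by (field; lra).
    apply Rmult_le_compat_l; lra. }
  split; nra.
Qed.

Lemma sumZ2_le (f : Z * Z -> R) s :
  (forall l, NoDup l -> fold_right (fun j t => f j + t) 0 l <= s) ->
  is_finite (sumZ2 f) /\ real (sumZ2 f) <= s.
Proof.
  intros H. unfold sumZ2.
  destruct (Lub_Rbar_correct (fun s => exists l : list (Z * Z),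
    NoDup l /\ s = fold_right (fun j t => f j + t) 0 l)) as [U L].
  assert (U0 : Rbar_le 0 (Lub_Rbar (fun s => exists l : list (Z * Z),
    NoDup l /\ s = fold_right (fun j t => f j + t) 0 l))).
  { apply U. exists nil. split; [constructor|reflexivity]. }
  assert (L1 := L s). destruct (Lub_Rbar _) as [x| |]; simpl in *.
  - split; [reflexivity|]. apply L1. intros x' (l & Hl & E). rewrite E. apply (H l Hl).
  - exfalso. apply L1. intros x' (l & Hl & E). rewrite E. apply (H l Hl).
  - contradiction.
Qed.

Lemma sumZ2_ge (f : Z * Z -> R) l :
  is_finite (sumZ2 f) -> NoDup l -> fold_right (fun j t => f j + t) 0 l <= real (sumZ2 f).
Proof.
  unfold sumZ2. intros F Hl.
  destruct (Lub_Rbar_correct (fun s => exists l : list (Z * Z),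
    NoDup l /\ s = fold_right (fun j t => f j + t) 0 l)) as [U L].
  assert (H : Rbar_le (fold_right (fun j t => f j + t) 0 l) (Lub_Rbar (fun s => exists l : list (Z * Z),
    NoDup l /\ s = fold_right (fun j t => f j + t) 0 l))) by (apply U; exists l; auto).
  rewrite <- F in H. exact H.
Qed.

Definition weighted (U : state) (j : Z * Z) : R :=
  sqrt (1 + norm2 (toR2 j) ^ 2) * Cmod (fst U j).

Lemma sqnorm_sumsq U l :
  fold_right (fun j t => ((1 + norm2 (toR2 j) ^ 2) * Cmod (fst U j) ^ 2 + Cmod (snd U j) ^ 2) + t) 0 l
  = sumsq (weighted U) l + sumsq (fun j => Cmod (snd U j)) l.
Proof.
  induction l as [|j l IH]; [simpl; ring|].
  change (fold_right ?f 0 (j :: l)) with (f j (fold_right f 0 l)). cbv beta.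
  rewrite IH.
  change (sumsq (weighted U) (j :: l)) with (weighted U j ^ 2 + sumsq (weighted U) l).
  change (sumsq (fun j => Cmod (snd U j)) (j :: l))
    with (Cmod (snd U j) ^ 2 + sumsq (fun j => Cmod (snd U j)) l).
  assert (W : weighted U j ^ 2 = (1 + norm2 (toR2 j) ^ 2) * Cmod (fst U j) ^ 2).
  { unfold weighted. rewrite Rpow_mult_distr, pow2_sqrt; auto.
    pose proof (pow2_ge_0 (norm2 (toR2 j))). lra. }
  rewrite W. ring.
Qed.

Lemma state_of_ell2 U c d :
  ell2 (weighted U) c -> ell2 (fun j => Cmod (snd U j)) d ->
  is_finite (sqnormX U) /\ normX U <= c + d.
Proof.
  intros [c0 Hc] [d0 Hd].
  destruct (sumZ2_le (fun j => (1 + norm2 (toR2 j) ^ 2) * Cmod (fst U j) ^ 2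
                  + Cmod (snd U j) ^ 2) ((c + d) ^ 2)) as [F B].
  { intros l Hl. rewrite sqnorm_sumsq. specialize (Hc l Hl). specialize (Hd l Hl).
    pose proof (Rmult_le_pos c d c0 d0) as cd.
    replace ((c + d) ^ 2) with (c ^ 2 + d ^ 2 + 2 * (c * d)) by ring.
    apply Rle_trans with (c ^ 2 + d ^ 2); [apply Rplus_le_compat; assumption|lra]. }
  split; auto. unfold normX. rewrite <- (sqrt_pow2 (c + d)) by lra.
  apply sqrt_le_1_alt. exact B.
Qed.

Lemma ell2_of_state U : is_finite (sqnormX U) ->
  ell2 (weighted U) (normX U) /\ ell2 (fun j => Cmod (snd U j)) (normX U).
Proof.
  intros F.
  assert (S : forall l, NoDup l ->
    sumsq (weighted U) l + sumsq (fun j => Cmod (snd U j)) l <= normX U ^ 2).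
  { intros l Hl. pose proof (sumZ2_ge _ l F Hl) as H. cbv beta in H. rewrite sqnorm_sumsq in H.
    unfold normX. rewrite pow2_sqrt; [exact H|].
    eapply Rle_trans; [|exact H].
    apply Rplus_le_le_0_compat; apply sumsq_ge0. }
  split; (split; [apply sqrt_pos|]); intros l Hl; (eapply Rle_trans; [|exact (S l Hl)]).
  - rewrite <- (Rplus_0_r (sumsq (weighted U) l)) at 1.
    apply Rplus_le_compat_l, sumsq_ge0.
  - rewrite <- (Rplus_0_l (sumsq (fun j => Cmod (snd U j)) l)) at 1.
    apply Rplus_le_compat_r, sumsq_ge0.
Qed.

Lemma of_coords_bounded : exists c, 0 <= c /\ forall a d, ell2c a d ->
  inX0 k (of_coords N k mu a) /\ normX (of_coords N k mu a) <= c * d.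
Proof.
  destruct weight_bounds as (q & q0 & Hq).
  exists (2 * (q * N) + 2). split; [nra|]. intros a d Ha.
  set (A := fun (s : bool) (j : Z * Z) => match option_map (fun l => (l, s)) (site k j) with
     | Some i => Cmod (a i) | None => 0 end).
  assert (HA : forall s, ell2 (A s) d).
  { intros s. apply (ell2_reindex (fun j => option_map (fun l => (l, s)) (site k j)) (fun i => Cmod (a i))); auto.
    intros j j' [l s'] E E'.
    destruct (site k j) as [l1|] eqn:S1; [|discriminate].
    destruct (site k j') as [l2|] eqn:S2; [|discriminate].
    apply site_spec in S1, S2; auto. simpl in *. congruence. }
  assert (d0 : 0 <= d) by apply Ha.
  assert (A0 : forall s j, 0 <= A s j).
  { intros s j. unfold A. destruct (option_map _ _); [apply Cmod_ge_0|lra]. }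
  assert (H1 : ell2 (weighted (of_coords N k mu a)) (q * N * (d + d))).
  { apply (ell2_le _ (fun j => q * N * (A true j + A false j)) (q * N * (d + d))); [|lra|].
    - intros j. rewrite (Rabs_pos_eq (_ * _)).
      2:{ apply Rmult_le_pos; [apply Rmult_le_pos; lra|].
        apply Rplus_le_le_0_compat; apply A0. }
      unfold weighted, of_coords, A; cbn [fst snd].
      destruct (site k j) as [l|] eqn:E; cbn [option_map].
      + apply site_spec in E; auto. subst j. destruct (Hq l) as [Hl _].
        pose proof (modulus_pos k mu mu_nonint l) as P.
        rewrite Cmod_mult, Cmod_R.
        replace (Rabs (- N / modulus k mu l)) with (N / modulus k mu l).
        2:{ unfold Rdiv. rewrite Rabs_mult, Rabs_Ropp, Rabs_inv, !Rabs_pos_eq; lra. }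
        pose proof (Cmod_triangle (a (l, true)) (- a (l, false))) as T. rewrite Cmod_opp in T.
        pose proof (Cmod_ge_0 (a (l, true) - a (l, false))) as D0.
        rewrite Rabs_pos_eq.
        2:{ apply Rmult_le_pos; [apply sqrt_pos|]. apply Rmult_le_pos; auto.
            left; apply Rdiv_lt_0_compat; auto. }
        rewrite <- Rmult_assoc. apply Rmult_le_compat; auto.
        * apply Rmult_le_pos; [apply sqrt_pos|]. left; apply Rdiv_lt_0_compat; auto.
        * apply (Rmult_le_reg_r (modulus k mu l)); auto.
          replace (sqrt (1 + norm2 (toR2 (Zscal2 l k)) ^ 2) * (N / modulus k mu l) * modulus k mu l)
            with (N * sqrt (1 + norm2 (toR2 (Zscal2 l k)) ^ 2)) by (field; lra).
          replace (q * N * modulus k mu l) with (N * (q * modulus k mu l)) by ring.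
          apply Rmult_le_compat_l; lra.
      + rewrite Cmod_0, Rmult_0_r, Rabs_R0, Rplus_0_l, Rmult_0_r. lra.
    - apply (ell2_mult (fun _ => q * N)); [nra| |apply ell2_plus; auto].
      intros _. rewrite Rabs_pos_eq; nra. }
  assert (H2 : ell2 (fun j => Cmod (snd (of_coords N k mu a) j)) (d + d)).
  { apply (ell2_le _ (fun j => A true j + A false j) (d + d)); [|lra|apply ell2_plus; auto].
    intros j. rewrite (Rabs_pos_eq (_ + _)).
    2:{ apply Rplus_le_le_0_compat; apply A0. }
    rewrite Rabs_pos_eq by apply Cmod_ge_0.
    unfold of_coords, A; cbn [fst snd]. destruct (site k j) as [l|]; cbn [option_map].
    - apply Cmod_triangle.
    - rewrite Cmod_0; lra. }
  destruct (state_of_ell2 _ _ _ H1 H2) as [F B]. split.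
  - split; auto. intros j Hj. unfold of_coords; cbn [fst snd].
    destruct (site k j) as [l|] eqn:E; auto.
    apply site_spec in E; auto. exfalso. apply Hj. exists l; auto.
  - eapply Rle_trans; [apply B|]. lra.
Qed.

Lemma to_coords_bounded : exists c, 0 <= c /\ forall U, inX0 k U ->
  ell2c (to_coords N k mu U) (c * normX U).
Proof.
  destruct weight_bounds as (q & q0 & Hq).
  exists (2 + 2 * (q / N)).
  assert (qN : 0 < q / N) by (apply Rdiv_lt_0_compat; auto).
  split; [lra|]. intros U [F S].
  destruct (ell2_of_state U F) as [H1 H2].
  set (at_sign := fun (s : bool) (i : Z * bool) =>
    if Bool.eqb (snd i) s then Some (Zscal2 (fst i) k) else None).
  assert (inj : forall s i i' j, at_sign s i = Some j -> at_sign s i' = Some j -> i = i').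
  { intros s [l1 s1] [l2 s2] j. unfold at_sign; cbn [fst snd].
    destruct (Bool.eqb_spec s1 s); [|discriminate].
    destruct (Bool.eqb_spec s2 s); [|discriminate]. intros E E'.
    assert (Q : site k j = Some l1) by (apply site_spec; auto; congruence).
    rewrite (proj2 (site_spec k j l2 k0)) in Q by congruence. congruence. }
  pose proof (fun s => ell2_reindex (at_sign s) _ _ (inj s) H1) as W.
  pose proof (fun s => ell2_reindex (at_sign s) _ _ (inj s) H2) as V.
  assert (qN' : forall i : Z * bool, Rabs (q / N) <= q / N)
    by (intros; rewrite Rabs_pos_eq; lra).
  pose proof (ell2_mult (fun _ => q / N) _ (q / N) _ (Rlt_le _ _ qN) qN'
    (ell2_plus _ _ _ _ (W true) (W false))) as W2.
  pose proof (ell2_plus _ _ _ _ (ell2_plus _ _ _ _ (V true) (V false)) W2) as T.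
  eapply ell2_le; [| |exact T]; [|apply Req_le; ring].
  intros [l s]. rewrite Rabs_pos_eq by apply Cmod_ge_0.
  unfold to_coords, at_sign; cbn [fst snd].
  pose proof (modulus_pos k mu mu_nonint l) as P. destruct (Hq l) as [_ Hl].
  unfold Cdiv. rewrite Cmod_mult.
  assert (T2 : RtoC 2 <> 0) by (apply RtoC_neq0; lra).
  rewrite Cmod_inv, Cmod_R, (Rabs_pos_eq 2) by (auto; lra).
  pose proof (Cmod_triangle (snd U (Zscal2 l k)) (- (RtoC (sg s * (modulus k mu l / N)) * fst U (Zscal2 l k)))) as Tr.
  rewrite Cmod_opp, Cmod_mult, Cmod_R in Tr.
  assert (Sg : Rabs (sg s * (modulus k mu l / N)) = modulus k mu l / N).
  { assert (0 < modulus k mu l / N) by (apply Rdiv_lt_0_compat; auto).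
    rewrite Rabs_mult, (Rabs_pos_eq (_ / _)) by lra.
    destruct s; unfold sg; [rewrite Rabs_R1|rewrite Rabs_left by lra]; ring. }
  rewrite Sg in Tr.
  assert (Wt : modulus k mu l / N * Cmod (fst U (Zscal2 l k)) <= q / N * weighted U (Zscal2 l k)).
  { unfold weighted. rewrite <- Rmult_assoc. apply Rmult_le_compat_r; [apply Cmod_ge_0|].
    unfold Rdiv. rewrite (Rmult_comm q), Rmult_assoc, Rmult_comm.
    apply Rmult_le_compat_l; auto. left; apply Rinv_0_lt_compat; auto. }
  pose proof (Cmod_ge_0 (snd U (Zscal2 l k) - RtoC (sg s * (modulus k mu l / N)) * fst U (Zscal2 l k))) as G0.
  unfold Cminus in G0 |- *.
  eapply Rle_trans; [|apply Rle_abs].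
  destruct s; simpl Bool.eqb; cbv iota; lra.
Qed.

End Bounds.

(** * The resonant curve near its two ends *)

(** [f t = L + O(t)] as [t -> 0] in [dom]. *)
Definition asym (dom : R -> Prop) (f : R -> R) (L : R) : Prop :=
  exists c d, 0 <= c /\ 0 < d /\
    forall t, dom t -> Rabs t < d -> Rabs (f t - L) <= c * Rabs t.

Section Asym.
Variable dom : R -> Prop.

Lemma asym_bound f L c d :
  0 < d -> (forall t, dom t -> Rabs t < d -> Rabs (f t - L) <= c * Rabs t) ->
  asym dom f L.
Proof.
  intros d0 H. exists (Rabs c), d. split; [apply Rabs_pos|split; auto].
  intros t Ht Htd. eapply Rle_trans; [apply H; auto|].
  apply Rmult_le_compat_r; [apply Rabs_pos|apply Rle_abs].
Qed.

Lemma asym_const L : asym dom (fun _ => L) L.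
Proof.
  apply (asym_bound _ _ 0 1); [lra|]. intros t _ _.
  replace (L - L) with 0 by ring. rewrite Rabs_R0. lra.
Qed.

Lemma asym_id : asym dom (fun t => t) 0.
Proof.
  apply (asym_bound _ _ 1 1); [lra|]. intros t _ _. rewrite Rminus_0_r. lra.
Qed.

Lemma asym_abs : asym dom Rabs 0.
Proof.
  apply (asym_bound _ _ 1 1); [lra|]. intros t _ _. rewrite Rminus_0_r, Rabs_Rabsolu. lra.
Qed.

Lemma asym_ext f g L e :
  0 < e -> (forall t, dom t -> Rabs t < e -> f t = g t) -> asym dom f L -> asym dom g L.
Proof.
  intros e0 E (c & d & c0 & d0 & H).
  apply (asym_bound _ _ c (Rmin e d)); [apply Rmin_pos; auto|].
  intros t Ht Htd. pose proof (Rmin_l e d). pose proof (Rmin_r e d).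
  rewrite <- E by (auto; lra). apply H; auto; lra.
Qed.

Lemma asym_plus f g L M :
  asym dom f L -> asym dom g M -> asym dom (fun t => f t + g t) (L + M).
Proof.
  intros (c & d & c0 & d0 & H) (c' & d' & c0' & d0' & H').
  apply (asym_bound _ _ (c + c') (Rmin d d')); [apply Rmin_pos; auto|].
  intros t Ht Htd. pose proof (Rmin_l d d'). pose proof (Rmin_r d d').
  replace (f t + g t - (L + M)) with ((f t - L) + (g t - M)) by ring.
  eapply Rle_trans; [apply Rabs_triang|].
  specialize (H t Ht ltac:(lra)). specialize (H' t Ht ltac:(lra)). lra.
Qed.

Lemma asym_mult f g L M :
  asym dom f L -> asym dom g M -> asym dom (fun t => f t * g t) (L * M).
Proof.
  intros (c & d & c0 & d0 & H) (c' & d' & c0' & d0' & H').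
  apply (asym_bound _ _ ((Rabs L + c * d) * c' + Rabs M * c) (Rmin d d')); [apply Rmin_pos; auto|].
  intros t Ht Htd. pose proof (Rmin_l d d'). pose proof (Rmin_r d d').
  replace (f t * g t - L * M) with (f t * (g t - M) + M * (f t - L)) by ring.
  eapply Rle_trans; [apply Rabs_triang|]. rewrite !Rabs_mult.
  specialize (H t Ht ltac:(lra)). specialize (H' t Ht ltac:(lra)).
  pose proof (Rabs_pos t) as T.
  assert (F : Rabs (f t) <= Rabs L + c * d).
  { replace (f t) with (L + (f t - L)) by ring.
    eapply Rle_trans; [apply Rabs_triang|].
    assert (c * Rabs t <= c * d) by (apply Rmult_le_compat_l; lra). lra. }
  assert (X : Rabs (f t) * Rabs (g t - M) <= (Rabs L + c * d) * (c' * Rabs t))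
    by (apply Rmult_le_compat; auto using Rabs_pos).
  assert (Y : Rabs M * Rabs (f t - L) <= Rabs M * (c * Rabs t))
    by (apply Rmult_le_compat_l; auto using Rabs_pos).
  lra.
Qed.

Lemma asym_minus f g L M :
  asym dom f L -> asym dom g M -> asym dom (fun t => f t - g t) (L - M).
Proof.
  intros H H'. replace (L - M) with (L + (-1) * M) by ring.
  apply (asym_ext (fun t => f t + (-1) * g t) _ _ 1); [lra|intros; ring|].
  apply asym_plus; auto. apply asym_mult; auto. apply asym_const.
Qed.

Lemma asym_pow f L n : asym dom f L -> asym dom (fun t => f t ^ n) (L ^ n).
Proof.
  intros H. induction n as [|n IH]; simpl; [apply asym_const|apply asym_mult; auto].
Qed.

Lemma asym_pos f L : 0 < L -> asym dom f L ->
  exists e, 0 < e /\ forall t, dom t -> Rabs t < e -> L / 2 <= f t.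
Proof.
  intros L0 (c & d & c0 & d0 & H).
  exists (Rmin d (L / (2 * (c + 1)))). split.
  { apply Rmin_pos; auto. apply Rdiv_lt_0_compat; lra. }
  intros t Ht Htd. pose proof (Rmin_l d (L / (2 * (c + 1)))).
  pose proof (Rmin_r d (L / (2 * (c + 1)))).
  specialize (H t Ht ltac:(lra)).
  assert (c * Rabs t <= L / 2).
  { apply Rle_trans with ((c + 1) * (L / (2 * (c + 1)))).
    - apply Rmult_le_compat; auto using Rabs_pos; lra.
    - right. field. lra. }
  rewrite Rabs_minus_sym in H. pose proof (Rle_abs (L - f t)). lra.
Qed.

Lemma asym_inv f L : 0 < L -> asym dom f L -> asym dom (fun t => / f t) (/ L).
Proof.
  intros L0 Hf. destruct (asym_pos f L L0 Hf) as (e & e0 & He).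
  destruct Hf as (c & d & c0 & d0 & H).
  apply (asym_bound _ _ (c * (2 / (L * L))) (Rmin e d)); [apply Rmin_pos; auto|].
  intros t Ht Htd. pose proof (Rmin_l e d). pose proof (Rmin_r e d).
  specialize (He t Ht ltac:(lra)). specialize (H t Ht ltac:(lra)).
  replace (/ f t - / L) with (- ((f t - L) * / (f t * L))) by (field; lra).
  rewrite Rabs_Ropp, Rabs_mult.
  replace (c * (2 / (L * L)) * Rabs t) with (c * Rabs t * (2 / (L * L))) by ring.
  apply Rmult_le_compat; auto using Rabs_pos.
  rewrite Rabs_pos_eq by (left; apply Rinv_0_lt_compat; nra).
  replace (2 / (L * L)) with (/ (L / 2 * L)) by (field; lra).
  apply Rinv_le_contravar; nra.
Qed.

Lemma asym_div f g L M :
  0 < M -> asym dom f L -> asym dom g M -> asym dom (fun t => f t / g t) (L / M).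
Proof. intros M0 Hf Hg. apply asym_mult; auto. apply asym_inv; auto. Qed.

Lemma asym_sqrt f L : 0 < L -> asym dom f L -> asym dom (fun t => sqrt (f t)) (sqrt L).
Proof.
  intros L0 Hf. destruct (asym_pos f L L0 Hf) as (e & e0 & He).
  destruct Hf as (c & d & c0 & d0 & H).
  pose proof (sqrt_lt_R0 L L0) as S0.
  apply (asym_bound _ _ (c * / sqrt L) (Rmin e d)); [apply Rmin_pos; auto|].
  intros t Ht Htd. pose proof (Rmin_l e d). pose proof (Rmin_r e d).
  specialize (He t Ht ltac:(lra)). specialize (H t Ht ltac:(lra)).
  pose proof (sqrt_pos (f t)) as S1.
  replace (sqrt (f t) - sqrt L) with ((f t - L) * / (sqrt (f t) + sqrt L)).
  2:{ rewrite <- (sqrt_sqrt (f t)) at 1 by lra. rewrite <- (sqrt_sqrt L) at 1 by lra. field. lra. }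
  rewrite Rabs_mult.
  replace (c * / sqrt L * Rabs t) with (c * Rabs t * / sqrt L) by ring.
  apply Rmult_le_compat; auto using Rabs_pos.
  rewrite Rabs_pos_eq by (left; apply Rinv_0_lt_compat; lra).
  apply Rinv_le_contravar; lra.
Qed.

End Asym.

Section Curve.
Variables (N : R) (m n : Z).
Hypotheses (N0 : 0 < N) (m0 : (0 < m)%Z) (n0 : (0 < n)%Z).

Let rm := IZR m.
Let rn := IZR n.
Let K := sqrt (rm * rm + rn * rn).

Lemma rm_pos : 0 < rm. Proof. apply IZR_lt; auto. Qed.
Lemma rn_pos : 0 < rn. Proof. apply IZR_lt; auto. Qed.

Lemma K_sq : K * K = rm * rm + rn * rn.
Proof. apply sqrt_sqrt. nra. Qed.

Lemma K_gt : 0 < K /\ rm < K.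
Proof.
  pose proof rm_pos. pose proof rn_pos. assert (0 < K) by (apply sqrt_lt_R0; nra).
  pose proof K_sq. split; auto. nra.
Qed.

Definition rad (x y : R) : R := sqrt (x * x + y * y).

Lemma sum_squares_pos a c : c <> 0 -> 0 < a * a + c * c.
Proof. intros H. nra. Qed.

Lemma sum_squares_ge0 a c : 0 <= a * a + c * c.
Proof. nra. Qed.

Lemma rad_pos x y : y <> 0 -> 0 < rad x y.
Proof. intros H. apply sqrt_lt_R0, sum_squares_pos, H. Qed.

Lemma rad_sq x y : rad x y * rad x y = x * x + y * y.
Proof. apply sqrt_sqrt. nra. Qed.

Lemma rad_ge x y : Rabs x <= rad x y /\ Rabs y <= rad x y.
Proof.
  unfold rad. rewrite <- !sqrt_Rsqr_abs. unfold Rsqr. split; apply sqrt_le_1_alt; nra.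
Qed.

Lemma resonant_iff x y : y <> 0 ->
  resonant N (m, n) (x, y) <-> rm / K - (rm + x) / rad (rm + x) (rn + y) = x / rad x y.
Proof.
  intros y0. unfold resonant, Omega, norm2, dot2, add2, toR2; cbn [fst snd].
  fold rm rn K. fold (rad (rm + x) (rn + y)) (rad x y).
  assert (E : forall a b c d e f : R, N * a / b - N * c / d = N * e / f <-> a / b - c / d = e / f).
  { intros a b c d e f.
    replace (N * a / b - N * c / d) with (N * (a / b - c / d)) by (unfold Rdiv; ring).
    replace (N * e / f) with (N * (e / f)) by (unfold Rdiv; ring).
    split; intros H; [apply (Rmult_eq_reg_l N); lra|rewrite H; reflexivity]. }
  rewrite E. split.
  - intros [H|[_ H]]; [injection H; intros; contradiction|auto].
  - intros H. right. split; auto. intros F. injection F; intros; contradiction.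
Qed.

(** Intermediate values of the defect of the resonance condition: it is positive
    at [x = - m], where the direction of [k + mu] is vertical, and negative at
    [x = |y| m / n], where the cosine of the direction of [mu] is that of [k]. *)
Lemma resonant_exists y : y <> 0 -> y <> - rn -> exists x, resonant N (m, n) (x, y).
Proof.
  intros y0 yn. pose proof rm_pos. pose proof rn_pos. destruct K_gt as [K0 K1].
  set (f := fun x => rm / K - (rm + x) / rad (rm + x) (rn + y) - x / rad x y).
  assert (cf : continuity f).
  { intros x. apply continuity_pt_filterlim.
    apply (ex_derive_continuous (V := R_NormedModule)). unfold f, rad.
    assert (A1 : 0 < (rm + x) * (rm + x) + (rn + y) * (rn + y)) by (apply sum_squares_pos; lra).
    assert (A2 : 0 < x * x + y * y) by nra.
    pose proof (sqrt_lt_R0 _ A1). pose proof (sqrt_lt_R0 _ A2).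
    auto_derive. repeat split; auto; lra. }
  set (X := Rabs y * (rm / rn)).
  assert (X0 : 0 < X).
  { apply Rmult_lt_0_compat; [apply Rabs_pos_lt; auto|apply Rdiv_lt_0_compat; auto]. }
  assert (RX : rad X y = Rabs y * (K / rn)).
  { unfold rad. rewrite <- (sqrt_square (Rabs y * (K / rn))).
    - f_equal. unfold X.
      replace (Rabs y * (K / rn) * (Rabs y * (K / rn))) with (Rabs y * Rabs y * (K * K) / (rn * rn))
        by (field; lra).
      rewrite K_sq. rewrite <- Rabs_mult, (Rabs_pos_eq (y * y)) by nra.
      replace (Rabs y * (rm / rn) * (Rabs y * (rm / rn))) with (Rabs y * Rabs y * (rm * rm) / (rn * rn))
        by (field; lra).
      rewrite <- Rabs_mult, (Rabs_pos_eq (y * y)) by nra. field. lra.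
    - apply Rmult_le_pos; [apply Rabs_pos|]. left; apply Rdiv_lt_0_compat; auto. }
  assert (fX : f X <= 0).
  { unfold f. rewrite RX.
    replace (X / (Rabs y * (K / rn))) with (rm / K).
    - assert (0 < (rm + X) / rad (rm + X) (rn + y)); [|lra].
      apply Rdiv_lt_0_compat; [lra|apply rad_pos; lra].
    - unfold X. field. repeat split; try lra. apply Rabs_no_R0; auto. }
  assert (fm : 0 <= f (- rm)).
  { unfold f. replace (rm + - rm) with 0 by ring. unfold Rdiv at 2. rewrite Rmult_0_l.
    pose proof (Rdiv_lt_0_compat rm K ltac:(lra) ltac:(lra)).
    pose proof (Rdiv_lt_0_compat rm (rad (- rm) y) ltac:(lra) (rad_pos _ _ y0)) as Q.
    replace (- rm / rad (- rm) y) with (- (rm / rad (- rm) y)) by (unfold Rdiv; ring). lra. }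
  destruct (IVT_gen f (- rm) X 0 cf) as (x & _ & Hx).
  { split.
    - eapply Rle_trans; [apply Rmin_r|auto].
    - eapply Rle_trans; [|apply Rmax_l]. auto. }
  exists x. apply resonant_iff; auto. unfold f in Hx. lra.
Qed.

Lemma varphi_resonant y : y <> 0 -> y <> - rn -> resonant N (m, n) (varphi N (m, n) y, y).
Proof.
  intros H1 H2. unfold varphi.
  apply (epsilon_spec (inhabits 0) (fun x => resonant N (m, n) (x, y))).
  apply resonant_exists; auto.
Qed.

Lemma cos_mono u v b : b <> 0 -> 0 <= u <= v -> u / rad u b <= v / rad v b.
Proof.
  intros b0 [u0 uv]. pose proof (rad_pos u b b0) as P. pose proof (rad_pos v b b0) as Q.
  apply (Rmult_le_reg_r (rad u b * rad v b)); [nra|].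
  replace (u / rad u b * (rad u b * rad v b)) with (u * rad v b) by (field; lra).
  replace (v / rad v b * (rad u b * rad v b)) with (v * rad u b) by (field; lra).
  apply Rsqr_incr_0_var; [|nra]. unfold Rsqr.
  replace (u * rad v b * (u * rad v b)) with (u * u * (rad v b * rad v b)) by ring.
  replace (v * rad u b * (v * rad u b)) with (v * v * (rad u b * rad u b)) by ring.
  rewrite !rad_sq.
  assert (u * u <= v * v) by (apply Rmult_le_compat; lra).
  assert (0 <= b * b) by nra. nra.
Qed.

(** Near the origin the resonance condition compares directions: by monotonicity
    of the cosine along horizontal lines, [|x| / |mu|] is at most the variation
    [O(y)] of the direction of [k + (0, y)], so [x = O(y^2)]. *)
Lemma resonant_small : exists c d, 0 <= c /\ 0 < d /\
  forall x y, y <> 0 -> Rabs y < d -> resonant N (m, n) (x, y) -> Rabs x <= c * y ^ 2.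
Proof.
  pose proof rm_pos. pose proof rn_pos. destruct K_gt as [K0 K1].
  assert (Q : asym (fun _ => True) (fun y => rm / K - rm / rad rm (rn + y)) (rm / K - rm / K)).
  { apply asym_minus; [apply asym_const|]. apply asym_div; auto; [apply asym_const|].
    replace K with (sqrt (rm * rm + (rn + 0) * (rn + 0))) by (unfold K; f_equal; ring).
    apply asym_sqrt; [nra|]. apply asym_plus; [apply asym_const|].
    apply asym_mult; (apply asym_plus; [apply asym_const|apply asym_id]). }
  destruct Q as (c & d & c0 & d0 & H1).
  exists (2 * c), (Rmin (rn / 2) (Rmin d (/ (2 * (c + 1))))). split; [lra|]. split.
  { repeat apply Rmin_pos; try lra. apply Rinv_0_lt_compat; lra. }
  intros x y y0 Hy Hr. apply resonant_iff in Hr; auto.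
  pose proof (Rmin_l (rn / 2) (Rmin d (/ (2 * (c + 1))))) as M1.
  pose proof (Rmin_r (rn / 2) (Rmin d (/ (2 * (c + 1))))) as M2.
  pose proof (Rmin_l d (/ (2 * (c + 1)))) as M3.
  pose proof (Rmin_r d (/ (2 * (c + 1)))) as M4.
  assert (b0 : rn + y <> 0).
  { intros E. replace y with (- rn) in Hy by lra. rewrite Rabs_Ropp, Rabs_pos_eq in Hy; lra. }
  specialize (H1 y Logic.I ltac:(lra)).
  replace (rm / K - rm / K) with 0 in H1 by ring. rewrite Rminus_0_r in H1.
  pose proof (rad_pos x y y0) as R0. pose proof (rad_pos (rm + x) (rn + y) b0) as R1.
  assert (B : Rabs (x / rad x y) <= c * Rabs y).
  { eapply Rle_trans; [|exact H1]. destruct (Rle_dec 0 x) as [x0|x0].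
    - assert (X : 0 <= x / rad x y) by (apply Rmult_le_pos; auto; left; apply Rinv_0_lt_compat; auto).
      rewrite Rabs_pos_eq by auto.
      pose proof (cos_mono rm (rm + x) (rn + y) b0 ltac:(lra)).
      eapply Rle_trans; [|apply Rle_abs]. lra.
    - assert (X : x / rad x y <= 0).
      { replace (x / rad x y) with (- (- x / rad x y)) by (unfold Rdiv; ring).
        assert (0 <= - x / rad x y); [|lra].
        apply Rmult_le_pos; [lra|left; apply Rinv_0_lt_compat; auto]. }
      rewrite Rabs_left1 by auto.
      assert ((rm + x) / rad (rm + x) (rn + y) <= rm / rad rm (rn + y)).
      { destruct (Rle_dec 0 (rm + x)) as [p|p].
        - apply cos_mono; auto. lra.
        - apply Rle_trans with 0.
          + replace ((rm + x) / rad (rm + x) (rn + y)) with (- (- (rm + x) / rad (rm + x) (rn + y))) by (unfold Rdiv; ring).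
            assert (0 <= - (rm + x) / rad (rm + x) (rn + y)); [|lra].
            apply Rmult_le_pos; [lra|left; apply Rinv_0_lt_compat; auto].
          + apply Rmult_le_pos; [lra|]. left; apply Rinv_0_lt_compat, rad_pos; auto. }
      eapply Rle_trans; [|rewrite <- Rabs_Ropp; apply Rle_abs]. lra. }
  assert (B2 : Rabs x <= c * Rabs y * rad x y).
  { replace x with (x / rad x y * rad x y) at 1 by (field; lra).
    rewrite Rabs_mult, (Rabs_pos_eq (rad x y)) by lra.
    apply Rmult_le_compat_r; lra. }
  assert (Y : c * Rabs y <= 1 / 2).
  { apply Rle_trans with ((c + 1) * / (2 * (c + 1))).
    - apply Rmult_le_compat; auto using Rabs_pos; lra.
    - right. field. lra. }
  assert (T : rad x y <= Rabs x + Rabs y).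
  { unfold rad. rewrite <- (sqrt_square (Rabs x + Rabs y)).
    - apply sqrt_le_1_alt. pose proof (Rabs_pos x). pose proof (Rabs_pos y).
      replace (x * x) with (Rabs x * Rabs x) by (rewrite <- Rabs_mult; apply Rabs_pos_eq; nra).
      replace (y * y) with (Rabs y * Rabs y) by (rewrite <- Rabs_mult; apply Rabs_pos_eq; nra).
      nra.
    - pose proof (Rabs_pos x). pose proof (Rabs_pos y). lra. }
  assert (Z : y ^ 2 = Rabs y * Rabs y) by (rewrite <- Rabs_mult, Rabs_pos_eq; [ring|nra]).
  rewrite Z.
  assert (A1 : c * Rabs y * rad x y <= c * Rabs y * (Rabs x + Rabs y)).
  { apply Rmult_le_compat_l; auto. apply Rmult_le_pos; auto using Rabs_pos. }
  assert (A2 : c * Rabs y * Rabs x <= 1 / 2 * Rabs x) by (apply Rmult_le_compat_r; auto using Rabs_pos).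
  lra.
Qed.

Lemma e_coef_rad x y : e_coef N (m, n) (x, y) =
  (rn * x - rm * y) ^ 2 * ((rad (rm + x) (rn + y) - K) * (K + rad x y) * (rad (rm + x) (rn + y) + K - rad x y) ^ 2)
  / (16 * N ^ 2 * rad x y ^ 2 * rad (rm + x) (rn + y) ^ 2 * K ^ 2).
Proof.
  unfold e_coef, norm2, dot2, perp2, add2, toR2; cbn [fst snd].
  fold rm rn K. fold (rad (rm + x) (rn + y)) (rad x y).
  replace (rn * x + - rm * y) with (rn * x - rm * y) by ring. reflexivity.
Qed.

(** With [y = n t] and [x = t X], [X = O(t)], the factor [|k + mu| - K] of
    [e_coef] equals [(2 k . mu + |mu|^2) / (|k + mu| + K)], hence [t] times a
    function with a limit, and [(k^perp . mu)^2 / |mu|^2] is a function of [X]. *)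
Lemma e_coef_small : exists C0 delta : R, 0 < delta /\
  forall tau : R, Rabs tau < delta ->
    Rabs (e_coef N (m, n) (mu_small N (m, n) tau)
          - rm ^ 2 * rn ^ 2 / (4 * N ^ 2 * K ^ 2) * tau) <= C0 * tau ^ 2.
Proof.
  pose proof rm_pos. pose proof rn_pos. destruct K_gt as [K0 K1].
  destruct resonant_small as (c & d & c0 & d0 & Hc).
  set (dom := fun t => t <> 0).
  set (x := fun t => varphi N (m, n) (rn * t)).
  set (X := fun t => x t / t).
  set (e1 := Rmin (d / rn) (1 / 2)).
  assert (e10 : 0 < e1) by (apply Rmin_pos; [apply Rdiv_lt_0_compat; auto|lra]).
  assert (sm : forall t, Rabs t < e1 -> Rabs (rn * t) < d /\ Rabs t < 1 / 2).
  { intros t Ht. pose proof (Rmin_l (d / rn) (1 / 2)). pose proof (Rmin_r (d / rn) (1 / 2)).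
    unfold e1 in Ht. split; [|lra]. rewrite Rabs_mult, (Rabs_pos_eq rn) by lra.
    replace d with (rn * (d / rn)) by (field; lra). apply Rmult_lt_compat_l; lra. }
  assert (AX : asym dom X 0).
  { apply (asym_bound _ _ _ (c * rn ^ 2) e1); auto. intros t Ht Hs.
    destruct (sm t Hs) as [S1 S2]. rewrite Rminus_0_r.
    assert (y0 : rn * t <> 0) by (apply Rmult_integral_contrapositive; split; auto; lra).
    assert (Hx := Hc (x t) (rn * t) y0 S1 ltac:(apply varphi_resonant; auto;
      intros E; assert (t = -1) by (apply (Rmult_eq_reg_l rn); lra); subst t; rewrite Rabs_left in S2; lra)).
    unfold X, Rdiv. rewrite Rabs_mult, Rabs_inv.
    apply (Rmult_le_reg_r (Rabs t)); [apply Rabs_pos_lt; auto|].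
    rewrite Rmult_assoc, Rinv_l, Rmult_1_r by (apply Rabs_no_R0; auto).
    replace (c * rn ^ 2 * Rabs t * Rabs t) with (c * (rn * t) ^ 2); auto.
    rewrite Rmult_assoc, <- Rabs_mult, Rabs_pos_eq by nra. ring. }
  set (Mt := fun t => sqrt (X t * X t + rn * rn)).
  set (P := fun t => sqrt ((rm + t * X t) * (rm + t * X t) + (rn + rn * t) * (rn + rn * t))).
  assert (AM : asym dom Mt rn).
  { replace rn with (sqrt (0 * 0 + rn * rn)) by (rewrite Rmult_0_l, Rplus_0_l; apply sqrt_square; lra).
    apply asym_sqrt; [nra|]. apply asym_plus; [apply asym_mult; auto|apply asym_const]. }
  assert (AP : asym dom P K).
  { unfold K. replace (rm * rm + rn * rn) with ((rm + 0 * 0) * (rm + 0 * 0) + (rn + rn * 0) * (rn + rn * 0)) by ring.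
    assert (A1 : asym dom (fun t => rm + t * X t) (rm + 0 * 0)).
    { apply asym_plus; [apply asym_const|]. apply asym_mult; auto. apply asym_id. }
    assert (A2 : asym dom (fun t => rn + rn * t) (rn + rn * 0)).
    { apply asym_plus; [apply asym_const|]. apply asym_mult; [apply asym_const|apply asym_id]. }
    apply asym_sqrt; [nra|]. apply asym_plus; apply asym_mult; auto. }
  set (E := fun t => (rn * X t - rm * rn) ^ 2 / (Mt t) ^ 2
     * ((2 * (rm * X t + rn * rn) + t * (Mt t) ^ 2) / (P t + K))
     * ((K + Rabs t * Mt t) * (P t + K - Rabs t * Mt t) ^ 2) / (16 * N ^ 2 * K ^ 2 * P t ^ 2)).
  assert (AE : asym dom E ((rn * 0 - rm * rn) ^ 2 / rn ^ 2
     * ((2 * (rm * 0 + rn * rn) + 0 * rn ^ 2) / (K + K))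
     * ((K + 0 * rn) * (K + K - 0 * rn) ^ 2) / (16 * N ^ 2 * K ^ 2 * K ^ 2))).
  { assert (0 < K ^ 2) by (apply pow_lt; auto). assert (0 < N ^ 2) by (apply pow_lt; auto).
    unfold E. repeat first [apply asym_div | apply asym_mult | apply asym_minus
      | apply asym_plus | apply asym_pow | exact AX | exact AM | exact AP | apply asym_abs
      | apply asym_const | apply asym_id]; try apply pow_lt; auto; try lra.
    repeat apply Rmult_lt_0_compat; lra. }
  replace ((rn * 0 - rm * rn) ^ 2 / rn ^ 2
     * ((2 * (rm * 0 + rn * rn) + 0 * rn ^ 2) / (K + K))
     * ((K + 0 * rn) * (K + K - 0 * rn) ^ 2) / (16 * N ^ 2 * K ^ 2 * K ^ 2))
    with (rm ^ 2 * rn ^ 2 / (4 * N ^ 2 * K ^ 2)) in AE by (field; lra).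
  destruct AE as (c' & d' & c0' & d0' & HE).
  exists c', (Rmin d' e1). split; [apply Rmin_pos; auto|].
  intros t Ht. pose proof (Rmin_l d' e1). pose proof (Rmin_r d' e1).
  unfold mu_small. cbn [snd]. fold rn. destruct (Req_EM_T t 0) as [->|t0].
  - rewrite e_coef_rad. replace ((rn * 0 - rm * 0) ^ 2) with 0 by ring.
    unfold Rdiv at 1. rewrite !Rmult_0_l, Rmult_0_r, Rminus_0_r, Rabs_R0. lra.
  - specialize (HE t t0 ltac:(lra)). rewrite e_coef_rad.
    fold (x t).
    assert (EM : rad (x t) (rn * t) = Rabs t * Mt t).
    { unfold rad, Mt. rewrite <- sqrt_Rsqr_abs, <- sqrt_mult.
      - f_equal. unfold X, Rsqr. field; auto.
      - apply Rle_0_sqr.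
      - nra. }
    assert (EP : rad (rm + x t) (rn + rn * t) = P t).
    { unfold rad, P, X. do 2 f_equal. field; auto. }
    assert (P0 : 0 < P t).
    { apply sqrt_lt_R0. destruct (sm t ltac:(lra)) as [_ S2]. apply Rabs_def2 in S2.
      apply sum_squares_pos. nra. }
    assert (M0 : 0 < Mt t) by (apply sqrt_lt_R0; nra).
    assert (PK : P t - K = t * (2 * (rm * X t + rn * rn) + t * (Mt t) ^ 2) / (P t + K)).
    { assert (S : P t * P t = (rm + t * X t) * (rm + t * X t) + (rn + rn * t) * (rn + rn * t))
        by (apply sqrt_sqrt, sum_squares_ge0).
      assert (S' : Mt t * Mt t = X t * X t + rn * rn) by (apply sqrt_sqrt; nra).
      apply (Rmult_eq_reg_r (P t + K)); [|lra].
      replace ((P t - K) * (P t + K)) with (P t * P t - K * K) by ring.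
      rewrite S, K_sq. unfold Rdiv. rewrite Rmult_assoc, Rinv_l by lra.
      replace (Mt t ^ 2) with (Mt t * Mt t) by ring. rewrite S'. ring. }
    rewrite EM, EP, PK.
    replace ((rn * x t - rm * (rn * t)) ^ 2 *
       (t * (2 * (rm * X t + rn * rn) + t * Mt t ^ 2) / (P t + K) * (K + Rabs t * Mt t) *
        (P t + K - Rabs t * Mt t) ^ 2) /
       (16 * N ^ 2 * (Rabs t * Mt t) ^ 2 * P t ^ 2 * K ^ 2)) with (t * E t).
    + replace (t * E t - rm ^ 2 * rn ^ 2 / (4 * N ^ 2 * K ^ 2) * t)
        with (t * (E t - rm ^ 2 * rn ^ 2 / (4 * N ^ 2 * K ^ 2))) by ring.
      rewrite Rabs_mult. replace (c' * t ^ 2) with (Rabs t * (c' * Rabs t)).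
      * apply Rmult_le_compat_l; auto using Rabs_pos.
      * replace (Rabs t * (c' * Rabs t)) with (c' * (Rabs t * Rabs t)) by ring.
        rewrite <- Rabs_mult, Rabs_pos_eq by nra. ring.
    + assert (At : Rabs t <> 0) by (apply Rabs_no_R0; auto).
      replace (x t) with (t * X t) by (unfold X; field; auto).
      rewrite Rpow_mult_distr. replace (Rabs t ^ 2) with (t ^ 2) by (rewrite pow2_abs; auto).
      unfold E. field. repeat split; lra.
Qed.
Lemma cos_close x y : y <> 0 -> rn + y <> 0 ->
  Rabs ((rm + x) / rad (rm + x) (rn + y) - x / rad x y) <= 2 * K / rad x y.
Proof.
  intros y0 b0. pose proof rm_pos. destruct K_gt as [K0 K1].
  pose proof (rad_pos x y y0) as R0. pose proof (rad_pos (rm + x) (rn + y) b0) as R1.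
  set (M := rad x y) in *. set (P := rad (rm + x) (rn + y)) in *.
  replace ((rm + x) / P - x / M) with ((((rm + x) / P) * (M - P) + rm) / M) by (field; lra).
  unfold Rdiv at 1 3. rewrite Rabs_mult, Rabs_inv, (Rabs_pos_eq M) by lra.
  apply Rmult_le_compat_r; [left; apply Rinv_0_lt_compat; auto|].
  eapply Rle_trans; [apply Rabs_triang|]. rewrite Rabs_mult, (Rabs_pos_eq rm) by lra.
  assert (A : Rabs ((rm + x) / P) <= 1).
  { unfold Rdiv. rewrite Rabs_mult, Rabs_inv, (Rabs_pos_eq P) by lra.
    apply (Rmult_le_reg_r P); auto. rewrite Rmult_assoc, Rinv_l, Rmult_1_r, Rmult_1_l by lra.
    apply rad_ge. }
  assert (B : Rabs (M - P) <= K).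
  { assert (T : forall a b c d, rad (a + c) (b + d) <= rad a b + rad c d).
    { intros a b c d. apply (norm2_triangle (a, b) (c, d)). }
    pose proof (T rm rn x y) as T1. pose proof (T (rm + x) (rn + y) (- rm) (- rn)) as T2.
    replace (rm + x + - rm) with x in T2 by ring. replace (rn + y + - rn) with y in T2 by ring.
    replace (rad (- rm) (- rn)) with K in T2 by (unfold rad, K; f_equal; ring).
    fold M P in T1, T2. change (rad rm rn) with K in T1. apply Rabs_le. lra. }
  pose proof (Rmult_le_compat _ _ _ _ (Rabs_pos _) (Rabs_pos _) A B). lra.
Qed.

(** With [y = 1 / t] and [x = X / t], the lengths [|mu|] and [|k + mu|] are [1 / t]
    times functions with the same limit, and their difference, a quotient of
    [|k|^2 + 2 k . mu] by their sum, has a limit. *)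
Lemma e_coef_large :
  let s := sqrt (3 * rm ^ 2 + 4 * rn ^ 2) in
  exists C0 T : R, 0 < T /\
   forall tau : R, T < tau ->
     Rabs (e_coef N (m, n) (mu_large N (m, n) tau)
           - rm ^ 2 / (256 * N ^ 2 * K ^ 6) * (rn - s) ^ 2 *
             (3 * rm ^ 2 + 2 * rn ^ 2 + rn * s) ^ 2) <= C0 / tau.
Proof.
  intros s. pose proof rm_pos. pose proof rn_pos. destruct K_gt as [K0 K1].
  assert (ss : s * s = 3 * rm ^ 2 + 4 * rn ^ 2) by (apply sqrt_sqrt; nra).
  assert (s0 : 0 < s) by (apply sqrt_lt_R0; nra).
  set (dom := fun t => 0 < t).
  set (x := fun t => varphi N (m, n) (/ t)).
  set (X := fun t => t * x t).
  assert (ti : forall t, dom t -> 0 < / t) by (intros; apply Rinv_0_lt_compat; auto).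
  assert (EM : forall t, dom t -> rad (x t) (/ t) = sqrt (X t * X t + 1) / t).
  { intros t Ht. unfold dom in Ht. unfold rad.
    replace (x t * x t + / t * / t) with ((X t * X t + 1) * (/ t * / t)) by (unfold X; field; lra).
    pose proof (ti t Ht).
    rewrite sqrt_mult, sqrt_square; [reflexivity|lra|nra|nra]. }
  set (Mt := fun t => sqrt (X t * X t + 1)).
  set (Pt := fun t => sqrt ((rm * t + X t) * (rm * t + X t) + (rn * t + 1) * (rn * t + 1))).
  assert (EP : forall t, dom t -> rad (rm + x t) (rn + / t) = Pt t / t).
  { intros t Ht. unfold dom in Ht. unfold rad.
    replace ((rm + x t) * (rm + x t) + (rn + / t) * (rn + / t))
      with (((rm * t + X t) * (rm * t + X t) + (rn * t + 1) * (rn * t + 1)) * (/ t * / t))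
      by (unfold X; field; lra).
    pose proof (ti t Ht).
    rewrite sqrt_mult, sqrt_square; [reflexivity|lra|apply sum_squares_ge0|nra]. }
  assert (M0 : forall t, 0 < Mt t) by (intros; apply sqrt_lt_R0; nra).
  (* the cosine of the direction of [mu] tends to half that of [k] *)
  assert (Ac : asym dom (fun t => X t / Mt t) (rm / (2 * K))).
  { apply (asym_bound _ _ _ K 1); [lra|]. intros t Ht _. unfold dom in Ht.
    pose proof (ti t Ht) as Hi.
    assert (Hr : resonant N (m, n) (x t, / t)) by (apply varphi_resonant; lra).
    apply resonant_iff in Hr; [|lra].
    pose proof (cos_close (x t) (/ t) ltac:(lra) ltac:(lra)) as Cl.
    rewrite EM in Hr, Cl by auto. fold (Mt t) in Hr, Cl.
    replace (x t / (Mt t / t)) with (X t / Mt t) in Hr, Cl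
      by (unfold X; field; specialize (M0 t); lra).
    replace (X t / Mt t - rm / (2 * K)) with
      (- (1 / 2 * ((rm + x t) / rad (rm + x t) (rn + / t) - X t / Mt t))).
    2:{ replace (rm / (2 * K)) with (1 / 2 * (rm / K)) by (field; lra). lra. }
    rewrite Rabs_Ropp, Rabs_mult, (Rabs_pos_eq (1 / 2)) by lra.
    rewrite (Rabs_pos_eq t) by lra.
    assert (M1 : 1 <= Mt t).
    { unfold Mt. rewrite <- sqrt_1 at 1. apply sqrt_le_1_alt. nra. }
    assert (2 * K / (Mt t / t) <= 2 * K * t); [|lra].
    replace (2 * K / (Mt t / t)) with (2 * K * t * / Mt t) by (field; lra).
    rewrite <- (Rmult_1_r (2 * K * t)) at 2. apply Rmult_le_compat_l; [nra|].
    rewrite <- Rinv_1. apply Rinv_le_contravar; lra. }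
  assert (KK := K_sq).
  assert (sK : sqrt (1 - rm / (2 * K) * (rm / (2 * K))) = s / (2 * K)).
  { replace (1 - rm / (2 * K) * (rm / (2 * K))) with ((4 * (K * K) - rm * rm) / (2 * K * (2 * K)))
      by (field; lra).
    replace (4 * (K * K) - rm * rm) with (s * s) by (rewrite ss, KK; ring).
    replace (s * s / (2 * K * (2 * K))) with (s / (2 * K) * (s / (2 * K))) by (field; lra).
    apply sqrt_square. left. apply Rdiv_lt_0_compat; lra. }
  assert (c2 : 0 < 1 - rm / (2 * K) * (rm / (2 * K))).
  { replace (1 - rm / (2 * K) * (rm / (2 * K))) with ((4 * (K * K) - rm * rm) / (2 * K * (2 * K)))
      by (field; lra).
    apply Rdiv_lt_0_compat; nra. }
  assert (AX : asym dom X (rm / s)).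
  { replace (rm / s) with (rm / (2 * K) / sqrt (1 - rm / (2 * K) * (rm / (2 * K))))
      by (rewrite sK; field; lra).
    apply (asym_ext _ (fun t => X t / Mt t / sqrt (1 - X t / Mt t * (X t / Mt t))) _ _ 1); [lra| |].
    - intros t Ht _. specialize (M0 t).
      assert (S : Mt t * Mt t = X t * X t + 1) by (apply sqrt_sqrt; nra).
      replace (1 - X t / Mt t * (X t / Mt t)) with (/ Mt t * / Mt t).
      + rewrite sqrt_square by (left; apply Rinv_0_lt_compat; auto). field. lra.
      + apply (Rmult_eq_reg_r (Mt t * Mt t)); [|nra].
        replace ((1 - X t / Mt t * (X t / Mt t)) * (Mt t * Mt t)) with (Mt t * Mt t - X t * X t)
          by (field; lra).
        replace (/ Mt t * / Mt t * (Mt t * Mt t)) with 1 by (field; lra). lra.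
    - apply asym_div; auto.
      + rewrite sK. apply Rdiv_lt_0_compat; lra.
      + apply asym_sqrt; auto. apply asym_minus; [apply asym_const|apply asym_mult; auto]. }
  assert (AM : asym dom Mt (2 * K / s)).
  { replace (2 * K / s) with (sqrt (rm / s * (rm / s) + 1)).
    - apply asym_sqrt; [nra|]. apply asym_plus; [apply asym_mult; auto|apply asym_const].
    - replace (rm / s * (rm / s) + 1) with ((rm * rm + s * s) / (s * s)) by (field; lra).
      replace (rm * rm + s * s) with (4 * (K * K)) by (rewrite ss, KK; ring).
      replace (4 * (K * K) / (s * s)) with (2 * K / s * (2 * K / s)) by (field; lra).
      apply sqrt_square. left. apply Rdiv_lt_0_compat; lra. }
  assert (AP : asym dom Pt (2 * K / s)).
  { replace (2 * K / s) with (sqrt ((rm * 0 + rm / s) * (rm * 0 + rm / s) + (rn * 0 + 1) * (rn * 0 + 1))).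
    - assert (A1 : asym dom (fun t => rm * t + X t) (rm * 0 + rm / s)).
      { apply asym_plus; auto. apply asym_mult; [apply asym_const|apply asym_id]. }
      assert (A2 : asym dom (fun t => rn * t + 1) (rn * 0 + 1)).
      { apply asym_plus; [|apply asym_const]. apply asym_mult; [apply asym_const|apply asym_id]. }
      apply asym_sqrt; [nra|]. apply asym_plus; apply asym_mult; auto.
    - replace ((rm * 0 + rm / s) * (rm * 0 + rm / s) + (rn * 0 + 1) * (rn * 0 + 1))
        with ((rm * rm + s * s) / (s * s)) by (field; lra).
      replace (rm * rm + s * s) with (4 * (K * K)) by (rewrite ss, KK; ring).
      replace (4 * (K * K) / (s * s)) with (2 * K / s * (2 * K / s)) by (field; lra).
      apply sqrt_square. left. apply Rdiv_lt_0_compat; lra. }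
  set (E := fun t => (rn * X t - rm) ^ 2 / Mt t ^ 2 *
     (Pt t - t * K) * (t * K + Mt t) / Pt t ^ 2 *
     (K + (t * K ^ 2 + 2 * (rm * X t + rn)) / (Pt t + Mt t)) ^ 2 / (16 * N ^ 2 * K ^ 2)).
  assert (AE : asym dom E ((rn * (rm / s) - rm) ^ 2 / (2 * K / s) ^ 2 *
     (2 * K / s - 0 * K) * (0 * K + 2 * K / s) / (2 * K / s) ^ 2 *
     (K + (0 * K ^ 2 + 2 * (rm * (rm / s) + rn)) / (2 * K / s + 2 * K / s)) ^ 2 / (16 * N ^ 2 * K ^ 2))).
  { assert (0 < K ^ 2) by (apply pow_lt; auto). assert (0 < N ^ 2) by (apply pow_lt; auto).
    assert (0 < 2 * K / s) by (apply Rdiv_lt_0_compat; lra).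
    unfold E. repeat first [exact AX | exact AM | exact AP | apply asym_const | apply asym_id
      | apply asym_pow | apply asym_minus | apply asym_plus
      | apply asym_div | apply asym_mult]; try apply pow_lt; auto; try lra.
    repeat apply Rmult_lt_0_compat; lra. }
  replace ((rn * (rm / s) - rm) ^ 2 / (2 * K / s) ^ 2 *
     (2 * K / s - 0 * K) * (0 * K + 2 * K / s) / (2 * K / s) ^ 2 *
     (K + (0 * K ^ 2 + 2 * (rm * (rm / s) + rn)) / (2 * K / s + 2 * K / s)) ^ 2 / (16 * N ^ 2 * K ^ 2))
    with (rm ^ 2 / (256 * N ^ 2 * K ^ 6) * (rn - s) ^ 2 *
             (3 * rm ^ 2 + 2 * rn ^ 2 + rn * s) ^ 2) in AE.
  2:{ replace (3 * rm ^ 2 + 2 * rn ^ 2 + rn * s) with (2 * (K * K) + rm * rm + rn * s) by (rewrite KK; ring).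
      field. lra. }
  destruct AE as (c' & d' & c0' & d0' & HE).
  exists c', (/ d'). split; [apply Rinv_0_lt_compat; auto|].
  intros tau Ht. unfold mu_large.
  assert (tau0 : 0 < tau) by (pose proof (Rinv_0_lt_compat d' d0'); lra).
  set (t := / tau).
  assert (t0 : 0 < t) by (apply Rinv_0_lt_compat; auto).
  assert (Et : tau = / t) by (unfold t; rewrite Rinv_inv; auto).
  specialize (HE t t0). rewrite (Rabs_pos_eq t) in HE by lra.
  assert (td : t < d').
  { unfold t. rewrite <- (Rinv_inv d'). apply Rinv_lt_contravar; auto.
    apply Rmult_lt_0_compat; auto using Rinv_0_lt_compat. }
  specialize (HE td).
  replace (c' / tau) with (c' * t) by reflexivity.
  replace (e_coef N (m, n) (varphi N (m, n) tau, tau)) with (E t); [exact HE|].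
  rewrite Et. fold (x t). rewrite e_coef_rad, EM, EP by auto. fold (Mt t).
  assert (P0 : 0 < Pt t) by (apply sqrt_lt_R0, sum_squares_pos; nra).
  specialize (M0 t).
  assert (S : Mt t * Mt t = X t * X t + 1) by (apply sqrt_sqrt; nra).
  assert (S' : Pt t * Pt t = (rm * t + X t) * (rm * t + X t) + (rn * t + 1) * (rn * t + 1))
    by (apply sqrt_sqrt, sum_squares_ge0).
  assert (D : (t * K ^ 2 + 2 * (rm * X t + rn)) / (Pt t + Mt t) = (Pt t - Mt t) / t).
  { apply (Rmult_eq_reg_r (t * (Pt t + Mt t))); [|nra].
    replace ((Pt t - Mt t) / t * (t * (Pt t + Mt t))) with (Pt t * Pt t - Mt t * Mt t) by (field; lra).
    rewrite S, S'.
    replace ((t * K ^ 2 + 2 * (rm * X t + rn)) / (Pt t + Mt t) * (t * (Pt t + Mt t)))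
      with (t * t * (K * K) + 2 * t * (rm * X t + rn)) by (field; lra).
    rewrite KK. ring. }
  unfold E. rewrite D.
  replace (x t) with (X t / t) by (unfold X; field; lra).
  field. lra.
Qed.

End Curve.

(** * The spectral plane of the linearized operator *)

Section SpectralPlane.
Variables (N : R) (k : Z * Z) (mu : R * R) (e b : R).
Hypotheses (N0 : 0 < N) (k0 : (0 < fst k)%Z)
  (mu_nonint : ~ exists j : Z * Z, mu = toR2 j).

Let h := wave_hops N k mu.
Let wt := freq N k mu.

Hypothesis h_bd : hops_bounded h b.

Lemma of_coords_lin (y z : C) a a' :
  of_coords N k mu (fun i => y * a i + z * a' i)%C =
  sadd (sscal y (of_coords N k mu a)) (sscal z (of_coords N k mu a')).
Proof.
  unfold of_coords, sadd, sscal, fadd, fscal; cbn [fst snd].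
  apply injective_projections; extensionality j; cbn [fst snd];
  destruct (site k j); ring.
Qed.

Lemma Lshift_of_coords z a :
  Lshift N k mu e z (of_coords N k mu a) =
  of_coords N k mu (fun i => diag_hop wt h e a i - z * a i)%C.
Proof.
  unfold Lshift. rewrite Lop_of_coords by auto. fold wt h.
  unfold of_coords, ssub, sscal, fsub, fscal; cbn [fst snd].
  apply injective_projections; extensionality j; cbn [fst snd];
  destruct (site k j); ring.
Qed.

Lemma of_to_coords_X0 U : inX0 k U -> of_coords N k mu (to_coords N k mu U) = U.
Proof. intros [_ H]. apply of_to_coords; auto. Qed.

Lemma inX0_of_coords a c : ell2c a c -> inX0 k (of_coords N k mu a).
Proof.
  intros Ha. destruct (of_coords_bounded N k mu N0 k0 mu_nonint) as (q & _ & Hq).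
  apply (Hq a c Ha).
Qed.

Lemma to_coords_X0 U : inX0 k U -> exists c, ell2c (to_coords N k mu U) c.
Proof.
  intros HU. destruct (to_coords_bounded N k mu N0 k0 mu_nonint) as (q & _ & Hq).
  eexists. apply Hq; auto.
Qed.

Lemma domL_of_coords z a f c c' :
  ell2c a c -> ell2c f c' -> (forall i, diag_hop wt h e a i - z * a i = f i)%C ->
  domL N k mu e (of_coords N k mu a).
Proof.
  intros Ha Hf E. split; [apply (inX0_of_coords a c Ha)|].
  rewrite Lop_of_coords by auto. apply (inX0_of_coords _ (c' + Cmod z * c)).
  eapply ell2c_le; [|apply Rle_refl|apply ell2c_plus; [exact Hf|apply (ell2c_scal z); exact Ha]].
  intros i. cbv beta. rewrite <- E. apply Req_le. f_equal. fold wt h. ring.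
Qed.

Lemma domL_coords z U F : inX0 k F -> domL N k mu e U -> Lshift N k mu e z U = F ->
  (exists c, ell2c (to_coords N k mu U) c) /\
  forall i, (diag_hop wt h e (to_coords N k mu U) i - z * to_coords N k mu U i
     = to_coords N k mu F i)%C.
Proof.
  intros HF [HU HL] E. split; [apply to_coords_X0; auto|].
  intros i. rewrite <- E. rewrite <- (of_to_coords_X0 U HU) at 3.
  rewrite Lshift_of_coords, to_of_coords; auto.
Qed.

Lemma resolvent_set_of_gap z d :
  0 < d -> (forall i, d <= Cmod (Ci * RtoC (wt i) - z)) ->
  Rabs e * hops_norm h b <= d / 2 -> resolvent_set N k mu e z.
Proof.
  intros d0 Hd sm. split.
  - intros F HF. destruct (to_coords_X0 F HF) as [c Hc].
    destruct (resolvent_exists _ wt h b e z d h_bd d0 Hd sm _ c Hc) as (a & Ha & Ea).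
    exists (of_coords N k mu a). split.
    + split; [apply (domL_of_coords z a _ _ _ Ha Hc Ea)|].
      rewrite Lshift_of_coords.
      replace (fun i => diag_hop wt h e a i - z * a i)%C with (to_coords N k mu F)
        by (extensionality i; auto).
      apply of_to_coords_X0; auto.
    + intros U [HU EU]. destruct (domL_coords z U F HF HU EU) as [[c' Hc'] Ei].
      rewrite <- (of_to_coords_X0 U) by apply HU. f_equal.
      assert (D : ell2c (fun i => a i - to_coords N k mu U i)%C (2 / d * 0)).
      { apply (resolvent_bound _ wt h b e z d h_bd d0 Hd sm _ (fun _ => RtoC 0) 0 (2 / d * c + c')).
        - apply ell2c_0; lra.
        - apply ell2c_minus; auto.
        - intros i. specialize (Ea i). specialize (Ei i). unfold diag_hop in *.
          pose proof (additive_hop h (fun _ => RtoC 1) a (to_coords N k mu U) i) as Ad.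
          cbv beta in Ad. rewrite !Cmult_1_l in Ad. rewrite Ad.
          transitivity ((Ci * (RtoC (wt i) * a i + RtoC e * hop_opC h a i) - z * a i)
            - (Ci * (RtoC (wt i) * to_coords N k mu U i + RtoC e * hop_opC h (to_coords N k mu U) i)
                 - z * to_coords N k mu U i))%C; [ring|].
          rewrite Ea, Ei. ring. }
      extensionality i. pose proof (ell2c_coef _ _ i D) as Di. cbv beta in Di.
      rewrite Rmult_0_r in Di.
      assert (Z : (a i - to_coords N k mu U i = 0)%C).
      { apply Cmod_eq_0. apply Rle_antisym; auto. apply Cmod_ge_0. }
      replace (a i) with (a i - to_coords N k mu U i + to_coords N k mu U i)%C by ring.
      rewrite Z. ring.
  - destruct (of_coords_bounded N k mu N0 k0 mu_nonint) as (q & q0 & Hq).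
    destruct (to_coords_bounded N k mu N0 k0 mu_nonint) as (q' & q0' & Hq').
    exists (q * (2 / d * q')). intros U HU.
    assert (HF : inX0 k (Lshift N k mu e z U)).
    { destruct HU as [H1 H2]. destruct (to_coords_X0 U H1) as [c Hc].
      destruct (to_coords_X0 _ H2) as [c' Hc'].
      rewrite <- (of_to_coords_X0 U H1). rewrite Lshift_of_coords.
      rewrite <- (of_to_coords_X0 U H1) in Hc'. rewrite Lop_of_coords, to_of_coords in Hc' by auto.
      apply (inX0_of_coords _ (c' + Cmod z * c)). apply ell2c_minus; auto.
      apply (ell2c_scal z); auto. }
    destruct (domL_coords z U _ HF HU eq_refl) as [[c Hc] Ei].
    pose proof (resolvent_bound _ wt h b e z d h_bd d0 Hd sm _ _ _ c (Hq' _ HF) Hc Ei) as R.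
    rewrite <- (of_to_coords_X0 U) at 1 by apply HU.
    eapply Rle_trans; [apply (Hq _ _ R)|]. apply Req_le. ring.
Qed.

Variables (pt : bool -> Z * bool) (v : bool -> Z * bool -> R) (M : bool -> bool -> R)
  (z0 : C) (rho d : R) (l1 l2 : C).
Hypotheses (v_bd : forall s, ell2 (v s) 2)
  (v_pt : forall s t, v s (pt t) = delta s t)
  (v_inv : forall s i, wt i * v s i + e * hop_op h (v s) i
     = M s true * v true i + M s false * v false i)
  (rho0 : 0 < rho)
  (dist : forall i, (exists t, i = pt t) \/ d <= Cmod (Ci * RtoC (wt i) - z0))
  (small : rho + 5 * (Rabs e * hops_norm h b) < d)
  (l1_in : Cmod (l1 - z0) < rho) (l2_in : Cmod (l2 - z0) < rho)
  (char : forall z, ((Ci * RtoC (M true true) - z) * (Ci * RtoC (M false false) - z)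
      - (Ci * RtoC (M true false)) * (Ci * RtoC (M false true)) = (l1 - z) * (l2 - z))%C).

Definition plane_state (x : bool -> C) : state := of_coords N k mu (plane_comb v x).

(** Transport of [projector_in_plane] and [plane_in_range] to states: passing to
    coordinates acts coefficientwise, hence commutes with contour integrals. *)
Lemma spectral_space_iff U :
  spectral_space N k mu e z0 rho U <-> exists x, U = plane_state x.
Proof.
  split.
  - intros (F & HF & HU & W & HW & HI).
    destruct (to_coords_X0 F HF) as [c Hc].
    exists (fun t => to_coords N k mu U (pt t)).
    unfold plane_state. rewrite <- (of_to_coords_X0 U HU) at 1. f_equal. extensionality i.
    apply (projector_in_plane _ wt h b e pt v M z0 rho d h_bd v_bd v_pt v_inv rho0 dist small
      (to_coords N k mu F) (to_coords N k mu U) c (fun t => to_coords N k mu (W t))); auto.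
    + intros t Ht. destruct (HW t Ht) as [H1 H2]. apply (domL_coords _ _ F); auto.
    + intros i'. unfold to_coords, Cdiv.
      destruct (HI (Zscal2 (fst i') k)) as [I1 I2].
      apply (is_contour_ext rho (fun t => / 2 * snd (W t) (Zscal2 (fst i') k) +
        (- / 2 * RtoC (sg (snd i') * (modulus k mu (fst i') / N))) * fst (W t) (Zscal2 (fst i') k))%C).
      { intros; ring. }
      replace ((snd U (Zscal2 (fst i') k) -
        RtoC (sg (snd i') * (modulus k mu (fst i') / N)) * fst U (Zscal2 (fst i') k)) * / 2)%C with
        (/ 2 * snd U (Zscal2 (fst i') k) +
        (- / 2 * RtoC (sg (snd i') * (modulus k mu (fst i') / N))) * fst U (Zscal2 (fst i') k))%C by ring.
      apply is_contour_plus; apply is_contour_scal; auto.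
  - intros [x ->].
    destruct (comb_ell2c _ v v_bd x) as [c Hc].
    destruct (plane_in_range _ wt h e v M z0 rho v_bd v_inv rho0 l1 l2 x l1_in l2_in char)
      as (W & HW & HI).
    exists (plane_state x). split; [apply (inX0_of_coords _ c Hc)|].
    split; [apply (inX0_of_coords _ c Hc)|].
    exists (fun t => of_coords N k mu (W t)). split.
    + intros t _. destruct (HW t) as [[c' Hc'] E].
      split; [apply (domL_of_coords (circle z0 rho t) _ _ _ _ Hc' Hc E)|].
      rewrite Lshift_of_coords. unfold plane_state. f_equal. extensionality i. apply E.
    + intros j. unfold plane_state, of_coords; cbn [fst snd].
      assert (Z : is_contour rho (fun _ => RtoC 0) 0).
      { apply is_contour_CInt. replace (- RtoC (2 * PI) * 0)%C with (RtoC (2 * PI) * 0)%C by ring.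
        eapply is_CInt_ext; [|apply is_CInt_const]. intros; simpl; ring. }
      destruct (site k j) as [l|]; [|auto]. split.
      * apply (is_contour_ext rho (fun t => RtoC (- N / modulus k mu l) * W t (l, true)
          + (- RtoC (- N / modulus k mu l)) * W t (l, false))%C); [intros; ring|].
        replace (RtoC (- N / modulus k mu l) * (plane_comb v x (l, true) - plane_comb v x (l, false)))%C
          with (RtoC (- N / modulus k mu l) * plane_comb v x (l, true)
          + (- RtoC (- N / modulus k mu l)) * plane_comb v x (l, false))%C by ring.
        apply is_contour_plus; apply is_contour_scal; auto.
      * apply is_contour_plus; auto.
Qed.

Lemma plane_state_lin (y z : C) x x' :
  sadd (sscal y (plane_state x)) (sscal z (plane_state x')) =
  plane_state (fun s => y * x s + z * x' s)%C.
Proof.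
  unfold plane_state. rewrite <- of_coords_lin. f_equal. extensionality i.
  unfold plane_comb. ring.
Qed.

Lemma plane_state_inj x x' : plane_state x = plane_state x' -> forall t, x t = x' t.
Proof.
  intros E t. apply (f_equal (to_coords N k mu)) in E. unfold plane_state in E.
  rewrite !to_of_coords in E by auto.
  apply (f_equal (fun a => a (pt t))) in E. unfold plane_comb in E. rewrite !v_pt in E.
  destruct t; unfold delta in E; simpl in E.
  - replace (x true) with (x true * 1 + x false * 0)%C by ring. rewrite E. ring.
  - replace (x false) with (x true * 0 + x false * 1)%C by ring. rewrite E. ring.
Qed.

Lemma Lop_plane_state x :
  Lop N k mu e (plane_state x) =
  plane_state (fun t => Ci * (x true * RtoC (M true t) + x false * RtoC (M false t)))%C.
Proof.
  unfold plane_state. rewrite Lop_of_coords by auto. f_equal. extensionality i.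
  apply (diag_hop_comb _ wt h e v M v_inv).
Qed.

Lemma domL_plane_state x : domL N k mu e (plane_state x).
Proof.
  destruct (comb_ell2c _ v v_bd x) as [c Hc].
  split; [apply (inX0_of_coords _ c Hc)|]. rewrite Lop_plane_state.
  destruct (comb_ell2c _ v v_bd (fun t => Ci * (x true * RtoC (M true t) + x false * RtoC (M false t)))%C) as [c' Hc'].
  apply (inX0_of_coords _ c' Hc').
Qed.

Lemma plane_eigenvalue z :
  (exists x, plane_state x <> szero /\ Lop N k mu e (plane_state x) = sscal z (plane_state x))
  <-> z = l1 \/ z = l2.
Proof.
  assert (S0 : szero = plane_state (fun _ => RtoC 0)).
  { unfold plane_state, plane_comb, of_coords, szero. apply injective_projections; extensionality j; cbn [fst snd];
    destruct (site k j); ring. }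
  assert (Sz : forall x, sscal z (plane_state x) = plane_state (fun s => z * x s)%C).
  { intros x. transitivity (sadd (sscal z (plane_state x)) (sscal 0 (plane_state x))).
    - unfold sadd, sscal, fadd, fscal; cbn [fst snd].
      apply injective_projections; extensionality j; cbn [fst snd]; ring.
    - rewrite plane_state_lin. f_equal. extensionality s. ring. }
  set (al := (Ci * RtoC (M true true) - z)%C). set (de := (Ci * RtoC (M false false) - z)%C).
  set (be := (Ci * RtoC (M false true))%C). set (ga := (Ci * RtoC (M true false))%C).
  assert (Ch : (al * de - ga * be = (l1 - z) * (l2 - z))%C) by apply char.
  split.
  - intros (x & Hx & E). rewrite Lop_plane_state, Sz in E.
    pose proof (plane_state_inj _ _ E true) as E1. pose proof (plane_state_inj _ _ E false) as E2.
    cbv beta in E1, E2.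
    assert (A1 : (al * x true + be * x false = 0)%C).
    { unfold al, be. transitivity (Ci * (x true * RtoC (M true true) + x false * RtoC (M false true)) - z * x true)%C; [ring|].
      rewrite E1. ring. }
    assert (A2 : (ga * x true + de * x false = 0)%C).
    { unfold ga, de. transitivity (Ci * (x true * RtoC (M true false) + x false * RtoC (M false false)) - z * x false)%C; [ring|].
      rewrite E2. ring. }
    assert (D : ((l1 - z) * (l2 - z) = 0)%C).
    { destruct (classic ((l1 - z) * (l2 - z) = 0)%C) as [D|D]; auto. exfalso. apply Hx.
      rewrite S0. f_equal. extensionality s.
      assert (X1 : ((l1 - z) * (l2 - z) * x true = 0)%C).
      { rewrite <- Ch. transitivity (de * (al * x true + be * x false) - be * (ga * x true + de * x false))%C; [ring|].
        rewrite A1, A2. ring. }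
      assert (X2 : ((l1 - z) * (l2 - z) * x false = 0)%C).
      { rewrite <- Ch. transitivity (al * (ga * x true + de * x false) - ga * (al * x true + be * x false))%C; [ring|].
        rewrite A1, A2. ring. }
      destruct s.
      - replace (x true) with (/ ((l1 - z) * (l2 - z)) * ((l1 - z) * (l2 - z) * x true))%C by (field; split; intros Q; apply D; rewrite Q; ring).
        rewrite X1. ring.
      - replace (x false) with (/ ((l1 - z) * (l2 - z)) * ((l1 - z) * (l2 - z) * x false))%C by (field; split; intros Q; apply D; rewrite Q; ring).
        rewrite X2. ring. }
    destruct (classic (l1 - z = 0)%C) as [Q|Q].
    + left. replace l1 with (l1 - z + z)%C by ring. rewrite Q. ring.
    + right. assert (R : (l2 - z = 0)%C).
      { replace (l2 - z)%C with (/ (l1 - z) * ((l1 - z) * (l2 - z)))%C by (field; auto).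
        rewrite D. ring. }
      replace l2 with (l2 - z + z)%C by ring. rewrite R. ring.
  - intros Hz.
    assert (D : (al * de - ga * be = 0)%C).
    { rewrite Ch. destruct Hz as [-> | ->]; ring. }
    assert (X : exists x : bool -> C, (exists s, x s <> RtoC 0) /\
       (al * x true + be * x false = 0)%C /\ (ga * x true + de * x false = 0)%C).
    { destruct (classic (al = RtoC 0)) as [Ea|Ea].
      - destruct (classic (be = RtoC 0)) as [Eb|Eb].
        + destruct (classic (ga = RtoC 0)) as [Eg|Eg].
          * exists (fun s : bool => if s then RtoC 1 else RtoC 0). split.
            { exists true. apply RtoC_neq0; lra. }
            rewrite Ea, Eb, Eg. split; ring.
          * exists (fun s : bool => if s then de else (- ga)%C). split.
            { exists false. intros Q. apply Eg. replace ga with (- - ga)%C by ring. rewrite Q. ring. }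
            rewrite Ea, Eb. split; ring.
        + exists (fun s : bool => if s then be else (- al)%C). split; [exists true; auto|].
          split; [ring|]. transitivity (- (al * de - ga * be))%C; [ring|]. rewrite D. ring.
      - exists (fun s : bool => if s then be else (- al)%C). split.
        + exists false. intros Q. apply Ea. replace al with (- - al)%C by ring. rewrite Q. ring.
        + split; [ring|]. transitivity (- (al * de - ga * be))%C; [ring|]. rewrite D. ring. }
    destruct X as (x & [s Hs] & X1 & X2). exists x. split.
    + intros Q. rewrite S0 in Q. apply Hs. apply (plane_state_inj _ _ Q s).
    + rewrite Lop_plane_state, Sz. f_equal. extensionality t. unfold al, be, ga, de in *.
      destruct t.
      * transitivity ((Ci * RtoC (M true true) - z) * x true + Ci * RtoC (M false true) * x false + z * x true)%C; [ring|].
        rewrite X1. ring.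
      * transitivity (Ci * RtoC (M true false) * x true + (Ci * RtoC (M false false) - z) * x false + z * x false)%C; [ring|].
        rewrite X2. ring.
Qed.

End SpectralPlane.

(** * Reduction to a two by two matrix *)

(** The two resonant modes: [w^+] at the site [0] and [w^-] at the site [k]. *)
Definition resonant_site (t : bool) : Z * bool := if t then (0%Z, true) else (1%Z, false).

Lemma csqrt_sq x : (csqrt x * csqrt x = RtoC x)%C.
Proof.
  unfold csqrt. destruct (Rle_dec 0 x) as [H|H].
  - rewrite (sqrt_neg_0 (- x)) by lra.
    apply injective_projections; simpl; [|ring].
    rewrite sqrt_sqrt by auto. ring.
  - rewrite (sqrt_neg_0 x) by lra.
    apply injective_projections; simpl; [|ring].
    rewrite sqrt_sqrt by lra. ring.
Qed.

Lemma csqrt_le x : Cmod (csqrt x) <= 1 + Rabs x.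
Proof.
  assert (H : Cmod (csqrt x) * Cmod (csqrt x) = Rabs x)
    by (rewrite <- Cmod_mult, csqrt_sq, Cmod_R; reflexivity).
  pose proof (Cmod_ge_0 (csqrt x)). nra.
Qed.

Section Reduction.
Variables (N : R) (k : Z * Z) (mu : R * R).
Hypotheses (N0 : 0 < N) (k0 : (0 < fst k)%Z)
  (mu_nonint : ~ exists j : Z * Z, mu = toR2 j).

Let K := norm2 (toR2 k).
Let M := norm2 mu.
Let P := norm2 (add2 (toR2 k) mu).

Lemma moduli_pos : 0 < K /\ 0 < M /\ 0 < P.
Proof.
  split; [apply K_pos; auto|]. split; apply norm2_pos; intros E; apply mu_nonint.
  - exists (0%Z, 0%Z). exact E.
  - exists (Zscal2 (-1) k). destruct k as [m n], mu as [x y].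
    unfold add2, toR2, Zscal2 in *; cbn [fst snd] in *. injection E as E1 E2.
    rewrite !mult_IZR. f_equal; lra.
Qed.

Lemma Zscal2_1 : Zscal2 1 k = k.
Proof. unfold Zscal2. rewrite !Z.mul_1_l. symmetry; apply surjective_pairing. Qed.

Lemma modulus_0 : modulus k mu 0 = M.
Proof.
  unfold modulus, xi, Zscal2. rewrite !Z.mul_0_l. unfold add2, toR2; cbn [fst snd].
  rewrite !Rplus_0_l, <- surjective_pairing. reflexivity.
Qed.

Lemma modulus_1 : modulus k mu 1 = P.
Proof. unfold modulus, xi. rewrite Zscal2_1. reflexivity. Qed.

(** The drift [c . k] equals [Omega(k)], so resonance is the coincidence of the
    two frequencies. *)
Lemma resonant_freq :
  resonant N k mu -> w N k 1 (0%Z, 0%Z) mu = w N k (-1) k mu.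
Proof.
  intros [E|[_ E]].
  - exfalso. apply mu_nonint. exists (0%Z, 0%Z). exact E.
  - destruct moduli_pos as (K0 & _).
    assert (C : dot2 (cvec N k) (toR2 k) = Omega N (toR2 k)).
    { unfold cvec, Omega, dot2; cbn [fst snd]. fold K.
      assert (S : IZR (fst k) * IZR (fst k) + IZR (snd k) * IZR (snd k) = K ^ 2)
        by (unfold K; rewrite norm2_sq; unfold toR2; cbn [fst snd]; ring).
      unfold toR2; cbn [fst snd].
      replace (N * IZR (fst k) / K ^ 3 * IZR (fst k) * IZR (fst k) +
         N * IZR (fst k) / K ^ 3 * IZR (snd k) * IZR (snd k)) with
        (N * IZR (fst k) / K ^ 3 * (IZR (fst k) * IZR (fst k) + IZR (snd k) * IZR (snd k))) by ring.
      rewrite S. field. lra. }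
    unfold w.
    replace (add2 (toR2 (0%Z, 0%Z)) mu) with mu.
    2:{ unfold add2, toR2; cbn [fst snd]. rewrite !Rplus_0_l. apply surjective_pairing. }
    replace (dot2 (cvec N k) (add2 (toR2 k) mu)) with (dot2 (cvec N k) (toR2 k) + dot2 (cvec N k) mu)
      by (unfold dot2, add2; cbn [fst snd]; ring).
    rewrite C. lra.
Qed.

Lemma freq_resonant_site t :
  resonant N k mu -> freq N k mu (resonant_site t) = w N k (-1) k mu.
Proof.
  intros H. destruct t; unfold freq, resonant_site; cbn [fst snd sg].
  - rewrite <- resonant_freq by auto. unfold Zscal2. rewrite !Z.mul_0_l. reflexivity.
  - rewrite Zscal2_1. reflexivity.
Qed.

Lemma freq_gap g :
  resonant N k mu ->
  (forall l : Z, l <> 0%Z -> g <= Rabs (w N k 1 (Zscal2 l k) mu - w N k 1 (0%Z, 0%Z) mu)) ->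
  (forall l : Z, l <> 1%Z -> g <= Rabs (w N k (-1) (Zscal2 l k) mu - w N k (-1) k mu)) ->
  forall i, (exists t, i = resonant_site t) \/ g <= Rabs (freq N k mu i - w N k (-1) k mu).
Proof.
  intros R G1 G2 [l s]. unfold freq; cbn [fst snd]. destruct s; cbn [sg].
  - destruct (Z.eq_dec l 0) as [->|L]; [left; exists true; reflexivity|right].
    rewrite <- resonant_freq by auto. auto.
  - destruct (Z.eq_dec l 1) as [->|L]; [left; exists false; reflexivity|right; auto].
Qed.

(** Each resonant site has the other one among its neighbours, which gives the
    off-diagonal entries; the ratios [P / M] and [M / P] come from the
    normalisation of the eigenvectors by their second component. *)
Lemma first_order s t :
  hop_op (wave_hops N k mu) (unit_at (Z * bool) resonant_site s) (resonant_site t) =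
  if s then if t then 0 else - (P / M) * b0 N k mu
  else if t then - (M / P) * b1 N k mu else 0.
Proof.
  destruct moduli_pos as (K0 & M0 & P0).
  assert (U : forall l s', unit_at (Z * bool) resonant_site s (l, s') =
     if (if s then Z.eqb l 0 && s' else Z.eqb l 1 && negb s')%bool then 1 else 0).
  { intros l s'. unfold unit_at. destruct excluded_middle_informative as [E|E].
    - destruct s; unfold resonant_site in E; injection E as -> ->; reflexivity.
    - destruct s; [destruct (Z.eqb_spec l 0)|destruct (Z.eqb_spec l 1)]; destruct s'; simpl; auto;
      exfalso; apply E; unfold resonant_site; congruence. }
  unfold hop_op, wave_hops, neighbours. cbn [map fold_right fst snd].
  rewrite !U. unfold b0, b1, coupling, kappa. fold K M P.
  destruct s, t; cbn [resonant_site fst snd negb Z.add Z.sub Z.opp Z.eqb Pos.add Z.pos_sub andb sg Pos.eqb];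
  rewrite ?modulus_0, ?modulus_1, ?Rmult_0_r, ?Rmult_1_r, ?Rplus_0_l, ?Rplus_0_r; fold K M P;
  first [reflexivity | field; lra].
Qed.

End Reduction.

Theorem theorem2 :
  forall (N : R) (m n : Z), 0 < N -> (0 < m)%Z -> (0 < n)%Z ->
  let k := (m, n) in
  let K := norm2 (toR2 k) in
  (forall (D : R * R -> Prop) (alpha : R * R -> R),
   exceptional_set N k D alpha ->
   forall mu : R * R,
   resonant N k mu -> ~ D mu -> (~ exists j : Z * Z, mu = toR2 j) ->
   let lam := lambda_plus N k mu in
   forall (z0 : C) (rho : R),
   separating_circle N k (alpha mu) mu z0 rho ->
   e_coef N k mu = - b1 N k mu * b0 N k mu /\
   exists (eps0 : R) (r1 r2 r3 r4 r5 r6 : R -> R),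
     0 < eps0 /\
     remainder eps0 2 r1 /\ remainder eps0 2 r2 /\
     remainder eps0 2 r3 /\ remainder eps0 2 r4 /\
     remainder eps0 2 r5 /\ remainder eps0 1 r6 /\
     forall eps : R, 0 < eps < eps0 ->
       let L := Lop N k mu eps in
       let V := spectral_space N k mu eps z0 rho in
       let M00 := (lam + Ci * RtoC (r1 eps))%C in
       let M01 := (Ci * RtoC (b0 N k mu * eps) + Ci * RtoC (r2 eps))%C in
       let M10 := (Ci * RtoC (b1 N k mu * eps) + Ci * RtoC (r3 eps))%C in
       let M11 := (lam + Ci * RtoC (r4 eps))%C in
       let root := csqrt (e_coef N k mu + r6 eps) in
       let lamp := (lam + Ci * RtoC (r5 eps) + RtoC eps * root)%C in
       let lamm := (lam + Ci * RtoC (r5 eps) - RtoC eps * root)%C in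
       (* the projector, hence [V], is well defined *)
       (forall theta, resolvent_set N k mu eps (circle z0 rho theta)) /\
       (* the matrix of [L] on [V] *)
       (exists v0 v1 : state,
          is_basis V v0 v1 /\
          domL N k mu eps v0 /\ domL N k mu eps v1 /\
          L v0 = sadd (sscal M00 v0) (sscal M10 v1) /\
          L v1 = sadd (sscal M01 v0) (sscal M11 v1)) /\
       (* its eigenvalues, and their multiplicities *)
       (forall z : C,
          (exists U, V U /\ U <> szero /\ L U = sscal z U) <->
          z = lamp \/ z = lamm) /\
       (forall z : C,
          ((M00 - z) * (M11 - z) - M01 * M10 = (lamp - z) * (lamm - z))%C)) /\
  (exists C0 delta : R, 0 < delta /\
     forall tau : R, Rabs tau < delta ->
       Rabs (e_coef N k (mu_small N k tau)
             - IZR m ^ 2 * IZR n ^ 2 / (4 * N ^ 2 * K ^ 2) * tau)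
       <= C0 * tau ^ 2) /\
  (let s := sqrt (3 * IZR m ^ 2 + 4 * IZR n ^ 2) in
   exists C0 T : R, 0 < T /\
     forall tau : R, T < tau ->
       Rabs (e_coef N k (mu_large N k tau)
             - IZR m ^ 2 / (256 * N ^ 2 * K ^ 6) * (IZR n - s) ^ 2 *
               (3 * IZR m ^ 2 + 2 * IZR n ^ 2 + IZR n * s) ^ 2)
       <= C0 / tau).

Proof.
  intros N m n N0 m0 n0 k K.
  split; [|split; [exact (e_coef_small N m n N0 m0 n0)|exact (e_coef_large N m n N0 m0 n0)]].
  intros D alpha (_ & _ & _ & gaps) mu res nD nonint lam z0 rho (rho0 & lam_in & diam & _).
  destruct (gaps mu res nD) as (al0 & G1 & G2).
  assert (k0 : (0 < fst k)%Z) by exact m0.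
  destruct (moduli_pos k mu k0 nonint) as (K0 & M0 & P0).
  set (M := norm2 mu) in *. set (P := norm2 (add2 (toR2 k) mu)) in *. fold K in K0.
  assert (e_b : e_coef N k mu = - b1 N k mu * b0 N k mu).
  { unfold e_coef, b1, b0. fold K M P. field. lra. }
  split; [exact e_b|].
  set (g := alpha mu * N) in *.
  assert (g0 : 0 < g) by (apply Rmult_lt_0_compat; auto).
  set (om := w N k (-1) k mu) in *.
  pose proof (freq_gap N k mu k0 nonint g res G1 G2) as gap. fold om in gap.
  destruct (wave_hops_bounded N k mu N0 k0 nonint) as (b & h_bd).
  set (h := wave_hops N k mu) in *. set (wt := freq N k mu) in *.
  set (Rs := fun i => if excluded_middle_informative (exists t, i = resonant_site t) then 0
    else / (wt i - om)).
  destruct (invariant_plane (Z * bool) wt om Rs (/ g) h b resonant_site h_bd)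
    as (r & v & rh & r0 & Hrh & plane).
  { left; apply Rinv_0_lt_compat; auto. }
  { intros i. unfold Rs. destruct excluded_middle_informative as [E|E].
    - rewrite Rabs_R0. left; apply Rinv_0_lt_compat; auto.
    - destruct (gap i) as [?|Gi]; [contradiction|].
      rewrite Rabs_inv. apply Rinv_le_contravar; auto. }
  { intros t. unfold Rs. destruct excluded_middle_informative as [E|E]; auto.
    exfalso. apply E. exists t; auto. }
  { intros t. apply freq_resonant_site; auto. }
  { unfold resonant_site. congruence. }
  { intros i. destruct (gap i) as [?|Gi]; [left; auto|]. right.
    unfold Rs. destruct excluded_middle_informative as [[t ->]|E].
    - exfalso. unfold wt in Gi. rewrite freq_resonant_site in Gi by auto. fold om in Gi.
      replace (om - om) with 0 in Gi by ring. rewrite Rabs_R0 in Gi. lra.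
    - apply Rinv_l. intros Q. rewrite Q, Rabs_R0 in Gi. lra. }
  (* remainders of the off-diagonal entries, divided by [e], in the rescaled basis *)
  set (f2 := fun e => - (M / P) * rh true false e).
  set (f3 := fun e => - (P / M) * rh false true e).
  set (dd := fun e => rh false false e + (-1) * rh true true e).
  set (r1 := fun e => e * rh false false e). set (r4 := fun e => e * rh true true e).
  set (r2 := fun e => e * f2 e). set (r3 := fun e => e * f3 e).
  (* Apart from the factor [i] the matrix is real: [r5] comes from half its trace, and
     [e_coef + r6] is minus its discriminant divided by [4 e^2]. *)
  set (r5 := fun e => 1 / 2 * (r1 e + r4 e)).
  set (r6 := fun e => (-1 / 4 * (dd e * dd e) + - b0 N k mu * f3 e)
     + (- b1 N k mu * f2 e + (-1) * (f2 e * f3 e))).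
  assert (R2 : remainder r 1 f2) by (apply remainder_scal; auto).
  assert (R3 : remainder r 1 f3) by (apply remainder_scal; auto).
  assert (Rd : remainder r 1 dd) by (apply remainder_plus; [|apply remainder_scal]; auto).
  assert (Rr : forall f, remainder r 1 f -> remainder r 2 (fun e => e * f e)).
  { intros f Hf. apply (remainder_mult r 1 1); auto. apply remainder_id. }
  assert (R5 : remainder r 2 r5)
    by (apply remainder_scal, remainder_plus; apply Rr; auto).
  assert (R6 : remainder r 1 r6).
  { assert (Sq : forall f f', remainder r 1 f -> remainder r 1 f' -> remainder r 1 (fun e => f e * f' e)).
    { intros f f' Hf Hf'. apply remainder_weaken. apply (remainder_mult r 1 1); auto. }
    apply remainder_plus; apply remainder_plus; apply remainder_scal; auto. }
  destruct (proj2 R5) as [c5 Hc5]. destruct (proj2 R6) as [c6 Hc6].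
  set (H := hops_norm h b).
  assert (H0 : 0 <= H) by (apply hops_norm_ge0; auto).
  set (m1 := rho - Cmod (lam - z0)). set (m2 := g - 2 * rho).
  assert (m1p : 0 < m1) by (unfold m1, lam; lra).
  assert (m2p : 0 < m2) by (unfold m2; lra).
  set (dl := Rmin m1 m2).
  assert (dl0 : 0 < dl) by (apply Rmin_pos; auto).
  set (Ct := Rabs c5 + 2 + Rabs (e_coef N k mu) + Rabs c6).
  assert (Ct0 : 0 < Ct).
  { unfold Ct. pose proof (Rabs_pos c5). pose proof (Rabs_pos c6).
    pose proof (Rabs_pos (e_coef N k mu)). lra. }
  (* [dl] bounds from below the distance of the unperturbed spectrum to the circle;
     [Ct * e] bounds the displacement of the two eigenvalues *)
  set (eps0 := Rmin (Rmin r 1) (Rmin (dl / (10 * (H + 1))) (m1 / Ct))).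
  assert (B1 : eps0 <= r) by (eapply Rle_trans; [apply Rmin_l|apply Rmin_l]).
  assert (B2 : eps0 <= 1) by (eapply Rle_trans; [apply Rmin_l|apply Rmin_r]).
  assert (B3 : eps0 <= dl / (10 * (H + 1))) by (eapply Rle_trans; [apply Rmin_r|apply Rmin_l]).
  assert (B4 : eps0 <= m1 / Ct) by (eapply Rle_trans; [apply Rmin_r|apply Rmin_r]).
  exists eps0, r1, r2, r3, r4, r5, r6.
  split.
  { repeat apply Rmin_pos; auto; try lra; apply Rdiv_lt_0_compat; lra. }
  do 6 (split; [apply (remainder_restrict r); auto; apply Rr; auto|]).
  intros e [e0 e1] L V M00 M01 M10 M11 root lamp lamm.
  assert (Ae : Rabs e = e) by (apply Rabs_pos_eq; lra).
  destruct (plane e ltac:(lra)) as (v_bd & v_pt & v_inv).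
  set (MM := fun s t => om * delta s t
    + e * (hop_op h (unit_at (Z * bool) resonant_site s) (resonant_site t) + rh s t e)).
  assert (M_tt : (Ci * RtoC (MM true true) = M11)%C).
  { unfold MM, M11, lam, lambda_plus, h. fold om. rewrite first_order by auto.
    unfold delta, r4. simpl. apply injective_projections; simpl; ring. }
  assert (M_ff : (Ci * RtoC (MM false false) = M00)%C).
  { unfold MM, M00, lam, lambda_plus, h. fold om. rewrite first_order by auto.
    unfold delta, r1. simpl. apply injective_projections; simpl; ring. }
  assert (M_tf : (Ci * RtoC (MM true false) = RtoC (- (P / M)) * M01)%C).
  { unfold MM, M01, h. rewrite first_order by auto. fold M P.
    unfold delta, r2, f2. simpl. apply injective_projections; simpl; field; lra. }
  assert (M_ft : (Ci * RtoC (MM false true) = RtoC (- (M / P)) * M10)%C).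
  { unfold MM, M10, h. rewrite first_order by auto. fold M P.
    unfold delta, r3, f3. simpl. apply injective_projections; simpl; field; lra. }
  assert (MP : (RtoC (- (P / M)) * RtoC (- (M / P)) = 1)%C).
  { rewrite <- RtoC_mult. f_equal. field. lra. }
  assert (char : forall z, ((M00 - z) * (M11 - z) - M01 * M10 = (lamp - z) * (lamm - z))%C).
  { intros z. pose proof (csqrt_sq (e_coef N k mu + r6 e)) as S. fold root in S.
    transitivity ((lam + Ci * RtoC (r5 e) - z) * (lam + Ci * RtoC (r5 e) - z)
      - RtoC e * RtoC e * (root * root))%C; [|unfold lamp, lamm; ring].
    rewrite S, e_b. unfold M00, M11, M01, M10.
    unfold r1, r2, r3, r4, r5, r6, dd, r1, r4. generalize (f2 e) (f3 e) (rh true true e) (rh false false e).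
    intros x2 x3 x4 x1. destruct z as [za zb], lam as [la lb].
    apply injective_projections; simpl; field. }
  assert (char' : forall z, ((Ci * RtoC (MM true true) - z) * (Ci * RtoC (MM false false) - z)
      - (Ci * RtoC (MM true false)) * (Ci * RtoC (MM false true)) = (lamp - z) * (lamm - z))%C).
  { intros z. rewrite M_tt, M_ff, M_tf, M_ft, <- char.
    transitivity ((M11 - z) * (M00 - z) - (RtoC (- (P / M)) * RtoC (- (M / P))) * (M01 * M10))%C; [ring|].
    rewrite MP. ring. }
  assert (shift : Rabs (r5 e) + e * Cmod root < m1).
  { specialize (Hc5 e ltac:(lra)). specialize (Hc6 e ltac:(lra)). rewrite Ae in Hc5, Hc6.
    pose proof (csqrt_le (e_coef N k mu + r6 e)) as S. fold root in S.
    pose proof (Rabs_triang (e_coef N k mu) (r6 e)) as T.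
    pose proof (Rle_abs c5) as Q5. pose proof (Rle_abs c6) as Q6. rewrite pow_1 in Hc6.
    assert (T6 : Rabs (r6 e) <= Rabs c6).
    { eapply Rle_trans; [exact Hc6|]. pose proof (Rabs_pos c6). nra. }
    assert (T5 : Rabs (r5 e) <= Rabs c5 * e).
    { eapply Rle_trans; [exact Hc5|]. pose proof (Rabs_pos c5).
      apply Rle_trans with (Rabs c5 * e ^ 2); [apply Rmult_le_compat_r; nra|].
      apply Rmult_le_compat_l; nra. }
    assert (T7 : e * Cmod root <= e * (1 + Rabs (e_coef N k mu) + Rabs c6))
      by (apply Rmult_le_compat_l; lra).
    assert (T8 : e * Ct < m1).
    { apply (Rmult_lt_compat_r Ct) in e1; auto.
      apply (Rmult_le_compat_r Ct) in B4; [|lra].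
      unfold Rdiv in B4. rewrite Rmult_assoc, Rinv_l, Rmult_1_r in B4 by lra. lra. }
    unfold Ct in T8. nra. }
  assert (near : forall s : C, Cmod s = 1 -> Cmod (lam + Ci * RtoC (r5 e) + s * (RtoC e * root) - z0) < rho).
  { intros s Hs.
    replace (lam + Ci * RtoC (r5 e) + s * (RtoC e * root) - z0)%C
      with ((lam - z0) + (Ci * RtoC (r5 e) + s * (RtoC e * root)))%C by ring.
    eapply Rle_lt_trans; [apply Cmod_triangle|].
    pose proof (Cmod_triangle (Ci * RtoC (r5 e)) (s * (RtoC e * root))) as T.
    rewrite !Cmod_mult, Hs, Cmod_Ci, !Cmod_R, Ae, !Rmult_1_l in T. unfold m1 in shift. lra. }
  assert (lamp_in : Cmod (lamp - z0) < rho).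
  { unfold lamp. replace (RtoC e * root)%C with (1 * (RtoC e * root))%C by ring.
    apply near, Cmod_1. }
  assert (lamm_in : Cmod (lamm - z0) < rho).
  { unfold lamm. replace (lam + Ci * RtoC (r5 e) - RtoC e * root)%C
      with (lam + Ci * RtoC (r5 e) + (-(1)) * (RtoC e * root))%C by ring.
    apply near. rewrite Cmod_opp. apply Cmod_1. }
  assert (smallH : e * H <= dl / 10).
  { apply Rle_trans with (dl / (10 * (H + 1)) * (H + 1)).
    - apply Rmult_le_compat; lra.
    - right. field. lra. }
  assert (far : forall i, (exists t, i = resonant_site t) \/ g - rho <= Cmod (Ci * RtoC (wt i) - z0)).
  { intros i. destruct (gap i) as [?|Gi]; [left; auto|right].
    pose proof (Cmod_triangle (Ci * RtoC (wt i) - z0) (- (lam - z0))) as T. rewrite Cmod_opp in T.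
    replace (Ci * RtoC (wt i) - z0 + - (lam - z0))%C with (Ci * RtoC (wt i - om))%C in T
      by (unfold lam, lambda_plus; fold om; rewrite RtoC_minus; ring).
    rewrite Cmod_mult, Cmod_Ci, Cmod_R, Rmult_1_l in T. unfold m1 in m1p. lra. }
  assert (dlm : dl <= m1 /\ dl <= m2) by (split; [apply Rmin_l|apply Rmin_r]).
  assert (smallP : rho + 5 * (Rabs e * hops_norm h b) < g - rho).
  { rewrite Ae. fold H. unfold m2 in *. lra. }
  pose proof (spectral_space_iff N k mu e b N0 k0 nonint h_bd resonant_site (v e) MM z0 rho (g - rho)
    lamp lamm v_bd v_pt v_inv rho0 far smallP lamp_in lamm_in char') as Viff.
  pose proof (Lop_plane_state N k mu e N0 k0 nonint (v e) MM v_inv) as Lx.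
  pose proof (domL_plane_state N k mu e N0 k0 nonint (v e) MM v_bd v_inv) as Dx.
  pose proof (plane_state_lin N k mu (v e)) as lin.
  split; [|split; [|split]].
  - intros theta. apply (resolvent_set_of_gap N k mu e b N0 k0 nonint h_bd _ dl dl0).
    + intros i. fold wt.
      pose proof (Cmod_mult (RtoC rho) (expi theta)) as Cr.
      rewrite Cmod_R, Cmod_expi, Rabs_pos_eq, Rmult_1_r in Cr by lra.
      replace (Ci * RtoC (wt i) - circle z0 rho theta)%C
        with (- (RtoC rho * expi theta - (Ci * RtoC (wt i) - z0)))%C by (unfold circle; ring).
      rewrite Cmod_opp.
      destruct (far i) as [[t ->]|Fi].
      * pose proof (Cmod_minus_ge (RtoC rho * expi theta) (Ci * RtoC (wt (resonant_site t)) - z0)) as Q.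
        unfold wt in Q |- *. rewrite freq_resonant_site in Q |- * by auto. fold om in Q |- *.
        change (Ci * RtoC om)%C with lam in Q |- *. unfold m1 in dlm. lra.
      * rewrite <- Cmod_opp.
        replace (- (RtoC rho * expi theta - (Ci * RtoC (wt i) - z0)))%C
          with ((Ci * RtoC (wt i) - z0) - RtoC rho * expi theta)%C by ring.
        pose proof (Cmod_minus_ge (Ci * RtoC (wt i) - z0) (RtoC rho * expi theta)) as Q.
        unfold m2 in dlm. lra.
    + rewrite Ae. fold h H. lra.
  - (* unnormalised eigenvectors; the sign gives [b0] and [b1] their signs *)
    set (x0 := fun s : bool => if s then RtoC 0 else RtoC P).
    set (x1 := fun s : bool => if s then RtoC (- M) else RtoC 0).
    exists (plane_state N k mu (v e) x0), (plane_state N k mu (v e) x1).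
    assert (Pn : RtoC P <> 0) by (apply RtoC_neq0; lra).
    assert (Mn : RtoC (- M) <> 0) by (apply RtoC_neq0; lra).
    split; [split|split; [apply Dx|split; [apply Dx|split]]].
    + intros a c E. rewrite lin in E.
      assert (S0 : szero = plane_state N k mu (v e) (fun s => 0 * x0 s + 0 * x0 s)%C).
      { rewrite <- lin. unfold szero, sadd, sscal, fadd, fscal; cbn [fst snd].
        apply injective_projections; extensionality j; cbn [fst snd]; ring. }
      rewrite S0 in E.
      pose proof (plane_state_inj N k mu N0 k0 nonint resonant_site (v e) v_pt _ _ E) as Ex.
      pose proof (Ex true) as Et. pose proof (Ex false) as Ef. unfold x0, x1 in Et, Ef. cbv beta iota in Et, Ef.
      split.
      * replace a with (/ RtoC P * (a * RtoC P + c * 0))%C by (field; auto). rewrite Ef. ring.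
      * replace c with (/ RtoC (- M) * (a * 0 + c * RtoC (- M)))%C by (field; auto). rewrite Et. ring.
    + intros U. unfold V. rewrite Viff. split.
      * intros [x ->]. exists (/ RtoC P * x false)%C, (/ RtoC (- M) * x true)%C.
        rewrite lin. f_equal. extensionality s. destruct s; unfold x0, x1; field; auto.
      * intros (a & c & ->). rewrite lin. eexists; reflexivity.
    + unfold L. rewrite Lx, lin. f_equal. extensionality t. unfold x0, x1. destruct t.
      * transitivity (RtoC P * (Ci * RtoC (MM false true)))%C; [ring|]. rewrite M_ft.
        replace (- (M / P)) with (- M * / P) by (field; lra).
        rewrite RtoC_mult, RtoC_inv by lra. field. auto.
      * transitivity (RtoC P * (Ci * RtoC (MM false false)))%C; [ring|]. rewrite M_ff. ring.
    + unfold L. rewrite Lx, lin. f_equal. extensionality t. unfold x0, x1. destruct t.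
      * transitivity (RtoC (- M) * (Ci * RtoC (MM true true)))%C; [ring|]. rewrite M_tt. ring.
      * transitivity (RtoC (- M) * (Ci * RtoC (MM true false)))%C; [ring|]. rewrite M_tf.
        rewrite Cmult_assoc, <- RtoC_mult. replace (- M * - (P / M)) with P by (field; lra). ring.
  - intros z. rewrite <- (plane_eigenvalue N k mu e N0 k0 nonint resonant_site (v e) MM lamp lamm v_pt v_inv char' z).
    unfold V, L. split.
    + intros (U & HU & Hn & E). apply Viff in HU. destruct HU as [x ->]. exists x; auto.
    + intros (x & Hn & E). exists (plane_state N k mu (v e) x). split; auto.
      apply Viff. exists x; reflexivity.
  - exact char.
Qed.
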